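(* Let $F(x,y)\in\mathbb{Z}[x,y]$ be an irreducible binary form of degree $n\geq 3$ and let $m$ be a positive integer. Let $p_1$ be the smallest prime number $p$ satisfying $$p\geq m^{\frac{8}{n}}(3.5)^4 n^{\frac{2}{n-1}}.$$ Then the inequality $|F(x,y)|\leq m$ has at most $(p_1+1)\left(9n+\frac{4}{n-1}\right)$ primitive solutions.
   Context: A pair $(x,y)\in\mathbb{Z}^2$ is a primitive solution of an inequality in $x,y$ if it satisfies it and $\gcd(x,y)=1$. Solutions $(x,y)$ and $(-x,-y)$ are regarded as one and the same solution when counting. *)

(* Defs.v *)
From HB Require Import structures.
From mathcomp Require Import all_boot all_order all_algebra finmap.
(* Importing all_analysis would clash with the notations of mpoly. *)
From mathcomp Require Import mathcomp_extra boolp classical_sets functions.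
From mathcomp Require Import cardinality reals exp.
From mathcomp Require Import mpoly.

Set Implicit Arguments.
Unset Strict Implicit.
Unset Printing Implicit Defensive.

Import Order.TTheory GRing.Theory Num.Theory.

Local Open Scope ring_scope.
Local Open Scope classical_set_scope.

Definition irreducible_elt (A : idomainType) (a : A) : Prop :=
  [/\ a != 0, a \isn't a GRing.unit
    & forall b c : A, a = b * c ->
        (b \is a GRing.unit) || (c \is a GRing.unit)].

(* A binary form with integer coefficients is called irreducible when it is
   irreducible over the rationals; its content may be different from 1. *)
Definition irreducible_form (F : {mpoly int[2]}) : Prop :=
  irreducible_elt (map_mpoly (intr : int -> rat) F).

Definition form_eval (F : {mpoly int[2]}) (z : int * int) : int :=
  F.@[tnth [tuple z.1; z.2]].

Definition primitive_solutions (F : {mpoly int[2]}) (m : nat) :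
    set (int * int) :=
  [set z | `|form_eval F z| <= m%:Z /\ gcdz z.1 z.2 = 1].

(* The set of the pairs {(x, y), (-x, -y)}: opposite solutions count once. *)
Definition primitive_solutions_upto_sign (F : {mpoly int[2]}) (m : nat) :
    set (set (int * int)) :=
  [set [set z; (- z.1, - z.2)] | z in primitive_solutions F m].

Definition smallest_prime_ge (R : realType) (B : R) (p : nat) : Prop :=
  [/\ prime p, B <= p%:R
    & forall q : nat, prime q -> B <= q%:R -> (p <= q)%N].

(* Main.v *)
Require Import Defs.
From mathcomp Require Import all_boot all_order all_algebra finmap.
From mathcomp Require Import mathcomp_extra boolp classical_sets functions.
From mathcomp Require Import cardinality reals exp.
From mathcomp Require Import complex mpoly.
From mathcomp Require Import ring lra zify.

(** Write F as a product of complex linear forms L_i and let M be the product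
of the larger coefficients of the L_i (the Mahler measure).  The product of the
|det(L_i, L_j)| over i <> j is the absolute discriminant; it is at least 1 and
at most 2^(n(n-1)) M^(2n-2), and it is multiplied by p^(n(n-1)) on a sublattice
of index p.  Put B = (17/2)^n m^4.

Small solutions (0 < y <= B^3): split Z^2 into p + 1 sublattices of index p.
By the choice of p, every basis of every sublattice gives a form with M >= B.
Completing a solution x to a basis (x, x') shows that the gap from x to the next
solution close to the same root grows like |L_i(x') / L_i(x)|, and the product
of these ratios is M / |F(x)| >= B / m.  Hence each sublattice contains fewer
than 8n small solutions (Bombieri-Schmidt, Stewart).

Large solutions (y > T^3, with T >= M and T >= 8^n m^4): the discriminant bound
gives |x - alpha y| <= T^(5(n-1)/4) / y^(n-1) for some root alpha, so that log y
is eventually multiplied by n - 1 from one solution to the next.  Thue's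
method, with an auxiliary polynomial U(X) - Y V(X), forbids long chains, and at
most 26 solutions are attached to each root.

If some form equivalent to F has M <= B both counts apply to it with T = B.
Otherwise take an equivalent form whose M is within a factor 2 of the infimum:
the argument for small solutions then applies directly, without sublattices. *)

Set Implicit Arguments.
Unset Strict Implicit.
Unset Printing Implicit Defensive.

Import Order.TTheory GRing.Theory Num.Theory.
Local Open Scope ring_scope.

(** * The modulus of a complex number *)

(** Two conflicting demands shape the proof: the large solutions want M small, the small ones want M
    large in every basis, and M is not invariant under unimodular substitutions. Hence the two
    cases. The constants balance as follows. A gap loses a factor 3 per root, so a small solution
    contributes B / (3^n m) = (17/6)^n m^3. Since (17/6)^7 > (17/2)^3, 7n such factors overshoot the
    height bound B^3; n more solutions, the last one near each root, have no successor. Sublattices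
    of index p have M^2 >= (p/2)^n, so p must satisfy B^2 <= (p/2)^n, which (7/2)^4 > 150 and 75 >
    (17/2)^2 provide. As 17/2 > 8, T = B also serves for the large solutions. The large solutions
    are counted once and not per sublattice: their 26n, and one possible solution with y = 0, fit
    into the n(p + 1) that separates 8n(p + 1) from 9n(p + 1), because p >= 150. *)

Section Modulus.
Variable R : realType.

(** The norm of [R[i]] takes its values in [R[i]]; the estimates need a real number. *)
Definition modulus (z : R[i]) : R := Normc.normc z.

Lemma modulus_ge0 z : 0 <= modulus z.
Proof. by case: z => a b; rewrite /modulus /= sqrtr_ge0. Qed.

Lemma modulus0 : modulus 0 = 0.
Proof. exact: Normc.normc0. Qed.

Lemma modulus1 : modulus 1 = 1.
Proof. exact: Normc.normc1. Qed.

Lemma modulus_eq0 z : (modulus z == 0) = (z == 0).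
Proof.
apply/eqP/eqP => [|->]; last exact: modulus0.
exact: Normc.eq0_normc.
Qed.

Lemma modulus_gt0 z : (0 < modulus z) = (z != 0).
Proof. by rewrite lt_neqAle modulus_ge0 andbT eq_sym modulus_eq0. Qed.

Lemma modulusM x y : modulus (x * y) = modulus x * modulus y.
Proof. exact: Normc.normcM. Qed.

Lemma modulusX x n : modulus (x ^+ n) = modulus x ^+ n.
Proof.
elim: n => [|n IHn]; first by rewrite !expr0 modulus1.
by rewrite !exprS modulusM IHn.
Qed.

Lemma modulusV x : modulus x^-1 = (modulus x)^-1.
Proof. exact: Normc.normcV. Qed.

Lemma modulusN x : modulus (- x) = modulus x.
Proof. exact: normcN. Qed.

Lemma modulusB x y : modulus (x - y) = modulus (y - x).
Proof. by rewrite -modulusN opprB. Qed.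

Lemma ler_modulusD x y : modulus (x + y) <= modulus x + modulus y.
Proof. exact: le_normcD. Qed.

Lemma ler_modulusBD x y : modulus (x - y) <= modulus x + modulus y.
Proof. by rewrite -(modulusN y) ler_modulusD. Qed.

Lemma ler_modulus_sum (I : Type) (r : seq I) (P : pred I) (F : I -> R[i]) :
  modulus (\sum_(i <- r | P i) F i) <= \sum_(i <- r | P i) modulus (F i).
Proof.
elim/big_rec2: _ => [|i y x _ IH]; first by rewrite modulus0.
by apply: le_trans (ler_modulusD _ _) _; rewrite lerD2l.
Qed.

Lemma modulus_prod (I : Type) (r : seq I) (P : pred I) (F : I -> R[i]) :
  modulus (\prod_(i <- r | P i) F i) = \prod_(i <- r | P i) modulus (F i).
Proof. by apply: (big_morph _ modulusM modulus1). Qed.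

Lemma modulus_real (x : R) : modulus x%:C%C = `|x|.
Proof. by rewrite /modulus /= expr0n addr0 sqrtr_sqr. Qed.

Lemma modulus_nat (k : nat) : modulus k%:R = k%:R.
Proof. by rewrite -(rmorph_nat (@real_complex R)) modulus_real normr_nat. Qed.

Lemma modulus_int (k : int) : modulus k%:~R = `|k|%:~R.
Proof.
by rewrite -(rmorph_int (@real_complex R)) modulus_real intr_norm.
Qed.

Lemma modulus_int_ge1 (k : int) : k != 0 -> 1 <= modulus k%:~R.
Proof. by move=> k0; rewrite modulus_int ler1z -gtz0_ge1 normr_gt0. Qed.

End Modulus.

(** * Binary forms evaluated through polynomials in one variable *)

Section HomogeneousEvaluation.
Variable A : comNzRingType.
Implicit Types (f g : {poly A}) (u v : A).

(* The value at [(u, v)] of the binary form of degree [n] whose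
   dehomogenization is [f]; coefficients of [f] beyond [n] are ignored. *)
Definition hev (n : nat) f u v : A := \sum_(k < n.+1) f`_k * (u ^+ k * v ^+ (n - k)).

Lemma hevD n f g u v : hev n (f + g) u v = hev n f u v + hev n g u v.
Proof. by rewrite -big_split; apply: eq_bigr => k _; rewrite coefD mulrDl. Qed.

Lemma hevZ n c f u v : hev n (c *: f) u v = c * hev n f u v.
Proof. by rewrite mulr_sumr; apply: eq_bigr => k _; rewrite coefZ mulrA. Qed.

Lemma hev0 n u v : hev n 0 u v = 0.
Proof. by rewrite /hev big1 // => k _; rewrite coef0 mul0r. Qed.

Lemma hev_sum (I : Type) (r : seq I) (P : pred I) (F : I -> {poly A}) n u v :
  hev n (\sum_(i <- r | P i) F i) u v = \sum_(i <- r | P i) hev n (F i) u v.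
Proof. by apply: (big_morph (fun f => hev n f u v)) => [f g|]; rewrite ?hevD ?hev0. Qed.

Lemma hev_horner n f u : (size f <= n.+1)%N -> hev n f u 1 = f.[u].
Proof.
move=> sf; rewrite (horner_coef_wide _ sf).
by apply: eq_bigr => k _; rewrite expr1n mulr1.
Qed.

Lemma hev1 n u v : hev n 1 u v = v ^+ n.
Proof.
rewrite /hev big_ord_recl big1 ?addr0 => [|k _]; last by rewrite coef1 mul0r.
by rewrite coef1 expr0 subn0 !mul1r.
Qed.

Lemma hev_scale n f c u v : hev n f (c * u) (c * v) = c ^+ n * hev n f u v.
Proof.
rewrite mulr_sumr; apply: eq_bigr => k _; rewrite !exprMn.
have -> : c ^+ n = c ^+ k * c ^+ (n - k) by rewrite -exprD subnKC // -ltnS.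
by ring.
Qed.

Lemma hev_widen n j f u v : (size f <= n.+1)%N ->
  hev (n + j) f u v = v ^+ j * hev n f u v.
Proof.
move=> sf; rewrite /hev -(big_mkord xpredT (fun k => f`_k * (u ^+ k * v ^+ (n + j - k)))).
rewrite (@big_cat_nat _ _ _ n.+1) //= ?ltnS ?leq_addr // [X in _ + X]big_nat_cond.
rewrite [X in _ + X]big1 ?addr0 => [|k /andP[/andP[nk _] _]]; last first.
  by rewrite nth_default ?mul0r // (leq_trans sf).
rewrite big_mkord mulr_sumr; apply: eq_bigr => k _.
have kn : (k <= n)%N by rewrite -ltnS.
by rewrite addnC -addnBA // exprD; ring.
Qed.

Lemma hev_MXaddC n f c u v :
  hev n.+1 (f * 'X + c%:P) u v = u * hev n f u v + c * v ^+ n.+1.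
Proof.
rewrite /hev big_ord_recl coefD coefMX coefC /= expr0 subn0 add0r mul1r addrC.
congr (_ + _); rewrite mulr_sumr; apply: eq_bigr => k _.
by rewrite coefD coefMX coefC /= /bump /= add0n addr0 exprS subSS; ring.
Qed.

Lemma hevM d e f g u v : (size f <= d.+1)%N -> (size g <= e.+1)%N ->
  hev (d + e) (f * g) u v = hev d f u v * hev e g u v.
Proof.
elim/poly_ind: f d => [|f c IHf] d; first by rewrite mul0r !hev0 mul0r.
move=> sf sg; case: d sf => [|d] sf.
  rewrite (size1_polyC sf); set b := _`_0.
  rewrite mul_polyC hevZ add0n /hev big_ord1 coefC /= !expr0.
  by ring.
have sf' : (size f <= d.+1)%N.
  by move: sf; rewrite size_MXaddC; case: ifP => // /andP[/eqP -> _]; rewrite size_poly0.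
rewrite mulrDl mulrAC mul_polyC addSn.
have -> : f * g * 'X + c *: g = f * g * 'X + 0%:P + c *: g by rewrite polyC0 addr0.
rewrite hevD hev_MXaddC mul0r addr0 hevZ IHf // hev_MXaddC -addSn addnC hev_widen //.
by ring.
Qed.

Lemma hevX d f k u v : (size f <= d.+1)%N ->
  hev (d * k) (f ^+ k) u v = hev d f u v ^+ k.
Proof.
move=> sf; elim: k => [|k IHk]; first by rewrite muln0 !expr0 hev1 expr0.
rewrite mulnS !exprS hevM ?IHk //.
apply: leq_trans (size_poly_exp_leq _ _) _; rewrite ltnS leq_mul2r.
by rewrite orbC; move: sf; case: (size f) => //= i; rewrite ltnS => ->.
Qed.

End HomogeneousEvaluation.

Lemma hev_map (A B : comNzRingType) (h : {rmorphism A -> B}) n (f : {poly A}) u v :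
  hev n (map_poly h f) (h u) (h v) = h (hev n f u v).
Proof.
rewrite rmorph_sum; apply: eq_bigr => k _.
by rewrite coef_map !rmorphM !rmorphXn.
Qed.

(** * Binary forms and their dehomogenizations *)

(* The roots of [f] have degree exactly [n], i.e. [f] is, up to a constant,
   their minimal polynomial. *)
Definition minimal_at_roots (R : realType) (f : {poly int}) (n : nat) : Prop :=
  size f = n.+1 /\
  forall (z : R[i]) (g : {poly int}),
    root (map_poly intr f) z -> root (map_poly intr g) z ->
    (size g <= n)%N -> g = 0.

Lemma hev00 (A : comNzRingType) n (f : {poly A}) : (0 < n)%N -> hev n f 0 0 = 0.
Proof.
move=> n0; rewrite /hev big1 // => k _; rewrite !expr0n.
have [->|k0] := eqVneq (k : nat) 0%N; last by rewrite mul0r mulr0.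
by rewrite subn0 (gtn_eqF n0) !mulr0.
Qed.

Definition mon2 (n k : nat) : 'X_{1..2} :=
  [multinom (if i == ord0 then k else n - k)%N | i < 2].

Lemma mdeg2 (m : 'X_{1..2}) : mdeg m = (m ord0 + m ord_max)%N.
Proof.
rewrite mdegE big_ord_recl big_ord1; congr (_ + m _)%N; exact/val_inj.
Qed.

Lemma mon2_eq n k (m : 'X_{1..2}) : (k <= n)%N ->
  (mon2 n k == m) = (mdeg m == n) && (k == m ord0).
Proof.
move=> kn; rewrite mdeg2; apply/eqP/andP => [<-|[/eqP mn /eqP mk]].
  by rewrite !mnmE /=; split; rewrite ?subnKC.
apply/mnmP => i; rewrite mnmE; case: ifP => [/eqP -> //|].
case: i => [[|[|i]]] //= Hi _; rewrite -mn mk addKn; congr (m _); exact/val_inj.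
Qed.

Lemma homog_hev (A : comNzRingType) n (G : {mpoly A[2]}) : G \is n.-homog ->
  G = hev n (map_poly (@mpolyC 2 A) (\poly_(k < n.+1) G@_(mon2 n k)))
        'X_ord0 'X_ord_max.
Proof.
move=> hG; rewrite /hev; transitivity (\sum_(k < n.+1) G@_(mon2 n k) *: 'X_[mon2 n k]).
  apply/mpolyP => m; rewrite linear_sum /=.
  have [mn|mn] := eqVneq (mdeg m) n; last first.
    rewrite (dhomog_nemf_coeff hG mn) big1 // => k _.
    by rewrite mcoeffZ mcoeffX mon2_eq ?(negPf mn) ?mulr0 // -ltnS.
  have m0 : (m ord0 < n.+1)%N by rewrite ltnS -mn mdeg2 leq_addr.
  rewrite (bigD1 (Ordinal m0)) //= big1 => [|k /negPf kn]; last first.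
    rewrite mcoeffZ mcoeffX mon2_eq; last by rewrite -ltnS.
    rewrite mn eqxx /=.
    by move: kn; rewrite -val_eqE /= => ->; rewrite mulr0.
  have /eqP E : mon2 n (m ord0) == m by rewrite mon2_eq ?mn ?eqxx // -ltnS.
  by rewrite addr0 mcoeffZ mcoeffX E eqxx mulr1.
apply: eq_bigr => k _; rewrite coef_map coef_poly ltn_ord /= mul_mpolyC; congr (_ *: _).
rewrite mpolyXE_id big_ord_recl big_ord1 !mnmE /=; congr (_ * 'X_ _ ^+ _); exact/val_inj.
Qed.

(** Irreducibility over the rationals enters twice. If the coefficient of x^n vanished, y would
    divide the form; and an integer polynomial of lower degree sharing a root with [f] would give,
    by a gcd over the rationals, a proper factor of [f], which homogenizes to a factor of [F]. *)
Lemma dehomogenization (R : realType) n (F : {mpoly int[2]}) :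
  (1 < n)%N -> F \is n.-homog -> irreducible_form F ->
  exists2 f : {poly int}, minimal_at_roots R f n
    & forall z, form_eval F z = hev n f z.1 z.2.
Proof.
move=> n1 hF [FQ0 _ FQirr].
set f := \poly_(k < n.+1) F@_(mon2 n k).
have FE : F = hev n (map_poly (@mpolyC 2 int) f) 'X_ord0 'X_ord_max := homog_hev hF.
pose fQ : {poly rat} := map_poly intr f.
have FQE : map_mpoly (intr : int -> rat) F
    = hev n (map_poly (@mpolyC 2 rat) fQ) 'X_ord0 'X_ord_max.
  rewrite {1}FE -(@hev_map _ _ (map_mpoly (intr : int -> rat))) /= !map_mpolyX; congr (hev _ _ _ _).
  by rewrite -!map_poly_comp; apply: eq_map_poly => c /=; rewrite map_mpolyC.
(* Evaluation at the origin sends units to units but kills every form of positive degree. *)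
have nonunit d (g : {poly rat}) : (0 < d)%N ->
    hev d (map_poly (@mpolyC 2 rat) g) 'X_ord0 'X_ord_max \isn't a GRing.unit.
  move=> d0; apply/negP => /(rmorph_unit (meval (fun=> 0 : rat))).
  rewrite /= -(@hev_map _ _ (meval (fun=> 0 : rat))) /= !mevalXU hev00 //.
have sf : (size f <= n.+1)%N by rewrite size_poly.
have fn0 : f`_n != 0.
  apply/eqP => fn0.
  (* The first factor is y, written as the form of degree 1 attached to the constant 1. *)
  have E : map_mpoly (intr : int -> rat) F =
      hev 1 (map_poly (@mpolyC 2 rat) 1) 'X_ord0 'X_ord_max
      * hev n.-1 (map_poly (@mpolyC 2 rat) fQ) 'X_ord0 'X_ord_max.
    rewrite rmorph1 hev1 -hev_widen; last first.
      apply/leq_sizeP => j nj; rewrite !coef_map /=.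
      have [->|jn] := eqVneq j n; first by rewrite fn0.
      by rewrite (leq_sizeP f n.+1 _ j) //; lia.
    by rewrite addn1 prednK ?FQE // ltnW.
  have n10 : (0 < n.-1)%N by lia.
  have /orP[U|U] := FQirr _ _ E.
    exact: (negP (nonunit 1%N 1 isT) U).
  exact: (negP (nonunit n.-1 fQ n10) U).
have szf : size f = n.+1.
  apply/eqP; rewrite eqn_leq sf /= ltnNge; apply/negP => /leq_sizeP H.
  by rewrite H // eqxx in fn0.
exists f; last first.
  move=> z; rewrite /form_eval {1}FE -(@hev_map _ _ (meval (tnth [tuple z.1; z.2]))) /= !mevalXU.
  congr (hev _ _ _ _).
  by rewrite -map_poly_comp map_poly_id // => c _ /=; rewrite mevalC.
split=> // z g fz gz sg; apply/eqP/negPn/negP => g0.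
have inj_intr (p : {poly int}) : map_poly (intr : int -> R[i]) p
    = map_poly (@ratr R[i]) (map_poly intr p).
  by rewrite -map_poly_comp; apply: eq_map_poly => c /=; rewrite ratr_int.
pose gQ : {poly rat} := map_poly intr g.
have sgQ : size gQ = size g by rewrite size_map_inj_poly //; exact: intr_inj.
have sfQ : size fQ = n.+1 by rewrite size_map_inj_poly //; exact: intr_inj.
pose d := gcdp fQ gQ.
have dz : root (map_poly ratr d) z.
  by rewrite gcdp_map root_gcd -!inj_intr fz gz.
have gQ0 : gQ != 0 by rewrite -size_poly_eq0 sgQ size_poly_eq0.
have fQ0 : fQ != 0 by rewrite -size_poly_eq0 sfQ.
have d0 : d != 0 by rewrite gcdp_eq0 negb_and fQ0.
have sd : (1 < size d)%N.
  rewrite -(size_map_poly (@ratr R[i])).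
  by apply: root_size_gt1 dz; rewrite map_poly_eq0.
have sdn : (size d <= n)%N.
  by apply: leq_trans sg; rewrite -sgQ dvdp_leq ?dvdp_gcdr.
have /dvdpP[e fde] : d %| fQ by rewrite dvdp_gcdl.
have e0 : e != 0 by apply: contra_neq fQ0; rewrite fde => ->; rewrite mul0r.
have ses : (size e + size d)%N = n.+2.
  have sz : n.+1 = (size e + size d).-1 by rewrite -(size_mul e0 d0) -fde.
  by rewrite sz prednK // addn_gt0 size_poly_gt0 e0.
have aux a b : (a + b = n.+2 -> b <= n -> 1 < b ->
    [/\ 0 < a.-1, 0 < b.-1, a.-1.+1 = a, b.-1.+1 = b & a.-1 + b.-1 = n])%N.
  by clear; move=> *; split; lia.
have [e1 d1 eS dS edn] := aux _ _ ses sdn sd.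
have E : map_mpoly (intr : int -> rat) F =
    hev (size e).-1 (map_poly (@mpolyC 2 rat) e) 'X_ord0 'X_ord_max
    * hev (size d).-1 (map_poly (@mpolyC 2 rat) d) 'X_ord0 'X_ord_max.
  by rewrite -hevM ?eS ?dS ?size_poly // -rmorphM /= -fde edn FQE.
have /orP[U|U] := FQirr _ _ E.
  exact: (negP (nonunit _ e e1) U).
exact: (negP (nonunit _ d d1) U).
Qed.

(** * Linear substitutions in binary forms *)

Section Substitution.
Variable A : comNzRingType.

(* Dehomogenization of the form F(p x + q y, r x + s y). *)
Definition subst_form n (f : {poly A}) (p q r s : A) : {poly A} :=
  hev n (map_poly polyC f) (p *: 'X + q%:P) (r *: 'X + s%:P).

Lemma size_lin (p q : A) : (size (p *: 'X + q%:P)%R <= 2)%N.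
Proof.
apply: leq_trans (size_polyD _ _) _; rewrite geq_max.
rewrite (leq_trans (size_scale_leq _ _)) ?size_polyX //.
by rewrite (leq_trans (size_polyC_leq1 _)).
Qed.

Lemma hev_lin (p q x y : A) : hev 1 (p *: 'X + q%:P) x y = p * x + q * y.
Proof.
have -> : p *: 'X + q%:P = (p%:P) * 'X + q%:P :> {poly A} by rewrite mul_polyC.
by rewrite (hev_MXaddC 0) /hev big_ord1 coefC /= !expr0; ring.
Qed.

Lemma size_subst_form n f p q r s : (size (subst_form n f p q r s) <= n.+1)%N.
Proof.
apply: leq_trans (size_sum _ _ _) _; apply/bigmax_leqP => k _.
rewrite coef_map /= mul_polyC (leq_trans (size_scale_leq _ _)) //.
apply: leq_trans (size_polyMleq _ _) _.
have kn : (k <= n)%N by rewrite -ltnS.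
have H (g : {poly A}) j : (size g <= 2)%N -> (size (g ^+ j) <= j.+1)%N.
  move=> sg; apply: leq_trans (size_poly_exp_leq _ _) _; rewrite ltnS.
  by rewrite -[leqRHS]mul1n leq_mul2r; case: (size g) sg => [|[|[|]]] //=; rewrite ?orbT.
apply: (@leq_trans (k.+1 + (n - k).+1).-1); last by rewrite addSn addnS subnKC.
by rewrite -!subn1 leq_sub2r // leq_add // H // size_lin.
Qed.

Lemma hev_subst_form n f p q r s x y :
  hev n (subst_form n f p q r s) x y = hev n f (p * x + q * y) (r * x + s * y).
Proof.
rewrite /subst_form [hev n (map_poly _ _) _ _]/hev hev_sum; apply: eq_bigr => k _.
have kn : (k <= n)%N by rewrite -ltnS.
rewrite coef_map /= mul_polyC hevZ; congr (_ * _).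
have H (g : {poly A}) j : (size g <= 2)%N -> (size (g ^+ j) <= j.+1)%N.
  move=> sg; apply: leq_trans (size_poly_exp_leq _ _) _; rewrite ltnS.
  by rewrite -[leqRHS]mul1n leq_mul2r; case: (size g) sg => [|[|[|]]] //=; rewrite ?orbT.
transitivity (hev (k + (n - k)) ((p *: 'X + q%:P) ^+ k * (r *: 'X + s%:P) ^+ (n - k)) x y).
  by rewrite subnKC.
rewrite hevM ?H ?size_lin //.
by have := @hevX _ 1 _ _ x y (size_lin p q) => /(_ k); rewrite mul1n => ->;
   have := @hevX _ 1 _ _ x y (size_lin r s) => /(_ (n - k)%N); rewrite mul1n => ->;
   rewrite !hev_lin.
Qed.

Lemma horner_subst_form n f p q r s x :
  (subst_form n f p q r s).[x] = hev n f (p * x + q) (r * x + s).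
Proof. by rewrite -(hev_horner _ (size_subst_form _ _ _ _ _ _)) hev_subst_form !mulr1. Qed.

End Substitution.

Lemma map_subst_form (A B : comNzRingType) (h : {rmorphism A -> B}) n f p q r s :
  map_poly h (subst_form n f p q r s) = subst_form n (map_poly h f) (h p) (h q) (h r) (h s).
Proof.
rewrite /subst_form -hev_map !rmorphD /= !map_polyZ /= !map_polyX !map_polyC /=.
congr (hev _ _ _ _).
by rewrite -!map_poly_comp; apply: eq_map_poly => c /=; rewrite map_polyC.
Qed.

Section FormNeq0.
Variables (R : realType) (n : nat) (f : {poly int}).
Hypotheses (n1 : (1 < n)%N) (hf : minimal_at_roots R f n).

(** A zero with y nonzero would make x / y a root of [f], killed by y X - x of degree 1 < n; for y =
    0 the value is the leading coefficient times x^n. *)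
Lemma hev_neq0 (x y : int) : (x, y) != (0, 0) -> hev n f x y != 0.
Proof.
have [sf mf] := hf; move=> xy0; apply/eqP => H.
have lf0 : f`_n != 0.
  have -> : n = (size f).-1 by rewrite sf.
  by rewrite -lead_coefE lead_coef_eq0 -size_poly_eq0 sf.
have [y0|y0] := eqVneq y 0.
  move: H; rewrite y0 /hev big_ord_recr big1 /= => [|k _]; last first.
    by rewrite expr0n subn_eq0 leqNgt ltn_ord !mulr0.
  rewrite add0r subnn expr0 mulr1 => /eqP; rewrite mulf_eq0 (negPf lf0) /= expf_eq0.
  by case/andP => _ /eqP x0; move: xy0; rewrite x0 y0 eqxx.
have yC : y%:~R != 0 :> R[i] by rewrite intr_eq0.
suff H0 : y *: 'X - x%:P = 0 :> {poly int}.
  have : (y *: 'X - x%:P)`_1 = 0 :> int by rewrite H0 coef0.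
  by rewrite coefB coefZ coefX coefC /= subr0 mulr1 => /eqP; rewrite (negPf y0).
apply: (mf (x%:~R / y%:~R)).
- rewrite /root -(@hev_horner _ n) ?size_map_inj_poly ?sf //; last exact: intr_inj.
  have := @hev_scale _ n (map_poly intr f) y%:~R (x%:~R / y%:~R : R[i]) 1.
  rewrite mulrCA divff // !mulr1 (@hev_map _ _ intr) H => /esym/eqP.
  by rewrite mulf_eq0 expf_eq0 (negPf yC) andbF.
- rewrite /root rmorphB /= map_polyZ /= map_polyX map_polyC /=.
  by rewrite hornerD hornerN hornerZ hornerX hornerC mulrCA divff // mulr1 subrr.
- by rewrite -polyCN (leq_trans (size_lin _ _)).
Qed.

(** A polynomial [g] vanishing at z is pulled back by the adjugate matrix to one vanishing at the
    image of z, a root of [f]. That one is zero by minimality, and substituting back recovers [g] up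
    to a power of the determinant. *)
Lemma minimal_subst_form (p q r s : int) : p * s - q * r != 0 ->
  minimal_at_roots R (subst_form n f p q r s) n.
Proof.
have [sf mf] := hf; move=> det0; split.
  apply/eqP; rewrite eqn_leq size_subst_form ltnNge; apply/negP => /leq_sizeP H.
  have : hev n (subst_form n f p q r s) 1 0 = 0.
    rewrite /hev big1 // => k _; have [kn|kn] := eqVneq (k : nat) n.
      by rewrite kn H // mul0r.
    by rewrite expr0n subn_eq0 leqNgt ltn_neqAle kn -ltnS ltn_ord /= !mulr0.
  rewrite hev_subst_form !mulr1 !mulr0 !addr0 => /eqP; apply/negP.
  apply: hev_neq0; apply: contraNneq det0 => -[-> ->].
  by rewrite mul0r mulr0 subr0.
move=> z g; rewrite /root map_subst_form horner_subst_form.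
set X := _ * z + _; set Y := _ * z + _ => /eqP fz /eqP gz sg.
have detC : (p * s - q * r)%:~R != 0 :> R[i] by rewrite intr_eq0.
(* If the denominator vanished, so would the numerator, and (z, 1) would lie in the kernel of an
   invertible matrix. *)
have Y0 : Y != 0.
  apply: contraNneq detC => Y0; move: fz; rewrite Y0 /hev big_ord_recr big1 /= => [|k _]; last first.
    by rewrite expr0n subn_eq0 leqNgt ltn_ord !mulr0.
  rewrite add0r subnn expr0 mulr1 coef_map /= => /eqP.
  rewrite mulf_eq0 intr_eq0.
  have -> : f`_n = lead_coef f by rewrite lead_coefE sf.
  rewrite lead_coef_eq0 -size_poly_eq0 sf /= expf_eq0 => /andP[_ /eqP X0].
  have sE : s%:~R = - (r%:~R * z) :> R[i] by apply/eqP; rewrite -addr_eq0 addrC; apply/eqP.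
  have qE : q%:~R = - (p%:~R * z) :> R[i] by apply/eqP; rewrite -addr_eq0 addrC; apply/eqP.
  by rewrite rmorphB /= !rmorphM /= sE qE; apply/eqP; ring.
pose G := subst_form n.-1 g s (- q) (- r) p.
have sG : (size G <= n)%N by rewrite (leq_trans (size_subst_form _ _ _ _ _ _)) // prednK // ltnW.
have G0 : G = 0.
  apply: (mf (X / Y)) => //.
    rewrite /root -(@hev_horner _ n) ?size_map_inj_poly ?sf //; last exact: intr_inj.
    have := @hev_scale _ n (map_poly intr f) Y (X / Y) 1.
    rewrite mulrCA divff // !mulr1 fz => /esym/eqP.
    by rewrite mulf_eq0 expf_eq0 (negPf Y0) andbF.
  rewrite /root map_subst_form horner_subst_form !rmorphN /=.
  have -> : s%:~R * (X / Y) + - q%:~R = (p * s - q * r)%:~R / Y * z.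
    transitivity ((s%:~R * X - q%:~R * Y) / Y); first by field.
    by rewrite mulrAC; congr (_ / _); rewrite rmorphB /= !rmorphM /= /X /Y; ring.
  have -> : - r%:~R * (X / Y) + p%:~R = (p * s - q * r)%:~R / Y * 1.
    transitivity ((p%:~R * Y - r%:~R * X) / Y); first by field.
    by rewrite mulr1; congr (_ / _); rewrite rmorphB /= !rmorphM /= /X /Y; ring.
  rewrite hev_scale hev_horner ?gz ?mulr0 //.
  by rewrite prednK ?(leq_trans (size_poly _ _)) // ltnW.
have gev (x : int) : g.[x] = 0.
  have := @hev_subst_form _ n.-1 g s (- q) (- r) p (p * x + q) (r * x + s).
  rewrite -/G G0 hev0.
  have -> : s * (p * x + q) + - q * (r * x + s) = (p * s - q * r) * x by ring.
  have -> : - r * (p * x + q) + p * (r * x + s) = (p * s - q * r) * 1 by ring.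
  rewrite hev_scale hev_horner ?prednK // => [|]; last by rewrite ltnW.
  by move=> /esym/eqP; rewrite mulf_eq0 expf_eq0 (negPf det0) andbF /= => /eqP.
apply/eqP/negPn/negP => g0.
have := @max_poly_roots _ g [seq (i%:Z) | i <- iota 0 (size g)] g0.
rewrite size_map size_iota ltnn => H; apply: notF; apply: H.
  by apply/allP => _ /mapP[i _ ->]; rewrite /root gev.
by rewrite map_inj_uniq ?iota_uniq // => i j [].
Qed.

End FormNeq0.

(** * Multiplicities and Wronskians *)

Section Taylor.

Lemma poly_taylor (A : comNzRingType) (p : {poly A}) (a : A) :
  p = \sum_(i < size p) p^`N(i).[a] *: ('X - a%:P) ^+ i.
Proof.
rewrite -{1}(comp_polyXr p) /comp_poly -[X in _.[X]](subrK a%:P) addrC.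
rewrite nderiv_taylor; last exact: mulrC.
rewrite size_map_inj_poly ?polyC0 //; last exact: polyC_inj.
by apply: eq_bigr => i _; rewrite nderivn_map horner_map /= mul_polyC.
Qed.

Lemma dvdp_nderivn (K : fieldType) (p : {poly K}) (a : K) (k : nat) :
  (forall h, (h < k)%N -> p^`N(h).[a] = 0) -> ('X - a%:P) ^+ k %| p.
Proof.
move=> H; rewrite {1}(poly_taylor p a).
elim/big_ind: _ => [|x y|i _]; [exact: dvdp0|exact: dvdp_add|].
have [ik|ki] := ltnP i k; first by rewrite H // scale0r dvdp0.
by rewrite -mul_polyC dvdp_mull // dvdp_exp2l.
Qed.

Lemma nderivn_neq0 (K : fieldType) (p : {poly K}) (a : K) : p != 0 ->
  exists2 l, p^`N(l).[a] != 0 & forall h, (h < l)%N -> p^`N(h).[a] = 0.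
Proof.
move=> p0; have ex : exists l, p^`N(l).[a] != 0.
  apply: contrapT => H; move/eqP: p0; apply.
  rewrite (poly_taylor p a) big1 // => i _.
  have [->|nz] := eqVneq (p^`N(i).[a]) 0; first by rewrite scale0r.
  by case: H; exists i.
case: (ex_minnP ex) => l nz lmin; exists l => // h hl.
by apply/eqP; apply: contraTT hl => /lmin; rewrite -leqNgt.
Qed.

(** Orders of vanishing are measured by divided derivatives: they keep coefficients integral and
    enlarge them by at most 2^N for polynomials of size N. Multiplying by i! j! k! turns the
    binomials into factorials. *)
Lemma nderivn_nderivn (A : comNzRingType) (p : {poly A}) i j :
  p^`N(i)^`N(j) = p^`N(i + j) *+ 'C(i + j, i).
Proof.
apply/polyP => k; rewrite coefMn !coef_nderivn -!mulrnA addnA; congr (_ *+ _).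
have fpos : (0 < i`! * (j`! * k`!))%N by rewrite !muln_gt0 !fact_gt0.
apply/eqP; rewrite -(eqn_pmul2r fpos); apply/eqP.
have E1 : ('C(i + j + k, i) * (i`! * (j + k)`!) = (i + j + k)`!)%N.
  by rewrite -addnA -(@bin_fact (i + (j + k)) i) ?leq_addr // addKn.
have E2 : ('C(j + k, j) * (j`! * k`!) = (j + k)`!)%N.
  by rewrite -(@bin_fact (j + k) j) ?leq_addr // addKn.
have E3 : ('C(i + j + k, i + j) * ((i + j)`! * k`!) = (i + j + k)`!)%N.
  by rewrite -(@bin_fact (i + j + k) (i + j)) ?leq_addr // addKn.
have E4 : ('C(i + j, i) * (i`! * j`!) = (i + j)`!)%N.
  by rewrite -(@bin_fact (i + j) i) ?leq_addr // addKn.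
transitivity (i + j + k)`!; first by rewrite -E1 -E2; ring.
by rewrite -E3 -E4; ring.
Qed.

Lemma lead_coef_deriv (p : {poly int}) :
  lead_coef p^`() = lead_coef p *+ (size p).-1.
Proof.
have [sp|sp] := leqP (size p) 1.
  by rewrite {1}(size1_polyC sp) derivC lead_coef0; case: (size p) sp => [|[|]].
have E : p^`()`_(size p).-2 = lead_coef p *+ (size p).-1.
  by rewrite coef_deriv lead_coefE; case: (size p) sp => [|[|k]].
have p0 : p != 0 by rewrite -size_poly_gt0 ltnW.
have nz : p^`()`_(size p).-2 != 0.
  rewrite E mulrn_eq0 negb_or lead_coef_eq0 p0 andbT.
  by case: (size p) sp => [|[|k]].
suff szd : size p^`() = (size p).-1 by rewrite lead_coefE szd.
apply/eqP; rewrite eqn_leq; apply/andP; split.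
  by rewrite -ltnS prednK ?lt_size_deriv // ltnW.
rewrite leqNgt; apply/negP => lt; move: nz; rewrite nth_default ?eqxx //.
by move: lt; case: (size p) sp => [|[|k]] //= _; rewrite ltnS.
Qed.

(* Compare the leading terms of both products. *)
Lemma wronskian0 (U V : {poly int}) : V != 0 -> U * V^`() - U^`() * V = 0 ->
  lead_coef V *: U = U`_(size V).-1 *: V.
Proof.
move=> V0 W0; set c := lead_coef V; set d := U`_ _.
pose P := c *: U - d *: V.
have PW : P * V^`() = P^`() * V.
  apply/eqP; rewrite -subr_eq0 /P derivB !derivZ.
  have -> : (c *: U - d *: V) * V^`() - (c *: U^`() - d *: V^`()) * V
     = c *: (U * V^`() - U^`() * V) by rewrite -!mul_polyC; ring.
  by rewrite W0 scaler0.
apply/eqP; rewrite -subr_eq0 -/P; apply/negPn/negP => P0.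
have := congr1 lead_coef PW; rewrite !lead_coefM !lead_coef_deriv.
have lP : lead_coef P != 0 by rewrite lead_coef_eq0.
have lV : lead_coef V != 0 by rewrite lead_coef_eq0.
rewrite mulrnAr mulrnAl => /(mulrIn (mulf_neq0 lP lV)) E.
have : P`_(size V).-1 = 0.
  by rewrite /P coefB !coefZ -/d -lead_coefE -/c; ring.
by rewrite E -lead_coefE => /eqP; rewrite (negPf lP).
Qed.

End Taylor.

(* Gauss's lemma: a primitive linear factor divides with integral quotient. *)
Lemma multiplicity_lead_coef (W : {poly int}) (x y : int) (e : nat) :
  W != 0 -> 0 < y -> coprimez x y ->
  ('X - (x%:~R / y%:~R)%:P) ^+ e %| map_poly (intr : int -> rat) W ->
  y ^+ e <= `|lead_coef W|.
Proof.
move=> W0 y0 cxy dvW.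
pose L : {poly int} := y *: 'X - x%:P.
have lL : lead_coef L = y.
  rewrite lead_coefDl ?lead_coefZ ?lead_coefX ?mulr1 //.
  by rewrite size_polyN size_scale ?gt_eqF // size_polyX (leq_ltn_trans (size_polyC_leq1 _)).
have yQ : (y%:~R : rat) != 0 by rewrite intr_eq0 gt_eqF.
have LQ : map_poly (intr : int -> rat) L = y%:~R *: ('X - (x%:~R / y%:~R)%:P).
  rewrite rmorphB /= map_polyZ /= map_polyX map_polyC /= scalerBr.
  by congr (_ - _); rewrite -mul_polyC -polyCM mulrC divfK.
(* The content divides gcd(x, y) = 1, and its sign is that of the leading coefficient y > 0. *)
have cL : zcontents L = 1.
  have /polyOverP H : L \is a polyOver (dvdz (zcontents L)) by rewrite -dvdz_contents.
  have d1 := H 1%N; have d0 := H 0%N.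
  rewrite coefB coefZ coefX coefC /= mulr1 subr0 in d1.
  rewrite coefB coefZ coefX coefC /= mulr0 sub0r rpredN in d0.
  have : (zcontents L %| gcdz x y)%Z by rewrite dvdz_gcd d0 d1.
  move/eqP: cxy => ->; rewrite dvdz1 => /eqP ab1.
  have sg1 : sgz (zcontents L) = 1 by rewrite sgz_contents lL gtr0_sgz.
  by rewrite [zcontents L]intEsg sg1 ab1.
have cLe : zcontents (L ^+ e) = 1.
  elim: e {dvW} => [|e IH]; first by rewrite expr0 zcontents_monic ?monic1.
  by rewrite exprS zcontentsM IH cL mulr1.
have zLe : zprimitive (L ^+ e) = L ^+ e by rewrite {2}[L ^+ e]zpolyEprim cLe scale1r.
have : L ^+ e %| W.
  rewrite -dvdp_rat_int rmorphXn /= LQ exprZn.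
  by rewrite dvdpZl // expf_neq0.
move/dvdpP_int => [Q]; rewrite zLe => E; rewrite E lead_coefM lead_coef_exp lL.
rewrite normrM normrX (gtr0_norm y0); apply: ler_peMr; first by rewrite exprn_ge0 // ltW.
by rewrite -gtz0_ge1 normr_gt0 lead_coef_eq0; apply: contra_neq W0 => Q0; rewrite E Q0 mulr0.
Qed.

Section Multiplicity.
Variables (R : realType) (n : nat) (f : {poly int}) (z : R[i]).
Hypotheses (n1 : (1 < n)%N) (hf : minimal_at_roots R f n).
Hypothesis fz : root (map_poly intr f) z.
Local Notation toC := (map_poly (intr : int -> R[i])).

Lemma simple_root : (toC f)^`().[z] != 0.
Proof.
have [sf mf] := hf; apply/eqP => H.
have : f^`() = 0.
  apply: (mf z) => //; first by rewrite /root -deriv_map H.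
  by rewrite -ltnS -sf lt_size_deriv // -size_poly_eq0 sf.
move/(congr1 lead_coef)/eqP; rewrite lead_coef_deriv lead_coef0 mulrn_eq0 sf /=.
by rewrite lead_coef_eq0 -size_poly_eq0 sf orbF => /eqP n0; move: n1; rewrite n0.
Qed.

(** Each order of vanishing costs a whole factor [f]: a polynomial vanishing at z is, up to a
    constant, divisible by [f], and since z is a simple root of [f] the quotient loses only one
    order. *)
Lemma size_high_multiplicity (V : {poly int}) (k : nat) :
  V != 0 -> ('X - z%:P) ^+ k %| toC V -> (n * k < size V)%N.
Proof.
have [sf mf] := hf.
elim: k V => [|k IHk] V V0 dvV; first by rewrite muln0 size_poly_gt0.
have f0 : f != 0 by rewrite -size_poly_eq0 sf.
have Vz : root (toC V) z.
  by rewrite -dvdp_XsubCl; apply: dvdp_trans dvV; rewrite exprS dvdp_mulr.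
have := Pdiv.Idomain.divp_eq V f; set c := _ ^+ _; set Q := V %/ f => VE.
have rem0 : V %% f = 0.
  apply: (mf z) => //; last by rewrite -ltnS -sf Pdiv.Idomain.ltn_modp.
  have -> : V %% f = c *: V - Q * f by rewrite VE [_ + _ %% _]addrC addrK.
  rewrite /root rmorphB rmorphM /= map_polyZ /= hornerD hornerN hornerM hornerZ.
  by rewrite (rootP fz) (rootP Vz) !mulr0 subr0.
rewrite rem0 addr0 in VE.
have c0 : c != 0 by rewrite expf_neq0 // lead_coef_eq0.
have Q0 : Q != 0.
  apply: contra_neq V0 => Q0; move: VE; rewrite Q0 mul0r => /eqP.
  by rewrite scale_poly_eq0 (negPf c0) => /eqP.
have sV : size V = (size Q + n)%N.
  by rewrite -(size_scale _ c0) VE size_mul // sf addnS.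
rewrite sV mulnS addnC ltn_add2r; apply: IHk => //.
have /factor_theorem[f1 f1E] := fz.
have f1z : ~~ root f1 z.
  have := simple_root; rewrite f1E derivM hornerD !hornerM derivXsubC hornerXsubC hornerC.
  by rewrite subrr mulr0 add0r mulr1.
have : ('X - z%:P) ^+ k.+1 %| toC (c *: V).
  by rewrite map_polyZ -mul_polyC dvdp_mull.
rewrite VE rmorphM /= f1E mulrA exprSr dvdp_mul2r ?polyXsubC_eq0 //.
rewrite Gauss_dvdpl //; apply: coprimep_expl.
by rewrite coprimep_sym coprimep_XsubC.
Qed.

End Multiplicity.

(** * Auxiliary polynomials *)

Definition height_le (p : {poly int}) (b : nat) := forall i, (absz (p`_i)%R <= b)%N.

Lemma leq_abszD (a b : int) (c d : nat) :
  (absz a <= c -> absz b <= d -> absz (a + b)%R <= c + d)%N.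
Proof. by lia. Qed.

Lemma leq_abszM (a b : int) (c d : nat) :
  (absz a <= c -> absz b <= d -> absz (a * b)%R <= c * d)%N.
Proof. by move=> ac bd; rewrite abszM leq_mul. Qed.

Lemma bin_le_exp2 m k : ('C(m, k) <= 2 ^ m)%N.
Proof.
elim: m k => [|m IHm] [|k]; rewrite ?bin0 ?bin0n ?expn_gt0 //.
by rewrite binS expnS mul2n -addnn leq_add.
Qed.

Lemma height_nderivn (p : {poly int}) b N h : (size p <= N)%N -> height_le p b ->
  height_le p^`N(h) (2 ^ N * b).
Proof.
move=> sp hp i; rewrite coef_nderivn -mulr_natl.
have [hiN|Nhi] := ltnP (h + i) N; last first.
  by rewrite nth_default ?mulr0 // (leq_trans sp).
apply: leq_abszM (hp _); rewrite natz absz_nat.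
by apply: leq_trans (bin_le_exp2 _ _) _; rewrite leq_exp2l // ltnW.
Qed.

Lemma size_nderivn (A : comNzRingType) (p : {poly A}) h : (size p^`N(h) <= size p)%N.
Proof.
apply/leq_sizeP => i hi; rewrite coef_nderivn nth_default ?mul0rn //.
by rewrite (leq_trans hi) // leq_addl.
Qed.

(** * Siegel's lemma by the pigeonhole principle *)

Section Siegel.
Variables (R : realType) (n : nat) (f : {poly int}) (H : nat).
Hypotheses (n0 : (0 < n)%N) (sf : size f = n.+1) (fH : height_le f H).
Local Notation toC := (map_poly (intr : int -> R[i])).
Implicit Types (g U V : {poly int}) (z : R[i]).

(* One step of division by [f], multiplied by the leading coefficient of [f]
   to stay integral. *)
Definition reduce (j : nat) (g : {poly int}) : {poly int} :=
  lead_coef f *: g - g`_(n + j) *: ('X^j * f).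

Fixpoint reducen (j : nat) (g : {poly int}) : {poly int} :=
  if j is i.+1 then reducen i (reduce i g) else g.

Lemma reduceB j g g' : reduce j (g - g') = reduce j g - reduce j g'.
Proof. by rewrite /reduce coefB scalerBr scalerBl; ring. Qed.

Lemma reducenB j g g' : reducen j (g - g') = reducen j g - reducen j g'.
Proof. by elim: j g g' => //= j IHj g g'; rewrite reduceB IHj. Qed.

Lemma size_reduce j g : (size g <= n + j.+1)%N -> (size (reduce j g)%R <= n + j)%N.
Proof.
move=> sg; apply/leq_sizeP => i; rewrite leq_eqVlt => /predU1P[<-|ji].
  rewrite coefB !coefZ coefXnM ltnNge leq_addl /= addnK.
  have -> : f`_n = lead_coef f by rewrite lead_coefE sf.
  by rewrite mulrC subrr.
rewrite coefB !coefZ coefXnM [g`_i]nth_default; last by rewrite (leq_trans sg) // addnS.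
have -> : (i < j)%N = false by apply/negbTE; rewrite -leqNgt (leq_trans (leq_addl n j)) // ltnW.
rewrite [f`__]nth_default ?mulr0 ?subrr // sf.
by rewrite ltn_subRL addnC.
Qed.

Lemma height_reduce j g b : height_le g b -> height_le (reduce j g) (2 * H * b).
Proof.
move=> hg i; rewrite coefB !coefZ coefXnM -mulnA mul2n -addnn.
apply: leq_abszD; first by apply: leq_abszM; [rewrite lead_coefE; exact: fH|exact: hg].
rewrite abszN mulnC; apply: leq_abszM; first exact: hg.
by case: ifP => // _; exact: fH.
Qed.

Lemma horner_reduce j g z : root (toC f) z ->
  (toC (reduce j g)).[z] = (lead_coef f)%:~R * (toC g).[z].
Proof.
move=> fz; rewrite /reduce rmorphB /= !map_polyZ /= rmorphM /= hornerD hornerN !hornerZ.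
by rewrite hornerM (rootP fz) !mulr0 subr0.
Qed.

Lemma size_reducen j g : (size g <= n + j)%N -> (size (reducen j g) <= n)%N.
Proof.
elim: j g => [|j IHj] g; first by rewrite addn0.
by move=> sg; apply: IHj; apply: size_reduce.
Qed.

Lemma height_reducen j g b : height_le g b -> height_le (reducen j g) ((2 * H) ^ j * b).
Proof.
elim: j g b => [|j IHj] g b hg; first by rewrite expn0 mul1n.
rewrite expnSr -mulnA; apply: IHj; exact: height_reduce.
Qed.

Lemma horner_reducen j g z : root (toC f) z ->
  (toC (reducen j g)).[z] = (lead_coef f)%:~R ^+ j * (toC g).[z].
Proof.
move=> fz; elim: j g => [|j IHj] g /=; first by rewrite expr0 mul1r.
by rewrite IHj horner_reduce // exprSr mulrA.
Qed.

Variables (N k A Hc : nat).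
Hypothesis AE : A = (2 * (4 * H) ^ N)%N.
Hypothesis pigeon : ((2 * (A * Hc)).+1 ^ (k * n) < Hc.+1 ^ (2 * N))%N.

Let vec := {ffun 'I_N -> 'I_Hc.+1}.

Let pol (c : vec) : {poly int} :=
  \poly_(i < N) oapp (fun j : 'I_N => (c j : nat)%:Z) 0 (insub i).

Let coef_pol (c : vec) (i : 'I_N) : (pol c)`_i = (c i : nat)%:Z.
Proof. by rewrite coef_poly ltn_ord valK. Qed.

Let pol_inj : injective pol.
Proof.
move=> c d cd; apply/ffunP => i; apply/val_inj.
by have := congr1 (fun p : {poly int} => p`_i) cd; rewrite !coef_pol => -[].
Qed.

Let pol_bound c i : 0 <= (pol c)`_i <= Hc%:Z.
Proof.
rewrite coef_poly; case: ifP => [iN|]; last by [].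
by rewrite insubT /= lez_nat -ltnS ltn_ord.
Qed.

(** The h-th divided derivative in X of U(X) - Y V(X), restricted to the diagonal Y = X; its value
    at the roots must vanish. *)
Let comb (U V : {poly int}) (h : nat) : {poly int} := U^`N(h) - 'X * V^`N(h).

Let size_comb U V h : (size U <= N)%N -> (size V <= N)%N -> (size (comb U V h) <= n + N)%N.
Proof.
move=> sU sV; apply: leq_trans (size_polyD _ _) _; rewrite size_polyN geq_max.
rewrite (leq_trans (size_nderivn _ _)) ?(leq_trans sU) ?leq_addl //=.
apply: leq_trans (size_polyMleq _ _) _; rewrite size_polyX /=.
apply: (@leq_trans (1 + N)); last by rewrite leq_add2r.
by rewrite add1n ltnS (leq_trans (size_nderivn _ _)).
Qed.

(** The N reductions cost (2 H)^N and the two derivatives 2 * 2^N, which together make up [A]. *)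
Let height_comb c d h : height_le (reducen N (comb (pol c) (pol d) h)) (A * Hc).
Proof.
have hp e : height_le (pol e) Hc by move=> i; have := pol_bound e i; lia.
have sp e : (size (pol e) <= N)%N by rewrite size_poly.
have -> : (A * Hc = (2 * H) ^ N * (2 ^ N * Hc + 2 ^ N * Hc))%N.
  by rewrite AE (_ : 4 * H = 2 * H * 2)%N ?expnMn; ring.
apply: height_reducen => i; rewrite coefB; apply: leq_abszD; first exact: height_nderivn.
by rewrite abszN coefXM; case: ifP => // _; exact: height_nderivn.
Qed.

(** There are (Hc + 1)^(2 N) pairs with coefficients between 0 and Hc, while the k conditions,
    reduced modulo [f], take at most (2 A Hc + 1)^(k n) values; the difference of two colliding
    pairs is a solution. Remainders modulo [f] do not refer to a root, so one pair serves all
    roots. *)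
Lemma siegel : exists U V : {poly int},
  [/\ (U != 0) || (V != 0), (size U <= N)%N /\ (size V <= N)%N,
      height_le U Hc /\ height_le V Hc
    & forall z, root (toC f) z -> forall h, (h < k)%N ->
        (toC U^`N(h)).[z] = z * (toC V^`N(h)).[z]].
Proof.
pose B := (A * Hc)%N.
(* Adding [B] moves the coefficients of the remainders from [-B, B] to [0, 2 B]. *)
pose img (c : vec * vec) : {ffun 'I_k * 'I_n -> 'I_(2 * B).+1} :=
  [ffun hj : 'I_k * 'I_n => inord (absz ((reducen N (comb (pol c.1) (pol c.2) hj.1))`_hj.2 + B%:Z))].
have /injectivePn[c [d cd Ecd]] : ~~ injectiveb img.
  apply/negP => /injectiveP /leq_card; apply/negP; rewrite -ltnNge.
  by rewrite card_prod !card_ffun !card_ord card_prod !card_ord -expnD addnn -mul2n.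
have sp e : (size (pol e) <= N)%N by rewrite size_poly.
exists (pol c.1 - pol d.1), (pol c.2 - pol d.2); split.
- rewrite -negb_and !subr_eq0 !(inj_eq pol_inj); apply: contra cd.
  by case: c d {Ecd} => [c1 c2] [d1 d2] /= /andP[/eqP -> /eqP ->].
- by split; apply: leq_trans (size_polyD _ _) _; rewrite size_polyN geq_max !sp.
- have sub (a b : int) : 0 <= a <= Hc%:Z -> 0 <= b <= Hc%:Z -> (absz (a - b)%R <= Hc)%N.
    by clear; lia.
  by split=> i; rewrite coefB; apply: sub; exact: pol_bound.
move=> z fz h hk.
pose g := comb (pol c.1 - pol d.1) (pol c.2 - pol d.2) h.
have gE : g = comb (pol c.1) (pol c.2) h - comb (pol d.1) (pol d.2) h.
  by rewrite /g /comb !nderivnB; ring.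
have g0 : reducen N g = 0.
  rewrite gE reducenB; apply/eqP; rewrite subr_eq0; apply/eqP/polyP => i.
  have [ni|ilt] := leqP n i.
    by rewrite !nth_default // (leq_trans _ ni) // size_reducen // size_comb.
  have := congr1 (fun F : {ffun _} => F (Ordinal hk, Ordinal ilt)) Ecd.
  rewrite /img !ffunE /= => /(congr1 (@nat_of_ord _)).
  have hc := @height_comb c.1 c.2 h i; have hd := @height_comb d.1 d.2 h i.
  have ub (a : int) C : (absz a <= C)%N -> (absz (a + C%:Z)%R < (2 * C).+1)%N.
    by clear; lia.
  have eqa (a b : int) C : (absz a <= C)%N -> (absz b <= C)%N ->
      absz (a + C%:Z) = absz (b + C%:Z) -> a = b.
    by clear; lia.
  by rewrite !inordK ?ub //; exact: eqa.
have := horner_reducen N g fz; rewrite g0 rmorph0 horner0 => /esym/eqP.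
rewrite mulf_eq0 expf_eq0 intr_eq0 lead_coef_eq0 -size_poly_eq0 sf andbF /=.
rewrite /g /comb rmorphB rmorphM /= map_polyX hornerD hornerN hornerM hornerX subr_eq0.
by move/eqP.
Qed.

End Siegel.

Section PolynomialBounds.
Variable R : realType.
Implicit Types (p G : {poly R[i]}).

Lemma modulus_horner p N b r z : (size p <= N)%N ->
  (forall i, modulus p`_i <= b) -> 1 <= r -> modulus z <= r ->
  modulus p.[z] <= N%:R * (b * r ^+ N).
Proof.
move=> sp pb r1 zr; rewrite (horner_coef_wide _ sp).
apply: le_trans (ler_modulus_sum _ _ _) _.
rewrite mulr_natl -[X in _ *+ X]card_ord -sumr_const; apply: ler_sum => i _.
rewrite modulusM modulusX; apply: ler_pM; rewrite ?modulus_ge0 ?exprn_ge0 ?modulus_ge0 //.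
apply: (@le_trans _ _ (r ^+ i)); first by rewrite lerXn2r ?nnegrE ?modulus_ge0 // (le_trans ler01).
by rewrite ler_weXn2l // ltnW.
Qed.

Lemma modulus_nderivn p N b h i : (size p <= N)%N ->
  (forall i, modulus p`_i <= b) -> modulus p^`N(h)`_i <= 2 ^+ N * b.
Proof.
move=> sp pb; have b0 : 0 <= b := le_trans (modulus_ge0 _) (pb 0%N).
rewrite coef_nderivn; have [hiN|Nhi] := ltnP (h + i) N; last first.
  by rewrite nth_default ?(leq_trans sp) // mul0rn modulus0 mulr_ge0 // exprn_ge0.
rewrite -[_ *+ 'C(_, _)]mulr_natl modulusM modulus_nat; apply: ler_pM; rewrite ?ler0n ?modulus_ge0 //.
rewrite -natrX ler_nat; apply: leq_trans (bin_le_exp2 _ _) _.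
by rewrite leq_exp2l // ltnW.
Qed.

(** In the expansion of the h-th derivative at z all terms of order below k - h vanish. The factor
    4^N pays for two successive divided derivatives. *)
Lemma taylor_bound G N b r z d k h : (size G <= N)%N ->
  (forall i, modulus G`_i <= b) -> 1 <= r -> modulus z <= r ->
  (forall t, (t < k)%N -> G^`N(t).[z] = 0) -> modulus d <= 1 ->
  modulus G^`N(h).[z + d] <= N%:R * (N%:R * (4 ^+ N * b * r ^+ N)) * modulus d ^+ (k - h).
Proof.
move=> sG Gb r1 zr Gz d1.
have b0 : 0 <= b := le_trans (modulus_ge0 _) (Gb 0%N).
have r0 : 0 <= r := le_trans ler01 r1.
rewrite (@nderiv_taylor_wide _ N); [|exact: mulrC|exact: leq_trans (size_nderivn _ _) sG].
apply: le_trans (ler_modulus_sum _ _ _) _; rewrite -mulrA.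
rewrite mulr_natl -[X in _ *+ X]card_ord -sumr_const; apply: ler_sum => i _.
rewrite nderivn_nderivn hornerMn; have [hik|khi] := ltnP (h + i) k.
  rewrite Gz // mul0rn mul0r modulus0 !mulr_ge0 ?ler0n ?exprn_ge0 ?modulus_ge0 //.
rewrite -hornerMn -nderivn_nderivn modulusM modulusX.
apply: ler_pM; rewrite ?exprn_ge0 ?modulus_ge0 //.
  apply: modulus_horner => //.
    by rewrite !(leq_trans (size_nderivn _ _)).
  move=> j; have -> : (4 : R) = 2 * 2 by ring.
  rewrite exprMn -mulrA; apply: modulus_nderivn; first by rewrite !(leq_trans (size_nderivn _ _)).
  by move=> l; apply: modulus_nderivn.
by rewrite ler_wiXn2l ?modulus_ge0 // leq_subLR.
Qed.

End PolynomialBounds.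

Lemma hev_ratio (K : numFieldType) d (p : {poly int}) (x y : int) :
  (size p <= d.+1)%N -> y != 0 ->
  (hev d p x y)%:~R = y%:~R ^+ d * (map_poly intr p).[x%:~R / y%:~R] :> K.
Proof.
move=> sp y0; have yK : y%:~R != 0 :> K by rewrite intr_eq0.
rewrite -(@hev_horner _ d) ?size_map_inj_poly //; last exact: intr_inj.
rewrite -hev_scale mulr1 mulrCA divff // mulr1.
by rewrite (@hev_map _ _ intr).
Qed.

Lemma absz_coefM (p q : {poly int}) a b M j : height_le p a -> height_le q b ->
  (j < M)%N -> (absz ((p * q)`_j)%R <= M * (a * b))%N.
Proof.
move=> pa qb jM; rewrite coefM -lez_nat abszE.
apply: le_trans (ler_norm_sum _ _ _) _; apply: (@le_trans _ _ (\sum_(i < j.+1) (a * b)%:Z)).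
  by apply: ler_sum => i _; rewrite -abszE lez_nat leq_abszM.
by rewrite sumr_const card_ord -mulr_natl natz -PoszM lez_nat leq_mul2r jM orbT.
Qed.

Lemma height_deriv (p : {poly int}) a N : (size p <= N)%N -> height_le p a ->
  height_le p^`() (N * a).
Proof.
move=> sp pa i; rewrite coef_deriv -mulr_natl.
have [iN|Ni] := ltnP i.+1 N; last by rewrite nth_default ?mulr0 // (leq_trans sp).
by apply: leq_abszM (pa _); rewrite natz absz_nat ltnW.
Qed.

Lemma dvdp_deriv (K : fieldType) (p : {poly K}) (a : K) l :
  ('X - a%:P) ^+ l %| p -> ('X - a%:P) ^+ l.-1 %| p^`().
Proof.
case/dvdpP => q ->; rewrite derivM deriv_exp derivXsubC mul1r dvdp_add //.
  by rewrite dvdp_mull // dvdp_exp2l // leq_pred.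
by rewrite dvdp_mull // -mulr_natr dvdp_mulr.
Qed.

(** * The Wronskian of an auxiliary pair *)

Section Wronskian.
Variables (R : realType) (n : nat) (f : {poly int}) (z : R[i]).
Hypotheses (n1 : (1 < n)%N) (hf : minimal_at_roots R f n).
Hypothesis fz : root (map_poly intr f) z.
Local Notation toC := (map_poly (intr : int -> R[i])).
Variables (U V : {poly int}) (N k : nat).
Hypotheses (UV0 : (U != 0) || (V != 0)) (sU : (size U <= N)%N) (sV : (size V <= N)%N).
Hypothesis Nk : (N <= n * k)%N.
Hypothesis UVz : forall h, (h < k)%N -> (toC U^`N(h)).[z] = z * (toC V^`N(h)).[z].

(** Otherwise U and V are proportional over the integers; as z is irrational, V (or U, when V = 0)
    then vanishes at z to order k, so its size exceeds n k >= N. *)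
Lemma wronskian_neq0 : U * V^`() - U^`() * V != 0.
Proof.
have mult P : P != 0 -> (forall h, (h < k)%N -> (toC P^`N(h)).[z] = 0) -> (N < size P)%N.
  move=> P0 Pz; apply: leq_ltn_trans Nk _.
  apply: (size_high_multiplicity n1 hf fz P0); apply: dvdp_nderivn => h hk.
  by rewrite nderivn_map Pz.
apply/eqP => W0; have [V0|V0] := eqVneq V 0.
  move: UV0; rewrite V0 eqxx orbF => U0.
  have := mult U U0; rewrite ltnNge sU => H; apply: notF; apply: H => h hk.
  by rewrite UVz // V0 nderivn_poly0 ?size_poly0 // rmorph0 horner0 mulr0.
have E := wronskian0 V0 W0.
have := mult V V0; rewrite ltnNge sV => H; apply: notF; apply: H => h hk.
set c := lead_coef V in E; set d := U`_ _ in E.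
have c0 : c != 0 by rewrite lead_coef_eq0.
have : (c%:~R * z - d%:~R) * (toC V^`N(h)).[z] = 0.
  rewrite mulrBl -mulrA -UVz //.
  have := congr1 (fun P : {poly int} => (toC P^`N(h)).[z]) E.
  by rewrite /= !nderivnZ !map_polyZ /= !hornerZ => ->; rewrite subrr.
move/eqP; rewrite mulf_eq0 => /orP[/eqP cz|/eqP //].
have L0 : c *: 'X - d%:P = 0 :> {poly int}.
  have [_ mf] := hf; apply: (mf z) => //.
    rewrite /root rmorphB /= map_polyZ /= map_polyX map_polyC /=.
    by rewrite hornerD hornerN hornerZ hornerX hornerC cz.
  by rewrite -polyCN (leq_trans (size_lin _ _)).
have : (c *: 'X - d%:P)`_1 = 0 :> int by rewrite L0 coef0.
by rewrite coefB coefZ coefX coefC /= subr0 mulr1 => /eqP; rewrite (negPf c0).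
Qed.

(* The order of vanishing of [U - (x2/y2) V] at [x1/y1] is controlled by the
   leading coefficient of the Wronskian. *)
Lemma nonvanishing (x1 y1 x2 y2 : int) (a : nat) : 0 < y1 -> coprimez x1 y1 -> y2 != 0 ->
  height_le U a -> height_le V a ->
  exists2 l, (map_poly (intr : int -> rat) (y2 *: U - x2 *: V)^`N(l)).[x1%:~R / y1%:~R] != 0
    & y1 ^+ l.-1 <= (4 * N * N * (a * a))%N%:Z.
Proof.
move=> y10 cop y20 hU hV; set K := y2 *: U - x2 *: V.
set W := U * V^`() - U^`() * V.
have W0 : W != 0 := wronskian_neq0.
(* Up to the factor y2, W is also the Wronskian of K and V, so a zero of K of order l is a zero of W
   of order at least l - 1. *)
have WE : y2 *: W = K * V^`() - K^`() * V.
  by rewrite /K derivB !derivZ /W -!mul_polyC; ring.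
have K0 : K != 0.
  apply: contra_neq W0 => K0; apply/eqP; move/eqP: WE.
  by rewrite K0 deriv0 !mul0r subrr scale_poly_eq0 (negPf y20).
have KQ0 : map_poly (intr : int -> rat) K != 0.
  by rewrite map_poly_eq0_id0 // intr_eq0 lead_coef_eq0.
have [l Kl Kh] := nderivn_neq0 (x1%:~R / y1%:~R) KQ0.
exists l; first by rewrite -nderivn_map.
have sW : (size W <= N + N)%N.
  have sM (P Q : {poly int}) : (size P <= N)%N -> (size Q <= N)%N -> (size (P * Q)%R <= N + N)%N.
    move=> sP sQ; apply: leq_trans (size_polyMleq _ _) _.
    by apply: leq_trans (leq_pred _) _; rewrite leq_add.
  have sD (P : {poly int}) : (size P <= N)%N -> (size P^`() <= N)%N.
    have [->|P0] := eqVneq P 0; first by rewrite deriv0 size_poly0.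
    by apply: leq_trans; rewrite ltnW // lt_size_deriv.
  apply: leq_trans (size_polyD _ _) _; rewrite size_polyN geq_max.
  by rewrite !sM ?sD.
apply: (@le_trans _ _ `|lead_coef W|).
  have y2Q : (y2%:~R : rat) != 0 by rewrite intr_eq0.
  have D : ('X - (x1%:~R / y1%:~R)%:P) ^+ l.-1 %| map_poly (intr : int -> rat) (y2 *: W).
    move: (x1%:~R / y1%:~R) Kh => xi Kh.
    rewrite WE rmorphB !rmorphM /=; apply: dvdp_sub.
      apply: dvdp_mulr; apply: dvdp_trans (dvdp_nderivn Kh).
      by rewrite dvdp_exp2l // leq_pred.
    apply: dvdp_mulr; rewrite -deriv_map; apply: dvdp_deriv; exact: dvdp_nderivn.
  rewrite map_polyZ /= dvdpZr // in D.
  exact: multiplicity_lead_coef D.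
rewrite lead_coefE -abszE lez_nat.
have jW : ((size W).-1 < N + N)%N.
  by rewrite prednK ?size_poly_gt0.
rewrite coefB; apply: leq_trans (leq_abszD (leqnn _) (leqnn _)) _; rewrite abszN.
(* Two products, each with at most 2 N terms bounded by a * N a. *)
have -> : (4 * N * N * (a * a) = (N + N) * (a * (N * a)) + (N + N) * (N * a * a))%N by ring.
by apply: leq_add; apply: absz_coefM => //; apply: height_deriv.
Qed.

End Wronskian.

(** * Thue's method *)

Ltac nonneg := solve [repeat first [assumption | exact: ler01 | exact: ler0n
  | exact: modulus_ge0 | apply: exprn_ge0 | apply: mulr_ge0 | apply: addr_ge0]].

(** Bounding 2 A Hc + 1 by 2 A (Hc + 1), ten of the twelve factors Hc + 1 cancel and (2 A)^10 < (Hc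
    + 1)^2 remains; hence the fifth power. *)
Lemma siegel_pigeonhole (A Hc e : nat) : (0 < A)%N -> (0 < e)%N -> Hc = ((2 * A) ^ 5)%N ->
  ((2 * (A * Hc)).+1 ^ (10 * e) < Hc.+1 ^ (12 * e))%N.
Proof.
move=> A0 e0 HE; rewrite [(10 * e)%N]mulnC [(12 * e)%N]mulnC ![(e * _)%N]mulnC !expnM ltn_exp2r //.
have le1 : ((2 * (A * Hc)).+1 <= 2 * A * Hc.+1)%N by lia.
apply: leq_ltn_trans (_ : (2 * A * Hc.+1) ^ 10 < _)%N; first by rewrite leq_exp2r.
rewrite expnMn (_ : 12 = 2 + 10)%N // expnD ltn_pmul2r ?expn_gt0 //.
by rewrite (_ : 10 = 5 * 2)%N // expnM -HE ltn_exp2r.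
Qed.

(** * Exponents in Thue's method *)

Section Exponents.
Variables (R : realType) (T : R).
Hypothesis T512 : 512 <= T.

Let T1 : 1 <= T. Proof. by apply: le_trans T512; lra. Qed.
Let T0 : 0 <= T. Proof. exact: le_trans ler01 T1. Qed.

(** The left side is at most (T * T^(18 e))^5 = T^(90 e + 5). *)
Lemma siegel_height_bound (H e : nat) : 4 * H%:R <= T ^+ 3 -> (0 < e)%N ->
  ((2 * (2 * (4 * H) ^ (6 * e))) ^ 5)%N%:R <= T ^+ (95 * e).
Proof.
move=> HT e0; rewrite natrX !natrM natrX natrM.
apply: (@le_trans _ _ ((T * (T ^+ 3) ^+ (6 * e)) ^+ 5)); last first.
  by rewrite -exprM -exprS -exprM ler_weXn2l //; lia.
rewrite lerXn2r ?nnegrE ?mulr_ge0 ?ler0n ?exprn_ge0 ?mulr_ge0 ?ler0n //.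
rewrite mulrA; apply: ler_pM; rewrite ?exprn_ge0 ?mulr_ge0 ?ler0n //.
  by apply: le_trans T512; lra.
by rewrite lerXn2r ?nnegrE ?mulr_ge0 ?ler0n ?exprn_ge0.
Qed.

Lemma natr_le_exp2 N : N%:R <= 2 ^+ N :> R.
Proof. by rewrite -natrX ler_nat ltnW // ltn_expl. Qed.

(** With N = 6 e, the powers of 2, including N <= 2^N used twice, combine to 32^N <= T^N; (2 T)^N
    leaves another T^N, and 1 + T <= T^2. The exponents add up to 12 e + 2 + 95 e. *)
Lemma taylor_constant_bound (Hc : R) e : 0 <= Hc -> Hc <= T ^+ (95 * e) -> (0 < e)%N ->
  (6 * e)%:R * ((6 * e)%:R * (4 ^+ (6 * e) * ((1 + T) * Hc) * (2 * T) ^+ (6 * e)))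
  <= T ^+ (110 * e).
Proof.
move=> H0 HT e0; set N := (6 * e)%N.
have NE : N = (6 * e)%N by []; clearbody N.
have -> : (110 * e = N + N + (3 * e + 95 * e))%N by lia.
rewrite exprD [T ^+ (N + N)]exprD [T ^+ (3 * e + _)]exprD.
apply: (@le_trans _ _ (2 ^+ N * (2 ^+ N * (4 ^+ N * (T * T * T ^+ (95 * e)) * (2 * T) ^+ N)))).
  apply: ler_pM; [nonneg|nonneg|exact: natr_le_exp2|].
  apply: ler_pM; [nonneg|nonneg|exact: natr_le_exp2|].
  apply: ler_wpM2r; first by nonneg.
  apply: ler_wpM2l; first by nonneg.
  apply: ler_pM; [nonneg|nonneg| |exact: HT].
  have := T512; nra.
rewrite !exprMn.
have -> : 2 ^+ N * (2 ^+ N * (4 ^+ N * (T * T * T ^+ (95 * e)) * (2 ^+ N * T ^+ N)))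
   = (2 * 2 * 4 * 2) ^+ N * T ^+ N * (T ^+ 2 * T ^+ (95 * e)) by rewrite !exprMn; ring.
apply: ler_pM; rewrite ?mulr_ge0 ?exprn_ge0 ?mulr_ge0 ?ler0n //.
  apply: ler_pM; rewrite ?mulr_ge0 ?exprn_ge0 ?mulr_ge0 ?ler0n //.
  rewrite lerXn2r ?nnegrE ?mulr_ge0 ?ler0n //; by apply: le_trans T512; lra.
apply: ler_pM; rewrite ?exprn_ge0 //.
by rewrite ler_weXn2l //; lia.
Qed.

Lemma wronskian_bound (Hc : R) e : 0 <= Hc -> Hc <= T ^+ (95 * e) -> (0 < e)%N ->
  4 * (6 * e)%:R * (6 * e)%:R * (Hc * Hc) <= T ^+ (200 * e).
Proof.
move=> H0 HT e0; set N := (6 * e)%N.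
have NE : N = (6 * e)%N by []; clearbody N.
have -> : (200 * e = (N + 4 * e) + (95 * e + 95 * e))%N by lia.
rewrite exprD [T ^+ (95 * e + _)]exprD; apply: ler_pM; rewrite ?mulr_ge0 ?ler0n //; last first.
  by apply: ler_pM.
apply: (@le_trans _ _ (4 * 2 ^+ N * 2 ^+ N)).
  by rewrite ler_pM ?mulr_ge0 ?ler0n ?natr_le_exp2 // ler_wpM2l ?ler0n ?natr_le_exp2.
rewrite -mulrA -exprMn mulrC exprD; apply: ler_pM; rewrite ?exprn_ge0 ?mulr_ge0 ?ler0n //.
  by rewrite lerXn2r ?nnegrE ?mulr_ge0 ?ler0n //; apply: le_trans T512; lra.
by rewrite -[leLHS]expr1; apply: le_trans (_ : T ^+ 1 <= _); 
  [rewrite !expr1; apply: le_trans T512; lra | rewrite ler_weXn2l //; lia].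
Qed.

Variables (n s l : nat) (Y1 Y2 C1 : R).
Hypotheses (n3 : (3 <= n)%N) (s100 : (100 <= s)%N).
Hypotheses (TY : T ^+ (2000 * n) <= Y1) (C1T : C1 <= T ^+ (110 * (n * s))).
Hypotheses (Y2l : Y1 ^+ (10 * s) <= Y2) (Y2u : Y2 <= Y1 ^+ (10 * s.+1)).
Hypothesis sl : (10 * l.-1 <= s)%N.

Let TY1 : 1 <= Y1. Proof. by apply: le_trans TY; rewrite exprn_ege1. Qed.
Let Y10 : 0 <= Y1. Proof. exact: le_trans ler01 TY1. Qed.
Let Y20 : 0 <= Y2. Proof. by apply: le_trans Y2l; rewrite exprn_ge0. Qed.

(** These compare the exponents of Y1 in the two error terms, with a spare Y1^s to absorb the powers
    of T. For n = 3 the margin 10 n s - 6 n s - 11 s is only s and has to cover n l + 10, which the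
    bounds on l and s ensure. *)
Lemma thue_exponents :
  [/\ (l <= 10 * s)%N, (6 * (n * s) + 10 * s.+1 + s <= n * (10 * s - l))%N
    & (6 * (n * s) + s <= 10 * s * n.-1)%N].
Proof.
have P1 : (3 * s <= n * s)%N by rewrite leq_mul2r n3 orbT.
have P2 : (100 * n <= n * s)%N by rewrite mulnC leq_mul2l s100 orbT.
have P3 : (10 * (n * l.-1) <= n * s)%N by rewrite mulnCA leq_mul2l sl orbT.
have ls : (l <= 10 * s)%N by clear -sl s100; lia.
split=> //.
  have ll : (n * l <= n * l.-1 + n)%N by rewrite -mulnSr leq_mul2l leqSpred orbT.
  rewrite mulnBr (mulnCA n 10 s).
  move: (n * l)%N (n * l.-1)%N (n * s)%N P1 P2 P3 ll => nl nl' e.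
  clear -s100 n3; lia.
have -> : (10 * s * n.-1 = 10 * (n * s) - 10 * s)%N.
  by rewrite -subn1 mulnBr muln1 -mulnA [(s * n)%N]mulnC.
by move: (n * s)%N P1 P2; clear -s100 n3; lia.
Qed.

Let TYs q : (q <= 2000 * (n * s))%N -> T ^+ q <= Y1 ^+ s.
Proof.
move=> hq; apply: (@le_trans _ _ ((T ^+ (2000 * n)) ^+ s)).
  by rewrite -exprM ler_weXn2l // -mulnA.
by rewrite lerXn2r ?nnegrE // exprn_ge0.
Qed.

(** This and [thue_second_term] will make a nonzero integer at most 1/2: this part is small because
    U(X) - Y V(X) vanishes to high order at X = Y = z, the other because x2 / y2 is close to z. *)
Lemma thue_first_term : 0 <= C1 ->
  4 * (Y1 ^+ (6 * (n * s)) * Y2 * (C1 * (T ^+ (2 * n) / Y1 ^+ n) ^+ (10 * s - l))) <= 1.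
Proof.
move=> C10; have [ls E _] := thue_exponents.
have Y1p : 0 < Y1 := lt_le_trans ltr01 TY1.
rewrite expr_div_n -!exprM; set q := (10 * s - l)%N in E *.
rewrite !mulrA ler_pdivrMr ?exprn_gt0 // mul1r.
apply: le_trans (_ : Y1 ^+ (6 * (n * s) + 10 * s.+1 + s) <= _); last by rewrite ler_weXn2l.
rewrite exprD [Y1 ^+ (_ + _)]exprD.
have -> : 4 * Y1 ^+ (6 * (n * s)) * Y2 * C1 * T ^+ (2 * n * q)
   = Y1 ^+ (6 * (n * s)) * Y2 * (4 * C1 * T ^+ (2 * n * q)) by ring.
apply: ler_pM; rewrite ?mulr_ge0 ?exprn_ge0 ?mulr_ge0 ?ler0n //.
  by rewrite ler_wpM2l ?exprn_ge0.
apply: le_trans (_ : T ^+ 1 * T ^+ (110 * (n * s)) * T ^+ (2 * n * q) <= _).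
  apply: ler_wpM2r; first exact: exprn_ge0.
  apply: ler_pM; rewrite ?ler0n // expr1; by apply: le_trans T512; lra.
rewrite -!exprD; apply: TYs.
have : (n * q <= n * (10 * s))%N by rewrite leq_mul2l leq_subr orbT.
have P2 : (100 * n <= n * s)%N by rewrite mulnC leq_mul2l s100 orbT.
rewrite (mulnCA n 10 s) -(mulnA 2 n q); move: (n * q)%N (n * s)%N P2; clear -n3; lia.
Qed.

Lemma thue_second_term : 0 <= C1 ->
  4 * (Y1 ^+ (6 * (n * s)) * Y2 * (T ^+ (2 * n) / Y2 ^+ n * C1)) <= 1.
Proof.
move=> C10; have [_ _ E] := thue_exponents.
have Y1p : 0 < Y1 := lt_le_trans ltr01 TY1.
have Y2p : 0 < Y2 by apply: lt_le_trans Y2l; rewrite exprn_gt0.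
have -> : Y2 ^+ n = Y2 * Y2 ^+ n.-1 by rewrite -exprS prednK // (leq_trans _ n3).
have -> : 4 * (Y1 ^+ (6 * (n * s)) * Y2 * (T ^+ (2 * n) / (Y2 * Y2 ^+ n.-1) * C1))
  = 4 * Y1 ^+ (6 * (n * s)) * T ^+ (2 * n) * C1 / Y2 ^+ n.-1.
  by field; rewrite ?expf_neq0 ?gt_eqF.
rewrite ler_pdivrMr ?exprn_gt0 // mul1r.
apply: le_trans (_ : (Y1 ^+ (10 * s)) ^+ n.-1 <= _); last first.
  by rewrite lerXn2r ?nnegrE ?exprn_ge0.
rewrite -exprM; apply: le_trans (_ : Y1 ^+ (6 * (n * s) + s) <= _); last by rewrite ler_weXn2l.
have -> : 4 * Y1 ^+ (6 * (n * s)) * T ^+ (2 * n) * C1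
  = Y1 ^+ (6 * (n * s)) * (4 * T ^+ (2 * n) * C1) by ring.
rewrite exprD ler_wpM2l ?exprn_ge0 //.
apply: le_trans (_ : T ^+ 1 * T ^+ (2 * n) * T ^+ (110 * (n * s)) <= _).
  apply: ler_pM; rewrite ?mulr_ge0 ?exprn_ge0 ?ler0n //.
  apply: ler_wpM2r; first exact: exprn_ge0.
  rewrite expr1; by apply: le_trans T512; lra.
rewrite -!exprD; apply: TYs.
have P2 : (100 * n <= n * s)%N by rewrite mulnC leq_mul2l s100 orbT.
by move: (n * s)%N P2; clear -n3; lia.
Qed.

End Exponents.

(* Thue's method: the auxiliary polynomial [U - Y V] is tuned to the ratio
   log y2 / log y1, which is about [10 s]. *)
Theorem thue_principle (R : realType) (n : nat) (f : {poly int}) (z : R[i]) (T : R) (H : nat)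
    (x1 x2 : int) (y1 y2 : nat) :
  (3 <= n)%N -> minimal_at_roots R f n -> root (map_poly intr f) z ->
  512 <= T -> height_le f H -> 4 * H%:R <= T ^+ 3 -> modulus z <= T ->
  coprimez x1 y1 -> T ^+ (2000 * n) <= y1%:R -> (y1 ^ (10 * 100) <= y2)%N ->
  modulus (z - x1%:~R / y1%:R) <= T ^+ (2 * n) / y1%:R ^+ n ->
  modulus (z - x2%:~R / y2%:R) <= T ^+ (2 * n) / y2%:R ^+ n ->
  False.
Proof.
move=> n3 hf fz T512 fH HT zT cop Ty1 y12 d1 d2.
have n1 : (1 < n)%N by apply: leq_trans n3.
have T1 : 1 <= T by apply: le_trans T512; lra.
have T0 : 0 <= T := le_trans ler01 T1.
have sf := hf.1.
have y1_gt1 : (1 < y1)%N.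
  rewrite -(ltr_nat R); apply: lt_le_trans Ty1.
  apply: (@lt_le_trans _ _ (T ^+ 1)); first by rewrite expr1; apply: lt_le_trans T512; lra.
  by rewrite ler_weXn2l //; clear -n3; lia.
have P1 : (1 < y1 ^ 10)%N by rewrite -[X in (X < _)%N](exp1n 10) ltn_exp2r.
have y2_gt0 : (0 < y2)%N by apply: leq_trans y12; rewrite expn_gt0 ltnW.
(* The integral part of log y2 / (10 log y1). *)
pose s := trunc_log (y1 ^ 10) y2.
have /andP[sl su] := trunc_log_bounds P1 y2_gt0.
rewrite -/s -!expnM in sl su.
have s100 : (100 <= s)%N by apply: trunc_log_max => //; rewrite -expnM.
pose e := (n * s)%N.
have e0 : (0 < e)%N by rewrite muln_gt0 (leq_trans _ n3) ?(leq_trans _ s100).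
(* This gives 2 N = 12 e unknown coefficients against k n = 10 e conditions, while N stays below n
   k, as the Wronskian requires. *)
pose N := (6 * e)%N; pose k := (10 * s)%N.
pose A := (2 * (4 * H) ^ N)%N; pose Hc := ((2 * A) ^ 5)%N.
have H0 : (0 < H)%N.
  have := fH n; have : f`_n != 0.
    have -> : f`_n = lead_coef f by rewrite lead_coefE sf.
    by rewrite lead_coef_eq0 -size_poly_eq0 sf.
  by rewrite -absz_gt0; apply: leq_trans.
have A0 : (0 < A)%N by rewrite muln_gt0 expn_gt0 muln_gt0 H0.
have pig : ((2 * (A * Hc)).+1 ^ (k * n) < Hc.+1 ^ (2 * N))%N.
  have -> : (k * n = 10 * e)%N by rewrite /k /e -mulnA [(s * n)%N]mulnC.
  have -> : (2 * N = 12 * e)%N by rewrite mulnA.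
  exact: siegel_pigeonhole.
have [U [V [UV0 [sU sV] [hU hV] UVz]]] := @siegel R n f H (ltnW n1) sf fH N k A Hc erefl pig.
have Nk : (N <= n * k)%N by rewrite /N /k /e (mulnCA n 10 s) leq_mul2r orbT.
have y1Z : (0 : int) < y1 by rewrite ltz_nat ltnW.
have y2Z : (y2 : int) != 0 by rewrite gt_eqF // ltz_nat.
have [l Kl ly] := nonvanishing n1 hf fz UV0 sU sV Nk (UVz z fz) x2 y1Z cop y2Z hU hV.
set K := _ *: U - _ *: V in Kl.
have HcT : Hc%:R <= T ^+ (95 * e) := siegel_height_bound T512 HT e0.
(* Here y1^(l - 1) <= T^(200 n s), whereas y1 >= T^(2000 n). *)
have sl10 : (10 * l.-1 <= s)%N.
  have : (y1%:R : R) ^+ l.-1 <= T ^+ (200 * e).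
    apply: le_trans (wronskian_bound T512 (ler0n _ Hc) HcT e0).
    by move: ly; rewrite -(ler_int R) rmorphXn /= -!pmulrn !natrM.
  have : T ^+ (2000 * n * l.-1) <= y1%:R ^+ l.-1 by rewrite exprM lerXn2r ?nnegrE ?exprn_ge0.
  move=> /le_trans/[apply]; rewrite ler_eXn2l; last by apply: lt_le_trans T512; lra.
  rewrite /e !mulnA => hh; rewrite -(leq_pmul2l (_ : 0 < 200 * n)%N); last by rewrite muln_gt0 (ltnW n1).
  by apply: leq_trans hh; rewrite mulnA leq_mul2r; apply/orP; right; clear; lia.
pose Y1 : R := y1%:R; pose Y2 : R := y2%:R.
have Y2l : Y1 ^+ (10 * s) <= Y2 by rewrite -natrX ler_nat.
have Y2u : Y2 <= Y1 ^+ (10 * s.+1) by rewrite -natrX ler_nat ltnW.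
pose C1 : R := N%:R * (N%:R * (4 ^+ N * ((1 + T) * Hc%:R) * (2 * T) ^+ N)).
have C10 : 0 <= C1 by rewrite !mulr_ge0 ?ler0n ?exprn_ge0 ?addr_ge0 ?mulr_ge0.
have C1T : C1 <= T ^+ (110 * e) := taylor_constant_bound T512 (ler0n _ Hc) HcT e0.
have t1 := thue_first_term T512 n3 s100 Ty1 C1T Y2l Y2u sl10 C10.
have t2 := thue_second_term T512 n3 s100 Ty1 C1T Y2l sl10 C10.
have [lk _ _] := thue_exponents n3 s100 sl10.
have Y1p : 0 < Y1 by rewrite ltr0n ltnW.
have N0 : (0 < N)%N by rewrite muln_gt0.
set toC := map_poly (intr : int -> R[i]) in UVz.
pose xi : R[i] := x1%:~R / y1%:~R.
(* The nonzero value at x1 / y1, multiplied by a power of y1, is an integer, so its modulus is at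
   least 1. *)
pose I : int := hev N.-1 K^`N(l) x1 y1.
have sK : (size K^`N(l) <= N.-1.+1)%N.
  rewrite prednK //; apply: leq_trans (size_nderivn _ _) _.
  apply: leq_trans (size_polyD _ _) _; rewrite size_polyN geq_max.
  by rewrite !(leq_trans (size_scale_leq _ _)).
have y1n0 : (y1 : int) != 0 by rewrite gt_eqF.
have I0 : I != 0.
  rewrite -(intr_eq0 rat) hev_ratio // mulf_neq0 //.
  by rewrite expf_neq0 // intr_eq0.
have := modulus_int_ge1 R I0; rewrite (@hev_ratio R[i]) // modulusM modulusX.
rewrite -[(y1 : int)%:~R]/(y1%:R) modulus_nat -/Y1 -nderivn_map.
pose G : {poly R[i]} := toC U - z *: toC V.
(* Writing x2 / y2 as z plus a deviation splits the value into a part that vanishes to high order at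
   z and an error proportional to the deviation. *)
have KE : (map_poly intr K)^`N(l).[xi] =
    y2%:R * (G^`N(l).[xi] + (z - x2%:~R / y2%:R) * (toC V)^`N(l).[xi]).
  rewrite /K rmorphB /= !map_polyZ /= !nderivnB !nderivnZ hornerD hornerN !hornerZ -/toC.
  rewrite hornerD hornerN hornerZ -[(y2 : int)%:~R]/(y2%:R).
  have y20 : (y2%:R : R[i]) != 0 by rewrite pnatr_eq0 -lt0n.
  by field.
rewrite KE modulusM modulus_nat -/Y2.
have D1 : T ^+ (2 * n) / Y1 ^+ n <= 1.
  rewrite ler_pdivrMr ?exprn_gt0 // mul1r exprM; have Y1ge0 := ltW Y1p.
  rewrite lerXn2r ?nnegrE ?exprn_ge0 //.
  by rewrite (le_trans _ Ty1) // ler_weXn2l //; clear -n3; lia.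
have xiz : modulus (xi - z) <= T ^+ (2 * n) / Y1 ^+ n by rewrite modulusB.
have zr : modulus z <= 2 * T by apply: le_trans zT _; rewrite ler_peMl // ler1n.
have r1 : 1 <= 2 * T by rewrite (le_trans T1) // ler_peMl // ler1n.
have Gb i : modulus G`_i <= (1 + T) * Hc%:R.
  rewrite coefB coefZ !coef_map /= mulrDl mul1r; apply: le_trans (ler_modulusBD _ _) _.
  rewrite modulusM !modulus_int; apply: lerD.
    by rewrite -[Hc%:R]/((Hc : int)%:~R) ler_int -abszE lez_nat; exact: hU.
  apply: ler_pM; rewrite ?modulus_ge0 ?ler0z //.
  by rewrite -[Hc%:R]/((Hc : int)%:~R) ler_int -abszE lez_nat; exact: hV.
have sG : (size G <= N)%N.
  apply: leq_trans (size_polyD _ _) _; rewrite size_polyN geq_max.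
  by rewrite (leq_trans (size_poly _ _)) // (leq_trans (size_scale_leq _ _)) // (leq_trans (size_poly _ _)).
have b1 : modulus G^`N(l).[xi] <= C1 * (T ^+ (2 * n) / Y1 ^+ n) ^+ (10 * s - l).
  have Gz t : (t < k)%N -> G^`N(t).[z] = 0.
    by move=> tk; rewrite nderivnB nderivnZ hornerD hornerN hornerZ !nderivn_map UVz // subrr.
  have := @taylor_bound R G N _ (2 * T) z (xi - z) k l sG Gb r1 zr Gz (le_trans xiz D1).
  rewrite addrC subrK => /le_trans; apply; rewrite ler_wpM2l //.
  by rewrite lerXn2r ?nnegrE ?modulus_ge0 // (le_trans (modulus_ge0 _) xiz).
have b2 : modulus (toC V)^`N(l).[xi] <= C1.
  apply: le_trans (_ : N%:R * (2 ^+ N * ((1 + T) * Hc%:R) * (2 * T) ^+ N) <= _).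
    apply: modulus_horner => //.
    - by rewrite (leq_trans (size_nderivn _ _)) // (leq_trans (size_poly _ _)).
    - move=> i; apply: modulus_nderivn; first by rewrite (leq_trans (size_poly _ _)).
      move=> j; rewrite coef_map /= modulus_int.
      apply: le_trans (_ : Hc%:R <= _).
        by rewrite -[Hc%:R]/((Hc : int)%:~R) ler_int -abszE lez_nat; exact: hV.
      by rewrite ler_peMl ?ler0n // lerDl.
    - rewrite -(subrK z xi); apply: le_trans (ler_modulusD _ _) _.
      have := le_trans xiz D1; move: (modulus (xi - z)) (modulus z) zT T1; clear.
      by move=> a b; lra.
  rewrite /C1 -[X in X <= _]mul1r; apply: ler_pM; rewrite ?ler01 ?mulr_ge0 ?ler0n ?exprn_ge0 ?addr_ge0 ?mulr_ge0 //.
    by rewrite ler1n.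
  apply: ler_wpM2l; first by rewrite ler0n.
  apply: ler_wpM2r; first by rewrite exprn_ge0 ?mulr_ge0.
  apply: ler_wpM2r; first by rewrite mulr_ge0 ?addr_ge0.
  by rewrite lerXn2r ?nnegrE ?ler0n // ler_nat.
have b3 : modulus (G^`N(l).[xi] + (z - x2%:~R / y2%:R) * (toC V)^`N(l).[xi])
   <= C1 * (T ^+ (2 * n) / Y1 ^+ n) ^+ (10 * s - l) + T ^+ (2 * n) / Y2 ^+ n * C1.
  apply: le_trans (ler_modulusD _ _) _; apply: lerD => //.
  by rewrite modulusM ler_pM ?modulus_ge0.
move: b3; set a := C1 * _; set b := _ * C1; set m := modulus _ => b3 one.
have le2 : Y1 ^+ N.-1 * (Y2 * m) <= Y1 ^+ N * (Y2 * (a + b)).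
  apply: ler_pM.
  - exact: exprn_ge0 (ltW Y1p).
  - by rewrite mulr_ge0 ?modulus_ge0 ?ler0n.
  - by rewrite ler_weXn2l ?leq_pred // ler1n ltnW.
  - by rewrite ler_wpM2l ?ler0n.
have := le_trans one le2; rewrite mulrA mulrDr.
move: t1 t2; rewrite -/Y1 -/Y2 -/a -/b -/e -/N.
move: (Y1 ^+ N * Y2 * a) (Y1 ^+ N * Y2 * b); clear => u v; lra.
Qed.

(** * The discriminant *)

Lemma deriv_prod (A : comNzRingType) (I : finType) (F : I -> {poly A}) :
  (\prod_i F i)^`() = \sum_i (F i)^`() * \prod_(j | j != i) F j.
Proof.
suff H (r : seq I) : uniq r -> (\prod_(i <- r) F i)^`()
    = \sum_(i <- r) (F i)^`() * \prod_(j <- r | j != i) F j.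
  by rewrite H // index_enum_uniq.
elim: r => [|x r IHr] /=; first by rewrite !big_nil derivC.
case/andP => xr ur; rewrite !big_cons derivM eqxx IHr //=; congr (_ * _ + _).
  rewrite big_seq [RHS]big_seq_cond; apply: eq_bigl => j.
  by case: (boolP (j \in r)) => //= jr; apply/esym; apply: contraNneq xr => <-.
rewrite mulr_sumr big_seq [RHS]big_seq; apply: eq_bigr => i ir.
have xi : x != i by apply: contraNneq xr => ->.
by rewrite big_cons xi mulrCA.
Qed.

Lemma prod_sym_pairs (A : comNzRingType) n (g : 'I_n -> 'I_n -> A) :
  (forall i j, g i j = g j i) ->
  \prod_i \prod_(j | j != i) g i j = (\prod_(i < n) \prod_(j < n | (i < j)%N) g i j) ^+ 2.
Proof.
move=> gs; transitivity (\prod_(i < n) ((\prod_(j < n | (i < j)%N) g i j)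
    * \prod_(j < n | (j < i)%N) g i j)).
  apply: eq_bigr => i _; rewrite (bigID (fun j : 'I_n => (i < j)%N)) /=; congr (_ * _).
    by apply: eq_bigl => j; case: ltngtP => //; rewrite ?andbF // -val_eqE neq_ltn => ->; rewrite ?orbT.
  apply: eq_bigl => j; rewrite -leqNgt -val_eqE /=; by case: ltngtP.
rewrite big_split /= expr2; congr (_ * _).
rewrite (exchange_big_dep xpredT) //=; apply: eq_bigr => i _; apply: eq_bigr => j _; exact: gs.
Qed.

Section Discriminant.
Variables (R : realType) (n : nat) (f : {poly int}) (al : 'I_n -> R[i]).
Hypotheses (n1 : (1 < n)%N) (hf : minimal_at_roots R f n).
Local Notation toC := (map_poly (intr : int -> R[i])).
Local Notation a := (lead_coef f).
Hypothesis fE : toC f = a%:~R *: \prod_i ('X - (al i)%:P).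

(** The cofactor f / (X - al k). Sums over k of products of its coefficients are integers; the
    integrality of the discriminant is derived from them. *)
Let q (k : 'I_n) : {poly R[i]} := a%:~R *: \prod_(i | i != k) ('X - (al i)%:P).

Let fq k : toC f = q k * ('X - (al k)%:P).
Proof. by rewrite fE (bigD1 k) //= -scalerAl mulrC. Qed.

Let rootal k : root (toC f) (al k).
Proof. by rewrite (fq k) rootM root_XsubC eqxx orbT. Qed.

Let sumq : \sum_k q k = toC f^`().
Proof.
rewrite -deriv_map fE derivZ deriv_prod scaler_sumr; apply: eq_bigr => k _.
by rewrite derivXsubC mul1r.
Qed.

Let isint (x : R[i]) := exists m : int, x = m%:~R.

Let isintD x y : isint x -> isint y -> isint (x + y).
Proof. by case=> m -> [p ->]; exists (m + p); rewrite rmorphD. Qed.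
Let isintN x : isint x -> isint (- x).
Proof. by case=> m ->; exists (- m); rewrite rmorphN. Qed.
Let isintM x y : isint x -> isint y -> isint (x * y).
Proof. by case=> m -> [p ->]; exists (m * p); rewrite rmorphM. Qed.
Let isintf j : isint (f`_j)%:~R. Proof. by exists f`_j. Qed.

Let isint_sumq j : isint (\sum_k (q k)`_j).
Proof. by rewrite -coef_sum sumq coef_map; exists (f^`()`_j). Qed.

Let qrec k j : al k * (q k)`_j.+1 = (q k)`_j - (f`_j.+1)%:~R.
Proof.
have := congr1 (fun p : {poly _} => p`_j.+1) (fq k).
by rewrite coef_map /= mulrBr coefB coefMX /= coefMC => ->; ring.
Qed.

Let qrec0 k : al k * (q k)`_0 = - (f`_0)%:~R.
Proof.
have := congr1 (fun p : {poly _} => p`_0) (fq k).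
by rewrite coef_map /= mulrBr coefB coefMX /= coefMC => ->; ring.
Qed.

(** Comparing coefficients in f = q_k (X - al k) trades the indices (i + 1, j) for (i, j + 1), at
    the price of integer multiples of sums of single coefficients of the q_k, which are coefficients
    of f'. Index 0 ends the descent. *)
Let isint_sumqq i j : isint (\sum_k (q k)`_i * (q k)`_j).
Proof.
elim: i j => [|i IHi] j.
  have -> : \sum_k (q k)`_0 * (q k)`_j = \sum_k ((f`_j.+1)%:~R * (q k)`_0 - (f`_0)%:~R * (q k)`_j.+1).
    apply: eq_bigr => k _; have := qrec k j; have := qrec0 k => E0 E1.
    have -> : (q k)`_j = al k * (q k)`_j.+1 + (f`_j.+1)%:~R by rewrite E1; ring.
    by rewrite mulrDr mulrCA mulrA E0; ring.
  rewrite sumrB -!mulr_sumr; apply: isintD; first exact: isintM.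
  by apply: isintN; apply: isintM.
have -> : \sum_k (q k)`_i.+1 * (q k)`_j = \sum_k ((q k)`_i * (q k)`_j.+1
    + ((f`_j.+1)%:~R * (q k)`_i.+1 - (f`_i.+1)%:~R * (q k)`_j.+1)).
  apply: eq_bigr => k _; have := qrec k j; have := qrec k i => E0 E1.
  have -> : (q k)`_j = al k * (q k)`_j.+1 + (f`_j.+1)%:~R by rewrite E1; ring.
  have -> : (q k)`_i = al k * (q k)`_i.+1 + (f`_i.+1)%:~R by rewrite E0; ring.
  by ring.
rewrite big_split sumrB -!mulr_sumr; apply: isintD; first exact: IHi.
by apply: isintD; [exact: isintM|apply: isintN; exact: isintM].
Qed.

Let a0 : (a%:~R : R[i]) != 0.
Proof. by rewrite intr_eq0 lead_coef_eq0 -size_poly_eq0 hf.1. Qed.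

Let size_q k : (size (q k) <= n)%N.
Proof.
rewrite size_scale // size_prod; last by move=> i _; rewrite polyXsubC_eq0.
under eq_bigr do rewrite size_XsubC.
rewrite sum_nat_const.
have -> : #|[pred i : 'I_n | i != k]| = n.-1 by rewrite cardC1 card_ord.
by rewrite muln2 -addnn -addSn addnK prednK // ltnW.
Qed.

Let lead_q k : (q k)`_n.-1 = a%:~R.
Proof.
have := qrec k n.-1; rewrite prednK ?(ltnW n1) //.
rewrite (nth_default 0 (size_q k)).
rewrite mulr0 => /esym/eqP; rewrite subr_eq0 => /eqP ->.
by rewrite lead_coefE hf.1.
Qed.

Let Q : 'M[R[i]]_n := \matrix_(k, j) (q k)`_j.
(** The last column of [Q] is constantly the leading coefficient a. Dividing it by a lowers the
    power of a in the squared determinant from 2 n to 2 n - 2, the exponent of the discriminant. *)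
Let W : 'M[R[i]]_n := \matrix_(k, j) if (j : nat) == n.-1 then 1 else (q k)`_j.
Let Dg : 'rV[R[i]]_n := \row_j if (j : nat) == n.-1 then a%:~R else 1.
Let V : 'M[R[i]]_n := Vandermonde n (\row_j al j).

Let QW : Q = W *m diag_mx Dg.
Proof.
apply/matrixP => k j; rewrite mul_mx_diag !mxE.
by case: eqP => [->|_]; rewrite ?mulr1 // lead_q mul1r.
Qed.

Let detDg : \det (diag_mx Dg) = a%:~R.
Proof.
have ltn1 : (n.-1 < n)%N by rewrite prednK // ltnW.
rewrite det_diag (bigD1 (Ordinal ltn1)) //= mxE eqxx big1 ?mulr1 // => i /negPf.
by rewrite mxE -val_eqE /= => ->.
Qed.

Let QV : Q *m V = diag_mx (\row_k (q k).[al k]).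
Proof.
apply/matrixP => k l; rewrite !mxE.
have -> : \sum_j Q k j * V j l = (q k).[al l].
  rewrite (horner_coef_wide _ (size_q k)); apply: eq_bigr => j _; by rewrite !mxE.
have [->|kl] := eqVneq k l; first by rewrite mulr1n.
rewrite mulr0n /q hornerZ horner_prod (bigD1 l) 1?eq_sym //=.
by rewrite hornerXsubC subrr mul0r mulr0.
Qed.

Let intT : exists m : int, \det (W^T *m W) = m%:~R.
Proof.
have H i j : isint ((W^T *m W) i j).
  rewrite mxE; have -> : \sum_k W^T i k * W k j = \sum_k W k i * W k j.
    by apply: eq_bigr => k _; rewrite mxE.
  have [ei|ei] := boolP ((i : nat) == n.-1); have [ej|ej] := boolP ((j : nat) == n.-1).
  - exists n%:Z; rewrite (eq_bigr (fun=> 1)) ?sumr_const ?card_ord //.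
    by move=> k _; rewrite !mxE ei ej mulr1.
  - rewrite (eq_bigr (fun k => (q k)`_j)) // => k _.
    by rewrite !mxE ei (negPf ej) mul1r.
  - rewrite (eq_bigr (fun k => (q k)`_i)) // => k _.
    by rewrite !mxE ej (negPf ei) mulr1.
  - rewrite (eq_bigr (fun k => (q k)`_i * (q k)`_j)) // => k _.
    by rewrite !mxE (negPf ei) (negPf ej).
have /boolp.choice[T0 T0E] : forall ij : 'I_n * 'I_n, exists m : int, (W^T *m W) ij.1 ij.2 = m%:~R.
  by move=> [i j]; exact: H.
exists (\det (\matrix_(i, j) T0 (i, j))); rewrite -det_map_mx; congr (\det _).
by apply/matrixP => i j; rewrite [RHS]mxE [X in _ = X%:~R]mxE -T0E.
Qed.

(** The right-hand side is the modulus of det(W^T W), where W^T W has integer entries; it is nonzero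
    because det Q det V is the product of the f'(al k). *)
Lemma discriminant_ge1 :
  1 <= modulus a%:~R ^+ (2 * n.-1) * \prod_i \prod_(j | j != i) modulus (al i - al j).
Proof.
have -> : \prod_i \prod_(j | j != i) modulus (al i - al j) = modulus (\det V) ^+ 2.
  rewrite prod_sym_pairs; last by move=> i j; rewrite modulusB.
  congr (_ ^+ 2); rewrite det_Vandermonde modulus_prod; apply: eq_bigr => i _.
  by rewrite modulus_prod; apply: eq_bigr => j _; rewrite !mxE modulusB.
have qal k : (q k).[al k] = (toC f)^`().[al k].
  rewrite (fq k) derivM derivXsubC mulr1 hornerD hornerM hornerXsubC subrr mulr0 add0r.
  by [].
have detQV : \det Q * \det V = \prod_k (q k).[al k].
  by rewrite -det_mulmx QV det_diag; apply: eq_bigr => k _; rewrite mxE.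
have detQV0 : \det Q * \det V != 0.
  rewrite detQV; apply/prodf_neq0 => k _; rewrite qal.
  exact: (simple_root n1 hf (rootal k)).
have detV0 : \det V != 0 by move: detQV0; rewrite mulf_eq0 negb_or => /andP[].
have qV : modulus (\prod_k (q k).[al k]) = modulus a%:~R ^+ n * modulus (\det V) ^+ 2.
  rewrite modulus_prod (eq_bigr (fun k => modulus a%:~R * \prod_(j | j != k) modulus (al k - al j))).
    rewrite big_split prodr_const card_ord /= prod_sym_pairs; last by move=> i j; rewrite modulusB.
    congr (_ * _ ^+ 2); rewrite det_Vandermonde modulus_prod; apply: eq_bigr => i _.
    by rewrite modulus_prod; apply: eq_bigr => j _; rewrite !mxE modulusB.
  move=> k _; rewrite /q hornerZ modulusM horner_prod modulus_prod; congr (_ * _).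
  by apply: eq_bigr => j _; rewrite hornerXsubC.
have mQ : modulus (\det Q) = modulus a%:~R ^+ n * modulus (\det V).
  have mV0 : modulus (\det V) != 0 by rewrite modulus_eq0.
  by apply: (mulIf mV0); rewrite -modulusM detQV qV; ring.
have mW : modulus (\det W) = modulus a%:~R ^+ n.-1 * modulus (\det V).
  have ma0 : modulus (a%:~R : R[i]) != 0 by rewrite modulus_eq0.
  apply: (mulIf ma0); rewrite -modulusM -[X in _ * X]detDg -det_mulmx -QW mQ.
  by rewrite mulrAC -exprSr prednK // ltnW.
have [t tE] := intT.
rewrite (mulnC 2%N) exprM -exprMn -mW -modulusX.
have <- : \det (W^T *m W) = \det W ^+ 2 by rewrite det_mulmx det_tr expr2.
rewrite tE; apply: modulus_int_ge1; rewrite -(intr_eq0 R[i]) -tE det_mulmx det_tr.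
have : \det W != 0.
  by move: detQV0; rewrite QW det_mulmx -mulrA mulf_eq0 negb_or => /andP[].
by move=> W0; rewrite mulf_neq0.
Qed.

End Discriminant.

(** * Products of linear forms *)

Lemma hev_prod (A : comNzRingType) n (F : 'I_n -> {poly A}) x y :
  (forall i, (size (F i) <= 2)%N) -> hev n (\prod_i F i) x y = \prod_i hev 1 (F i) x y.
Proof.
move=> sF; suff H (r : seq 'I_n) : (size (\prod_(i <- r) F i)%R <= (size r).+1)%N /\
    hev (size r) (\prod_(i <- r) F i) x y = \prod_(i <- r) hev 1 (F i) x y.
  by have [_] := H (enum 'I_n); rewrite size_enum_ord !big_enum.
elim: r => [|i r [sr IHr]]; first by rewrite !big_nil hev1 size_poly1.
rewrite !big_cons; split; last by rewrite -IHr -hevM.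
apply: leq_trans (size_polyMleq _ _) _.
by rewrite -subn1 leq_subLR; apply: leq_trans (leq_add (sF i) sr) _.
Qed.

Section LinearForms.
Variable R : realType.
Implicit Types (u v : R[i] * R[i]).

Definition lin u (x y : R[i]) : R[i] := u.1 * x + u.2 * y.
Definition lmax u : R := Num.max (modulus u.1) (modulus u.2).
Definition det2 u v : R[i] := u.1 * v.2 - u.2 * v.1.

Lemma lmax_ge0 u : 0 <= lmax u.
Proof. by rewrite /lmax le_max modulus_ge0. Qed.

Lemma lmax1 u : modulus u.1 <= lmax u. Proof. by rewrite /lmax le_max lexx. Qed.
Lemma lmax2 u : modulus u.2 <= lmax u. Proof. by rewrite /lmax le_max lexx orbT. Qed.

Lemma modulus_det2 u v : modulus (det2 u v) <= 2 * (lmax u * lmax v).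
Proof.
apply: le_trans (ler_modulusBD _ _) _; rewrite !modulusM mulr_natl mulr2n.
by apply: lerD; apply: ler_pM; rewrite ?modulus_ge0 ?lmax1 ?lmax2.
Qed.

Variable n : nat.
Implicit Types l : 'I_n -> R[i] * R[i].

Definition mahler l : R := \prod_i lmax (l i).
Definition disc2 l : R := \prod_i \prod_(j | j != i) modulus (det2 (l i) (l j)).

(* The linear forms (x, y) |-> l_i (p x + q y, r x + s y). *)
Definition lact l (p q r s : int) (i : 'I_n) : R[i] * R[i] :=
  (lin (l i) p%:~R r%:~R, lin (l i) q%:~R s%:~R).

Definition factors (f : {poly int}) l : Prop :=
  forall x y : R[i], hev n (map_poly intr f) x y = \prod_i lin (l i) x y.

Lemma mahler_ge0 l : 0 <= mahler l.
Proof. by apply: prodr_ge0 => i _; exact: lmax_ge0. Qed.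

Lemma factors_subst f l p q r s :
  factors f l -> factors (subst_form n f p q r s) (lact l p q r s).
Proof.
move=> fl x y.
have -> : map_poly intr (subst_form n f p q r s) =
  subst_form n (map_poly intr f) p%:~R q%:~R r%:~R s%:~R :> {poly R[i]} by exact: map_subst_form.
rewrite hev_subst_form fl; apply: eq_bigr => i _; rewrite /lin /lact /lin /=.
by move: (p%:~R : R[i]) (q%:~R : R[i]) (r%:~R : R[i]) (s%:~R : R[i]) => p' q' r' s'; ring.
Qed.

Lemma factors_int f l (x y : int) : factors f l ->
  (`|hev n f x y|%:~R : R) = \prod_i modulus (lin (l i) x%:~R y%:~R).
Proof. by move=> fl; rewrite -modulus_int -modulus_prod -fl (@hev_map _ _ intr). Qed.

Lemma disc2_lact l p q r s :
  disc2 (lact l p q r s) = modulus (p * s - q * r)%:~R ^+ (n * n.-1) * disc2 l.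
Proof.
rewrite /disc2 exprM; have -> : forall z : R[i],
    (modulus z ^+ n) ^+ n.-1 = \prod_(i < n) \prod_(j < n | j != i) modulus z.
  move=> z; rewrite exprAC -[X in _ ^+ X = _](card_ord n) -prodr_const; apply: eq_bigr => i _.
  by rewrite prodr_const cardC1 card_ord.
rewrite -big_split; apply: eq_bigr => i _; rewrite -big_split; apply: eq_bigr => j _ /=.
rewrite -modulusM; congr modulus.
by rewrite /det2 /lact /lin /= rmorphB !rmorphM /=; ring.
Qed.

(** Each index occurs in 2 (n - 1) of the n (n - 1) ordered pairs. *)
Lemma prod_pairs (m : 'I_n -> R) :
  \prod_i \prod_(j | j != i) (2 * (m i * m j)) = 2 ^+ (n * n.-1) * (\prod_i m i) ^+ (2 * n.-1).
Proof.
have c (i : 'I_n) (z : R) : \prod_(j < n | j != i) z = z ^+ n.-1.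
  by rewrite prodr_const cardC1 card_ord.
transitivity (\prod_(i < n) (2 ^+ n.-1 * (m i ^+ n.-1 * \prod_(j < n | j != i) m j))).
  by apply: eq_bigr => i _; rewrite !big_split /= !c.
rewrite !big_split /= prodr_const card_ord -exprM mulnC; congr (_ * _).
rewrite (exchange_big_dep xpredT) //= mulSn mul1n exprD -!prodrXl.
congr (_ * _); apply: eq_bigr => i _.
by rewrite -(c i); apply: eq_bigl => j; rewrite eq_sym.
Qed.

Lemma disc2_mahler l : disc2 l <= 2 ^+ (n * n.-1) * mahler l ^+ (2 * n.-1).
Proof.
rewrite -prod_pairs; apply: ler_prod => i _; rewrite prodr_ge0 => [|j _]; last exact: modulus_ge0.
by apply: ler_prod => j _; rewrite modulus_ge0 modulus_det2.
Qed.

Lemma factorization (f : {poly int}) : (1 < n)%N -> minimal_at_roots R f n ->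
  exists2 l, factors f l & 1 <= disc2 l.
Proof.
move=> n1 hf; have [sf _] := hf.
pose a : R[i] := (lead_coef f)%:~R.
have a0 : a != 0 by rewrite intr_eq0 lead_coef_eq0 -size_poly_eq0 sf.
have [r rE] := closed_field_poly_normal (map_poly (intr : int -> R[i]) f).
have lE : lead_coef (map_poly (intr : int -> R[i]) f) = a.
  by rewrite lead_coef_map_inj //; exact: intr_inj.
rewrite lE in rE.
have sr : size r = n.
  have := congr1 (fun p : {poly _} => size p) rE.
  rewrite size_map_inj_poly ?sf //; last exact: intr_inj.
  by rewrite size_scale // size_prod_XsubC => -[].
pose al (i : 'I_n) : R[i] := r`_i.
have fE : map_poly (intr : int -> R[i]) f = a *: \prod_i ('X - (al i)%:P).
  rewrite {1}rE; congr (_ *: _).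
  by rewrite (big_nth 0) sr big_mkord.
(* The leading coefficient is shared equally among the forms: each pair contributes c^2 (al i - al
   j), and |c|^(2 n (n - 1)) = |a|^(2 (n - 1)). *)
pose c := n.-root a.
have cn : c ^+ n = a by rewrite rootCK // ltnW.
exists (fun i => (c, - (c * al i))).
  move=> x y; rewrite fE hevZ hev_prod => [|i]; last by rewrite size_XsubC.
  rewrite -cn -[X in c ^+ X](card_ord n) -prodr_const -big_split; apply: eq_bigr => i _.
  have -> : 'X - (al i)%:P = 1 *: 'X + (- al i)%:P by rewrite scale1r polyCN.
  by rewrite hev_lin /lin /=; ring.
have := discriminant_ge1 n1 hf fE; rewrite -/a => /le_trans; apply.
rewrite -cn modulusX -exprM.
have -> : modulus c ^+ (n * (2 * n.-1)) = \prod_(i < n) \prod_(j < n | j != i) modulus c ^+ 2.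
  rewrite (eq_bigr (fun=> (modulus c ^+ 2) ^+ n.-1)) => [|i _]; last first.
    by rewrite prodr_const cardC1 card_ord.
  by rewrite prodr_const card_ord -!exprM; congr (_ ^+ _); ring.
rewrite -big_split /disc2 le_eqVlt; apply/orP; left; apply/eqP; apply: eq_bigr => i _.
rewrite -big_split; apply: eq_bigr => j _ /=.
by rewrite /det2 /= -modulusX -modulusM; congr modulus; ring.
Qed.

End LinearForms.

(** * Small solutions *)

Section Chain.
Variables (R : realType) (T : eqType) (x0 : T) (y w : T -> R) (P : pred T) (Y : R).

Let leY : rel T := fun a b => y a <= y b.

Let chain_path a t : uniq (a :: t) -> path leY a t ->
  {in a :: t &, forall b c, b != c -> leY b c -> y b * Num.max 1 (w b) <= y c} ->
  y a * \prod_(b <- belast a t) Num.max 1 (w b) <= y (last a t).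
Proof.
elim: t a => [|b t IHt] a /=; first by rewrite big_nil mulr1.
case/andP; rewrite inE negb_or => /andP[ab at_] ut /andP[lab pt] H.
rewrite big_cons mulrA; apply: le_trans (IHt b ut pt _) => [|c d cin din]; last first.
  by apply: H; rewrite inE ?cin ?din orbT.
apply: ler_wpM2r; first by apply: prodr_ge0 => c _; rewrite le_max ler01.
by apply: H; rewrite ?inE ?eqxx ?orbT.
Qed.

(** Sort the elements of [P] by [y]: the factors telescope and are bounded by the last value, at
    most Y. The largest element has no successor, hence the exception [e]; elements outside [P]
    contribute 1. *)
Lemma chain_prod (S : seq T) : uniq S -> 1 <= Y ->
  (forall x, x \in S -> 1 <= y x <= Y) ->
  (forall x, x \in S -> ~~ P x -> w x <= 1) ->
  (forall a b, a \in S -> b \in S -> a != b -> P a -> P b -> y a <= y b -> y a * w a <= y b) ->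
  exists e, \prod_(x <- S | x != e) Num.max 1 (w x) <= Y.
Proof.
move=> uS Y1 yS nP HP.
pose s := sort leY (filter P S).
have mems b : (b \in s) = P b && (b \in S) by rewrite mem_sort mem_filter.
have us : uniq s by rewrite sort_uniq filter_uniq.
have prodE e : \prod_(x <- S | x != e) Num.max 1 (w x) = \prod_(x <- s | x != e) Num.max 1 (w x).
  rewrite [RHS](perm_big (filter P S)) /=; last by rewrite /s perm_sort.
  rewrite big_filter_cond (bigID P) /= [X in _ * X]big_seq_cond [X in _ * X]big1 ?mulr1.
    by apply: eq_bigl => b; rewrite andbC.
  by move=> b /and3P[bS _ nPb]; apply/max_idPl; exact: nP.
have ss : sorted leY s by apply: sort_sorted => a b; exact: le_total.
case E : s => [|a t].
  by exists x0; rewrite prodE E big_nil.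
exists (last a t); rewrite prodE E; rewrite E /= in ss us mems.
have H : {in a :: t &, forall b c, b != c -> leY b c -> y b * Num.max 1 (w b) <= y c}.
  move=> b c; rewrite !mems => /andP[Pb bS] /andP[Pc cS] bc lbc.
  have /andP[yb _] := yS b bS.
  rewrite maxr_pMr ?(le_trans ler01) // ge_max mulr1; apply/andP; split; [exact: lbc|exact: HP].
have := @chain_path a t us ss H.
rewrite lastI -cats1 big_cat big_cons big_nil eqxx /= mulr1.
have -> : \prod_(x <- belast a t | x != last a t) Num.max 1 (w x) = \prod_(x <- belast a t) Num.max 1 (w x).
  rewrite big_seq_cond [RHS]big_seq; apply: eq_bigl => b.
  case bb : (b \in belast a t) => //=; apply: contraTneq us => be.
  by rewrite -[(_ \notin _) && _]/(uniq (a :: t)) lastI rcons_uniq -be bb.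
have ain : a \in a :: t by rewrite inE eqxx.
have lin : last a t \in a :: t by rewrite mem_last.
rewrite mems in ain; rewrite mems in lin.
have /andP[_ aS] := ain; have /andP[_ lS] := lin.
have /andP[ya _] := yS _ aS; have /andP[_ yl] := yS _ lS => hh.
apply: le_trans yl; apply: le_trans hh; rewrite ler_peMl //.
by apply: prodr_ge0 => c _; rewrite le_max ler01.
Qed.

End Chain.

Lemma bezout_reduced (x y : int) : 0 < y -> coprimez x y ->
  exists w : int * int, x * w.2 - w.1 * y = 1 /\ 2 * `|w.2| <= y.
Proof.
move=> y0 /coprimezP[[u v] /= uv].
(* The integer nearest to u / y: subtracting t (x, y) from a Bezout completion brings its second
   coordinate into [-y/2, y/2]. *)
pose t := ((2 * u + y) %/ (2 * y))%Z.
exists (- v - t * x, u - t * y); split=> /=; first by rewrite -uv; ring.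
have y20 : 2 * y != 0 by rewrite mulf_neq0 // gt_eqF.
have := divz_eq (2 * u + y) (2 * y); have := modz_ge0 (2 * u + y) y20.
have := ltz_pmod (2 * u + y) (_ : 0 < 2 * y); rewrite pmulr_rgt0 // => /(_ y0).
rewrite -/t; move: ((2 * u + y) %% (2 * y))%Z t => r t' h1 h2 h3.
have rE : r - y = 2 * (u - t' * y).
  have -> : r = 2 * u + y - t' * (2 * y) by rewrite h3; ring.
  by ring.
have : `|r - y| <= y by rewrite ler_norml; move: h1 h2; clear; lia.
by rewrite rE normrM normr_nat.
Qed.

Lemma primitive_det_neq0 (x x' : int * int) : 0 < x.2 -> 0 < x'.2 ->
  coprimez x.1 x.2 -> coprimez x'.1 x'.2 -> x != x' -> x.1 * x'.2 - x'.1 * x.2 != 0.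
Proof.
move=> x2 x2' cx cx' xx'; apply: contraNneq xx' => d0.
have E : x.1 * x'.2 = x'.1 * x.2 by apply/eqP; rewrite -subr_eq0 d0.
have e2 : x.2 = x'.2.
  have d1 : (x.2 %| x'.2)%Z.
    rewrite -(Gauss_dvdzr _ (_ : coprimez x.2 x.1)); last by rewrite coprimez_sym.
    by rewrite E dvdz_mull.
  have d2 : (x'.2 %| x.2)%Z.
    rewrite -(Gauss_dvdzr _ (_ : coprimez x'.2 x'.1)); last by rewrite coprimez_sym.
    by rewrite -E dvdz_mull.
  rewrite -(gtz0_abs x2) -(gtz0_abs x2'); congr Posz; apply/eqP.
  by rewrite eqn_dvd -!dvdzE d1 d2.
have x20 : x'.2 != 0 by rewrite gt_eqF.
have e1 : x.1 = x'.1 by apply: (mulIf x20); rewrite E e2.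
by rewrite -pair_eqE /pair_eq /= e1 e2 !eqxx.
Qed.

Lemma lin_bezout (R : realType) (u : R[i] * R[i]) (x y x' y' : R[i]) :
  x * y' - x' * y = 1 -> y * lin u x' y' = y' * lin u x y - u.1.
Proof.
move=> E; transitivity (y' * lin u x y - u.1 * (x * y' - x' * y)); last by rewrite E mulr1.
by rewrite /lin; ring.
Qed.

(** Here u is the second coordinate of a solution x, v is |L_i(x)| and t the modulus of the first
    coefficient of L_i. The first hypothesis puts x far from the root; then |L_i| at the completing
    vector is at most 3 |L_i(x)|. *)
Lemma gap_far (R : realType) (u v t : R) :
  t < 2 * u * v -> 0 < v -> 1 <= u -> t + u / 2 * v <= u * (3 * v).
Proof.
move=> h1 h2 h3; have u0 : 0 < u by lra.
have uv : 0 < u * v by rewrite mulr_gt0.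
by lra.
Qed.

(** For two solutions close to the same root, u and u' are the values |L_i|, v and v' the second
    coordinates; [da] is [b] times the modulus of their determinant. The second solution is so close
    that u' v is at most b / 2. *)
Lemma gap_det (R : realType) (da b u u' v v' : R) :
  2 * v' * u' <= b -> u' * v <= u' * v' -> b <= da -> da <= u * v' + u' * v ->
  b <= 2 * (u * v').
Proof. by lra. Qed.

Lemma gap_near (R : realType) (u v t b : R) :
  2 * u * t <= b -> b <= 2 * (t * v) -> 0 <= t -> 0 <= v -> b + u / 2 * t <= v * 3 * t.
Proof.
move=> h1 h2 h3 h4; have tv : 0 <= t * v by rewrite mulr_ge0.
by lra.
Qed.

Section SmallSolutions.
Variables (R : realType) (n m : nat) (l : 'I_n -> R[i] * R[i]) (B Y : R).
Hypotheses (m0 : (0 < m)%N) (Y1 : 1 <= Y).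
Hypothesis l10 : forall i, (l i).1 != 0.
Hypothesis hB : forall p q r s : int, p * s - q * r = 1 -> B <= mahler (lact l p q r s).
Variable S : seq (int * int).
Hypothesis uS : uniq S.
Hypothesis hS : forall x, x \in S ->
  [/\ 0 < x.2, coprimez x.1 x.2, x.2%:~R <= Y
    & 0 < \prod_i modulus (lin (l i) x.1%:~R x.2%:~R) <= m%:R].

Let L i (x : int * int) : R := modulus (lin (l i) x.1%:~R x.2%:~R).

(* The next solution close to the same root is larger by the factor
   [rho x / 3], and the product of the [rho] is a Mahler measure divided by
   |F(x)|, since [(x, w x)] is a unimodular basis. *)
Lemma small_solutions : 1 <= B / (m%:R * 3 ^+ n) ->
  (B / (m%:R * 3 ^+ n)) ^+ (size S - n) <= Y ^+ n.
Proof.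
move=> base1.
have /boolp.choice[w hw] : forall x : int * int, exists w : int * int,
    x \in S -> x.1 * w.2 - w.1 * x.2 = 1 /\ 2 * `|w.2| <= x.2.
  move=> x; case: (boolP (x \in S)) => [xS|_]; last by exists (0, 0).
  by have [x2 cx _ _] := hS xS; have [w ?] := bezout_reduced x2 cx; exists w.
pose yR (x : int * int) : R := x.2%:~R.
have y1 x : x \in S -> 1 <= yR x.
  by move=> xS; have [x2 _ _ _] := hS xS; rewrite /yR ler1z -gtz0_ge1.
have L0 i x : x \in S -> 0 < L i x.
  move=> xS; have [_ _ _ /andP[p0 _]] := hS xS.
  rewrite lt_neqAle modulus_ge0 andbT eq_sym; apply: contraTneq p0 => Li.
  by rewrite (bigD1 i) //= -/(L i x) Li mul0r ltxx.
pose rho i x := lmax (lin (l i) x.1%:~R x.2%:~R, lin (l i) (w x).1%:~R (w x).2%:~R) / L i x.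
pose a i : R := modulus (l i).1.
have a0 i : 0 < a i by rewrite modulus_gt0.
(* The solutions with |x - alpha y| <= 1 / (2 y), where alpha is the root of L_i. *)
pose P i := [pred x | 2 * yR x * L i x <= a i].
(* By the Bezout relation y L_i(w) is w_2 L_i(x) minus the first coefficient of L_i, and |w_2| <= y
   / 2. *)
have key i x : x \in S -> yR x * L i (w x) <= a i + yR x / 2 * L i x.
  move=> xS; have [detw hw2] := hw _ xS; have [x2 _ _ _] := hS xS.
  have -> : yR x * L i (w x) = modulus (x.2%:~R * lin (l i) (w x).1%:~R (w x).2%:~R).
    by rewrite modulusM modulus_int gtr0_norm.
  have -> : x.2%:~R * lin (l i) (w x).1%:~R (w x).2%:~R
      = (w x).2%:~R * lin (l i) x.1%:~R x.2%:~R - (l i).1.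
    by apply: lin_bezout; rewrite -!rmorphM -rmorphB /= detw.
  apply: le_trans (ler_modulusBD _ _) _; rewrite addrC lerD2l modulusM modulus_int.
  apply: ler_wpM2r; first exact: modulus_ge0.
  rewrite ler_pdivlMr // mulrC -[2]/((2 : int)%:~R) -rmorphM /= ler_int.
  exact: hw2.
have F1 i x : x \in S -> ~~ P i x -> rho i x / 3 <= 1.
  move=> xS; rewrite /= -ltNge => nP; have := key i x xS; have := y1 x xS; have := L0 i x xS.
  move=> Lp yp K; rewrite ler_pdivrMr // mul1r /rho ler_pdivrMr // ge_max.
  apply/andP; split; first by rewrite /= -/(L i x) ler_peMl ?ltW //; lra.
  rewrite /= -/(L i (w x)).
  have yp0 : 0 < yR x by lra.
  rewrite -(ler_pM2l yp0); apply: le_trans K _; exact: gap_far.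
have F2 i x x' : x \in S -> x' \in S -> x != x' -> P i x -> P i x' -> yR x <= yR x' ->
    yR x * (rho i x / 3) <= yR x'.
  move=> xS xS' xx' /= Px Px' yy'.
  have K := key i x xS; have yp := y1 x xS; have Lp := L0 i x xS; have Lp' := L0 i x' xS'.
  (* The determinant of x and x', a nonzero integer, times the first coefficient of L_i equals y'
     L_i(x) - y L_i(x'). *)
  have a2 : a i <= 2 * (L i x * yR x').
    have [x2 cx _ _] := hS xS; have [x2' cx' _ _] := hS xS'.
    pose d := x.1 * x'.2 - x'.1 * x.2.
    have d0 : d != 0 by exact: primitive_det_neq0.
    have : modulus (d%:~R * (l i).1) <= L i x * yR x' + L i x' * yR x.
      have -> : d%:~R * (l i).1 = lin (l i) x.1%:~R x.2%:~R * x'.2%:~R - lin (l i) x'.1%:~R x'.2%:~R * x.2%:~R.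
        rewrite rmorphB !rmorphM /= /lin.
        by move: (x.1%:~R : R[i]) (x.2%:~R : R[i]) (x'.1%:~R : R[i]) (x'.2%:~R : R[i]) => *; ring.
      by apply: le_trans (ler_modulusBD _ _) _; rewrite !modulusM !modulus_int !gtr0_norm.
    rewrite modulusM; have d1 := modulus_int_ge1 R d0.
    have : a i <= modulus d%:~R * a i by rewrite ler_peMl // ltW.
    have : L i x' * yR x <= L i x' * yR x' by rewrite ler_wpM2l // ltW.
    exact: gap_det.
  rewrite mulrA ler_pdivrMr // mulrA ler_pdivrMr //.
  rewrite maxr_pMr ?(le_trans ler01) // ge_max /= -/(L i x) -/(L i (w x)).
  apply/andP; split.
    apply: ler_wpM2r; first exact: ltW.
    apply: (le_trans yy').
    apply: ler_peMr; last by rewrite ler1n.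
    exact: le_trans ler01 (le_trans yp yy').
  apply: le_trans K _; apply: gap_near => //; first exact: ltW.
  exact: le_trans ler01 (le_trans yp yy').
have /boolp.choice[e he] : forall i, exists e, \prod_(x <- S | x != e) Num.max 1 (rho i x / 3) <= Y.
  move=> i; apply: (@chain_prod R _ (0, 0) yR _ (P i)) => //.
  - by move=> x xS; rewrite y1 //=; have [_ _ ? _] := hS xS.
  - exact: F1.
  - exact: F2.
(* At most n solutions are discarded, one exception for each linear form. *)
pose S' := [seq x <- S | x \notin codom e].
have sS' : (size S - n <= size S')%N.
  rewrite leq_subLR -(count_predC (mem (codom e)) S) size_filter leq_add2r.
  have sc : size (codom e) = n by rewrite size_codom card_ord.
  rewrite -size_filter -[X in (_ <= X)%N]sc; apply: uniq_leq_size; first exact: filter_uniq.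
  by move=> x; rewrite mem_filter => /andP[].
apply: (@le_trans _ _ (\prod_(x <- S') \prod_i Num.max 1 (rho i x / 3))); last first.
  rewrite exchange_big /= -[X in _ ^+ X]card_ord -prodr_const; apply: ler_prod => i _.
  apply/andP; split; first by apply: prodr_ge0 => x _; rewrite le_max ler01.
  apply: le_trans (he i).
  rewrite big_filter [X in _ <= X](bigID (fun x => x \notin codom e)) /=.
  rewrite [X in _ <= X * _](eq_bigl (fun x => x \notin codom e)); last first.
    move=> x; case: (boolP (x \in codom e)) => [_|xe]; rewrite ?andbF //= andbT.
    by apply: contraNneq xe => ->; exact: codom_f.
  rewrite ler_peMr //; first by apply: prodr_ge0 => x _; rewrite le_max ler01.
  by apply: (big_ind (fun z => 1 <= z)) => // [u v|x _]; [exact: mulr_ege1|rewrite le_max lexx].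
apply: (@le_trans _ _ ((B / (m%:R * 3 ^+ n)) ^+ size S')); first by rewrite ler_weXn2l.
have B0 : 0 <= B.
  apply: le_trans (_ : m%:R * 3 ^+ n <= _); first by rewrite mulr_ge0 ?exprn_ge0 ?ler0n.
  by move: base1; rewrite ler_pdivlMr ?mul1r // mulr_gt0 ?exprn_gt0 ?ltr0n.
have base x : x \in S -> B / (m%:R * 3 ^+ n) <= \prod_i Num.max 1 (rho i x / 3).
  move=> xS; have [_ _ _ /andP[p0 pm]] := hS xS; have [detw _] := hw _ xS.
  apply: (@le_trans _ _ (\prod_i (rho i x / 3))); last first.
    apply: ler_prod => i _; rewrite le_max lexx orbT andbT.
    by rewrite !divr_ge0 ?lmax_ge0 ?modulus_ge0 ?ler0n.
  rewrite !prodf_div prodr_const card_ord invfM mulrA ler_pM2r ?invr_gt0 ?exprn_gt0 ?ltr0n //.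
  apply: ler_pM => //; first by rewrite invr_ge0 ler0n.
    exact: (hB detw).
  by rewrite lef_pV2 ?posrE ?ltr0n.
have subS' : {subset S' <= S} by move=> x; rewrite mem_filter => /andP[].
elim: S' subS' {sS'} => [|x s IHs] sub; first by rewrite big_nil expr0.
rewrite big_cons exprS; apply: ler_pM.
- exact: le_trans ler01 base1.
- by rewrite exprn_ge0 // (le_trans ler01 base1).
- by apply: base; apply: sub; rewrite inE eqxx.
- by apply: IHs => z zs; apply: sub; rewrite inE zs orbT.
Qed.

End SmallSolutions.

(** * Large solutions *)

Lemma eq_poly_horner (R : realType) (p q : {poly R[i]}) : (forall x, p.[x] = q.[x]) -> p = q.
Proof.
move=> H; apply/eqP; rewrite -subr_eq0; apply/negPn/negP => d0.
have := @max_poly_roots _ (p - q) [seq (i%:R : R[i]) | i <- iota 0 (size (p - q))] d0.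
rewrite size_map size_iota ltnn => H'; apply: notF; apply: H'.
  by apply/allP => _ /mapP[i _ ->]; rewrite /root hornerD hornerN H subrr.
rewrite map_inj_uniq ?iota_uniq // => i j /eqP; by rewrite eqr_nat => /eqP.
Qed.

Lemma coef_prod_lin (R : realType) (I : Type) (r : seq I) (l : I -> R[i] * R[i]) k :
  modulus (\prod_(i <- r) ((l i).1 *: 'X + (l i).2%:P))`_k <= \prod_(i <- r) (2 * lmax (l i)).
Proof.
elim: r k => [|i r IHr] k.
  by rewrite !big_nil coef1; case: eqP => _; rewrite ?modulus1 ?modulus0.
rewrite !big_cons mulrDl coefD -scalerAl coefZ coefXM coefCM mulr_natl mulr2n mulrDl.
apply: le_trans (ler_modulusD _ _) _; rewrite !modulusM; apply: lerD; apply: ler_pM;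
  rewrite ?modulus_ge0 ?lmax1 ?lmax2 //.
case: ifP => // _; rewrite modulus0; apply: prodr_ge0 => j _.
by rewrite mulr_ge0 ?lmax_ge0.
Qed.

Section Roots.
Variables (R : realType) (n : nat) (f : {poly int}) (l : 'I_n -> R[i] * R[i]).
Hypotheses (n1 : (1 < n)%N) (hf : minimal_at_roots R f n) (fl : factors f l).

(** The product is |F(1, 0)|, a nonzero integer. *)
Lemma lead_forms_ge1 : 1 <= \prod_i modulus (l i).1.
Proof.
have := factors_int 1 0 fl; rewrite (eq_bigr (fun i => modulus (l i).1)) => [<-|i _]; last first.
  by rewrite /lin mulr1 mulr0 addr0.
rewrite ler1z -gtz0_ge1 normr_gt0.
by apply: (hev_neq0 n1 hf).
Qed.

Lemma lead_form_neq0 i : (l i).1 != 0.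
Proof.
have := lead_forms_ge1; rewrite (bigD1 i) //=; apply: contraTneq => ->.
by rewrite modulus0 mul0r -ltNge ltr01.
Qed.

Definition form_root i : R[i] := - ((l i).2 / (l i).1).

Lemma linE i x y : lin (l i) x y = (l i).1 * (x - form_root i * y).
Proof. by rewrite /lin /form_root; have := lead_form_neq0 i; move=> ?; field. Qed.

Lemma form_rootP i : root (map_poly intr f) (form_root i).
Proof.
rewrite /root -(@hev_horner _ n) ?size_map_inj_poly ?hf.1 //; last exact: intr_inj.
by rewrite fl (bigD1 i) //= linE mulr1 subrr mulr0 mul0r.
Qed.

(** Multiply numerator and denominator of the root by the first coefficients of the other forms: the
    numerator is then at most the Mahler measure and the denominator at least 1. *)
Lemma modulus_form_root i : modulus (form_root i) <= mahler l.
Proof.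
have a1 := lead_forms_ge1; rewrite (bigD1 i) //= in a1.
set Pi := \prod_(j | _) _ in a1.
have Pi0 : 0 < Pi by apply: prodr_gt0 => j _; rewrite modulus_gt0 lead_form_neq0.
have ai0 : 0 < modulus (l i).1 by rewrite modulus_gt0 lead_form_neq0.
rewrite /form_root modulusN modulusM modulusV ler_pdivrMr //.
rewrite -(ler_pM2r Pi0); apply: le_trans (_ : mahler l <= _); last first.
  by rewrite -mulrA ler_peMr // mahler_ge0.
rewrite /mahler (bigD1 i) //=; apply: ler_pM; [exact: modulus_ge0|exact: ltW|exact: lmax2|].
by apply: ler_prod => j _; rewrite modulus_ge0 lmax1.
Qed.

Lemma height_form : exists2 H : nat, height_le f H & H%:R <= 2 ^+ n * mahler l.
Proof.
have fE : map_poly intr f = \prod_i ((l i).1 *: 'X + (l i).2%:P) :> {poly R[i]}.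
  apply: eq_poly_horner => x.
  rewrite -(@hev_horner _ n) ?size_map_inj_poly ?hf.1 //; last exact: intr_inj.
  rewrite fl horner_prod; apply: eq_bigr => i _.
  by rewrite hornerD hornerZ hornerX hornerC /lin mulr1.
have M0 : 0 <= 2 ^+ n * mahler l by rewrite mulr_ge0 ?exprn_ge0 ?mahler_ge0.
exists (\max_(k < n.+1) absz (f`_k)%R).
  move=> k; have [kn|nk] := ltnP k n.+1; last by rewrite nth_default ?hf.1.
  exact: (leq_bigmax (Ordinal kn)).
elim/big_ind: _ => // [a b|k _]; first by rewrite /maxn; case: ifP.
rewrite natr_absz; have := @coef_prod_lin R _ (index_enum 'I_n) l k; rewrite -fE coef_map /= modulus_int.
by rewrite big_split /= prodr_const card_ord.
Qed.

End Roots.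

Lemma prod_pairs_away (R : realType) n (i : 'I_n) (m : 'I_n -> R) :
  \prod_(j | j != i) \prod_(k | (k != j) && (k != i)) (2 * (m j * m k))
  = 2 ^+ (n.-1 * n.-2) * (\prod_(j | j != i) m j) ^+ (2 * n.-2).
Proof.
have c (j : 'I_n) (z : R) : j != i -> \prod_(k < n | (k != j) && (k != i)) z = z ^+ n.-2.
  move=> ji; rewrite prodr_const; congr (_ ^+ _).
  have := cardD1 j [pred k | k != i]; rewrite cardC1 card_ord inE ji add1n.
  by rewrite (eq_card (_ : _ =i [pred k | (k != j) && (k != i)])) // => ->.
have c1 (z : R) : \prod_(j < n | j != i) z = z ^+ n.-1 by rewrite prodr_const cardC1 card_ord.
transitivity (\prod_(j < n | j != i) (2 ^+ n.-2 * (m j ^+ n.-2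
    * \prod_(k < n | (k != j) && (k != i)) m k))).
  by apply: eq_bigr => j ji; rewrite !big_split /= !c.
rewrite !big_split /= c1 -exprM mulnC; congr (_ * _).
rewrite (exchange_big_dep (fun k => k != i)) /=; last by move=> j k _ /andP[].
rewrite mulSn mul1n exprD -!prodrXl; congr (_ * _); apply: eq_bigr => k ki.
rewrite -(c k) //; apply: eq_bigl => j.
by rewrite ki andbT [j == k]eq_sym andbC.
Qed.

(** * Distance from a solution to the nearest root *)

Section Approximation.
Variables (R : realType) (n m : nat) (f : {poly int}) (l : 'I_n -> R[i] * R[i]) (T : R).
Hypotheses (n3 : (3 <= n)%N) (hf : minimal_at_roots R f n) (fl : factors f l).
Hypotheses (disc1 : 1 <= disc2 l) (MT : mahler l <= T) (m0 : (0 < m)%N).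
Hypothesis mT : 8 ^+ n * m%:R ^+ 4 <= T.

Let n1 : (1 < n)%N. Proof. exact: leq_trans n3. Qed.
Let al := form_root l.
Definition root_dist i (x : int * int) : R := modulus (x.1%:~R - al i * x.2%:~R).
Local Notation dist := root_dist.

Definition nearest i (x : int * int) := forall j, dist i x <= dist j x.

Lemma nearest_exists x : exists i, nearest i x.
Proof.
have i0 : 'I_n := Ordinal (ltnW n1).
case: (@arg_minP _ R 'I_n i0 xpredT (fun i => dist i x) isT) => i _ H.
by exists i => j; exact: H.
Qed.

(** Since i is nearest, y |al i - al j| <= 2 |x - al j y|, so |F| <= m bounds d y^(n-1) times the
    product E of the |det(L_i, L_j)|. The discriminant bounds E from below: it is E^2 times the
    pairs avoiding i, which are estimated by the other forms alone. This yields the exponent 2 (n -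
    2) of M. *)
Lemma nearest_bound i x : nearest i x -> 0 < x.2 -> `|hev n f x.1 x.2| <= m%:Z ->
  (dist i x * x.2%:~R ^+ n.-1) ^+ 2 <= m%:R ^+ 2 * 2 ^+ (n * n.-1) * mahler l ^+ (2 * n.-2).
Proof.
move=> near x20 xm; set y : R := x.2%:~R; set d := dist i x.
have y0 : 0 < y by rewrite ltr0z.
have d0 : 0 <= d by exact: modulus_ge0.
pose a j := modulus (l j).1.
have a0 j : 0 < a j by rewrite modulus_gt0 (lead_form_neq0 n1 hf fl).
pose E := \prod_(j | j != i) modulus (det2 (l i) (l j)).
have detE j k : modulus (det2 (l j) (l k)) = a j * a k * modulus (al j - al k).
  rewrite -!modulusM; congr modulus; rewrite /det2 /al /form_root.
  have := lead_form_neq0 n1 hf fl j; have := lead_form_neq0 n1 hf fl k => ? ?.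
  by field; apply/andP.
have EE : E = a i ^+ n.-1 * \prod_(j | j != i) (a j * modulus (al i - al j)).
  rewrite /E (eq_bigr (fun j => a i * (a j * modulus (al i - al j)))).
    by rewrite big_split /= prodr_const cardC1 card_ord.
  by move=> j _; rewrite detE mulrA.
have le1 : d * y ^+ n.-1 * E <= m%:R * 2 ^+ n.-1 * a i ^+ n.-2.
  have up : a i * d * \prod_(j | j != i) (a j * dist j x) <= m%:R.
    have := xm; rewrite -(ler_int R) (factors_int _ _ fl) (bigD1 i) //=.
    rewrite -pmulrn; apply: le_trans; rewrite (linE n1 hf fl) modulusM -/(a i) -/(dist i x) -/d.
    apply: ler_wpM2l; first by rewrite mulr_ge0 // ltW.
    rewrite le_eqVlt; apply/orP; left; apply/eqP; apply: eq_bigr => j _.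
    by rewrite (linE n1 hf fl) modulusM.
  have le2 : y ^+ n.-1 * \prod_(j | j != i) (a j * modulus (al i - al j))
      <= 2 ^+ n.-1 * \prod_(j | j != i) (a j * dist j x).
    have c1 (z : R) : z ^+ n.-1 = \prod_(j < n | j != i) z by rewrite prodr_const cardC1 card_ord.
    rewrite !c1 -!big_split; apply: ler_prod => j ji /=; apply/andP; split.
      by rewrite !mulr_ge0 ?modulus_ge0 // ltW.
    rewrite mulrCA [leRHS]mulrCA; apply: ler_wpM2l; first exact: ltW.
    have -> : y * modulus (al i - al j) = modulus ((x.1%:~R - al j * x.2%:~R) - (x.1%:~R - al i * x.2%:~R)).
      have -> : (x.1%:~R - al j * x.2%:~R) - (x.1%:~R - al i * x.2%:~R) = x.2%:~R * (al i - al j).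
        by move: (x.1%:~R : R[i]) (x.2%:~R : R[i]) => u v; ring.
      by rewrite modulusM modulus_int gtr0_norm.
    apply: le_trans (ler_modulusBD _ _) _; rewrite mulr_natl mulr2n lerD2l.
    exact: near.
  have -> : d * y ^+ n.-1 * E = a i ^+ n.-2 * (a i * d) *
       (y ^+ n.-1 * \prod_(j | j != i) (a j * modulus (al i - al j))).
    have n12 : n.-1 = n.-2.+1 by rewrite prednK // -ltnS prednK // ltnW.
    by rewrite EE [in a i ^+ _]n12 exprS; ring.
  apply: le_trans (ler_wpM2l _ le2) _.
    by rewrite !mulr_ge0 ?exprn_ge0 // ltW.
  have -> : a i ^+ n.-2 * (a i * d) * (2 ^+ n.-1 * \prod_(j | j != i) (a j * dist j x))
    = (a i * d * \prod_(j | j != i) (a j * dist j x)) * (2 ^+ n.-1 * a i ^+ n.-2) by ring.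
  rewrite -[leRHS]mulrA; apply: ler_wpM2r => //.
  by rewrite mulr_ge0 ?exprn_ge0 // ltW.
have E0 : 0 <= E by apply: prodr_ge0 => j _; exact: modulus_ge0.
pose Q := \prod_(j | j != i) lmax (l j).
have Q0 : 0 <= Q by apply: prodr_ge0 => j _; exact: lmax_ge0.
have le3 : disc2 l <= E ^+ 2 * (2 ^+ (n.-1 * n.-2) * Q ^+ (2 * n.-2)).
  rewrite /disc2 (bigD1 i) //= -/E expr2 -mulrA; apply: ler_wpM2l => //.
  rewrite -(prod_pairs_away i (fun j => lmax (l j))) /E -big_split /=; apply: ler_prod => j ji.
  rewrite prodr_ge0 => [|k _]; last exact: modulus_ge0.
  rewrite (bigD1 i) 1?eq_sym //=; apply: ler_pM; rewrite ?modulus_ge0 //.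
  - by apply: prodr_ge0 => k _; exact: modulus_ge0.
  - by rewrite !detE modulusB [a j * a i]mulrC.
  - by apply: ler_prod => k _; rewrite modulus_ge0 modulus_det2.
set c := d * y ^+ n.-1 in le1 *.
have c0 : 0 <= c by rewrite mulr_ge0 // exprn_ge0 // ltW.
apply: le_trans (_ : c ^+ 2 * disc2 l <= _); first by rewrite ler_peMr // exprn_ge0.
apply: le_trans (ler_wpM2l (exprn_ge0 2 c0) le3) _.
have -> : c ^+ 2 * (E ^+ 2 * (2 ^+ (n.-1 * n.-2) * Q ^+ (2 * n.-2)))
  = (c * E) ^+ 2 * (2 ^+ (n.-1 * n.-2) * Q ^+ (2 * n.-2)) by ring.
have le4 : (c * E) ^+ 2 <= (m%:R * 2 ^+ n.-1 * a i ^+ n.-2) ^+ 2.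
  by rewrite lerXn2r ?nnegrE ?mulr_ge0 ?exprn_ge0 ?ler0n // ltW.
apply: le_trans (ler_wpM2r _ le4) _; first by rewrite mulr_ge0 // exprn_ge0.
have -> : (m%:R * 2 ^+ n.-1 * a i ^+ n.-2) ^+ 2 * (2 ^+ (n.-1 * n.-2) * Q ^+ (2 * n.-2))
  = m%:R ^+ 2 * 2 ^+ (n.-1 * 2 + n.-1 * n.-2) * (a i * Q) ^+ (n.-2 * 2) :> R.
  by rewrite [(2 * n.-2)%N]mulnC !exprMn exprD -!exprM; ring.
have -> : (n.-1 * 2 + n.-1 * n.-2 = n * n.-1)%N.
  rewrite -mulnDr [(n * _)%N]mulnC; congr (_ * _)%N.
  by case: n n3 => [|[|k]].
rewrite [(2 * n.-2)%N]mulnC; apply: ler_wpM2l; first by rewrite mulr_ge0 ?exprn_ge0 ?ler0n.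
rewrite lerXn2r ?nnegrE ?mulr_ge0 ?mahler_ge0 //; first exact: ltW.
by rewrite /mahler (bigD1 i) //= ler_wpM2r // lmax1.
Qed.

Let T512 : 512 <= T.
Proof.
apply: le_trans mT; apply: le_trans (_ : 8 ^+ n * 1 <= _); last first.
  by rewrite ler_wpM2l ?exprn_ge0 // exprn_ege1 // ler1n.
rewrite mulr1; apply: le_trans (_ : 8 ^+ 3 <= _); first by rewrite -natrX ler_nat.
by rewrite ler_weXn2l // ler1n.
Qed.

Let T1 : 1 <= T. Proof. by apply: le_trans T512; rewrite ler1n. Qed.
Let T0 : 0 <= T. Proof. exact: le_trans ler01 T1. Qed.

(** Fourth powers turn m into m^4, which [T] dominates, and the power of 2 into (4^n)^(n - 1) <=
    T^(n - 1); with M^(4 (n - 2)) the exponents add up to 5 (n - 1) - 3. *)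
Lemma nearest_bound4 i x : nearest i x -> 0 < x.2 -> `|hev n f x.1 x.2| <= m%:Z ->
  (dist i x * x.2%:~R ^+ n.-1) ^+ 4 <= T ^+ (5 * n.-1).
Proof.
move=> near x2 xm; have := nearest_bound near x2 xm.
set c := dist i x * _ => H; have c0 : 0 <= c ^+ 2 by exact: sqr_ge0.
rewrite (exprM c 2 2); apply: le_trans (_ : (m%:R ^+ 2 * 2 ^+ (n * n.-1) * mahler l ^+ (2 * n.-2)) ^+ 2 <= _).
  by rewrite lerXn2r ?nnegrE // (le_trans c0).
have -> : (m%:R ^+ 2 * 2 ^+ (n * n.-1) * mahler l ^+ (2 * n.-2)) ^+ 2
    = m%:R ^+ 4 * (4 ^+ n) ^+ n.-1 * mahler l ^+ (4 * n.-2).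
  have -> : (4 : R) = 2 ^+ 2 by rewrite -natrX.
  have e1 : (n * n.-1 * 2 = n * n.-1 + n * n.-1)%N by ring.
  have e2 : (2 * n.-2 * 2 = 4 * n.-2)%N by ring.
  by rewrite !exprMn -!exprM e1 e2 exprD; ring.
have -> : (5 * n.-1 = 1 + n.-1 + 4 * n.-2 + 3)%N by move: n3; clear; case: n => [|[|k]] //= _; lia.
have -> : T ^+ (1 + n.-1 + 4 * n.-2 + 3) = T * T ^+ n.-1 * T ^+ (4 * n.-2) * T ^+ 3.
  by rewrite exprD; congr (_ * _); rewrite exprD; congr (_ * _); rewrite exprD expr1.
apply: le_trans (_ : T * T ^+ n.-1 * T ^+ (4 * n.-2) <= _); last first.
  by rewrite ler_peMr ?exprn_ege1 // !mulr_ge0 // exprn_ge0.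
have M0 := mahler_ge0 l.
have T8 : 8 ^+ n <= T.
  by apply: le_trans mT; rewrite ler_peMr ?exprn_ge0 // exprn_ege1 // ler1n.
apply: ler_pM; rewrite ?mulr_ge0 ?exprn_ge0 ?ler0n ?exprn_ge0 //.
  apply: ler_pM; rewrite ?exprn_ge0 ?ler0n ?exprn_ge0 //.
    apply: le_trans mT; rewrite ler_peMl ?exprn_ge0 ?ler0n // exprn_ege1 // ler1n.
    by [].
  rewrite lerXn2r ?nnegrE ?exprn_ge0 ?ler0n //; apply: le_trans T8.
  by rewrite lerXn2r ?nnegrE ?ler0n // ler_nat.
by rewrite lerXn2r ?nnegrE.
Qed.

End Approximation.

(** For n = 3 this is 24000 <= 2^15 and 2000 <= 2^11: fifteen steps make y1 large enough for Thue's
    method, and eleven more make y2 >= y1^1000. The factors 4 and 2 translate between y and a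
    normalization of y^4. *)
Lemma growth_exponents (n : nat) : (3 <= n)%N ->
  (2000 * n * 4 <= n.-1 ^ 15)%N /\ (2 * (10 * 100) <= n.-1 ^ 11)%N.
Proof.
move=> n3; have n2 : (2 <= n.-1)%N by move: n3; clear; case: n => [|[|[|]]].
have le1 : (2 * (10 * 100) <= 2 ^ 11)%N by [].
split; last by apply: leq_trans le1 _; rewrite leq_exp2r.
have -> : (2000 * n * 4 = 2 * (10 * 100) * (4 * n))%N by clear; lia.
have le2 : (4 * n <= 2 ^ 3 * n.-1)%N by move: n3; clear; lia.
apply: leq_trans (leq_mul le1 le2) _.
rewrite mulnA -expnD [leqRHS]expnSr leq_mul2r; apply/orP; right.
by rewrite leq_exp2r.
Qed.

(** * Growth of the large solutions *)

Section LargeSolutions.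
Variables (R : realType) (n m : nat) (f : {poly int}) (l : 'I_n -> R[i] * R[i]) (T : R).
Hypotheses (n3 : (3 <= n)%N) (hf : minimal_at_roots R f n) (fl : factors f l).
Hypotheses (disc1 : 1 <= disc2 l) (MT : mahler l <= T) (m0 : (0 < m)%N).
Hypothesis mT : 8 ^+ n * m%:R ^+ 4 <= T.

Let n1 : (1 < n)%N. Proof. exact: leq_trans n3. Qed.

Let T8 : 8 ^+ n <= T.
Proof. by apply: le_trans mT; rewrite ler_peMr ?exprn_ge0 // exprn_ege1 // ler1n. Qed.

Let T512 : 512 <= T.
Proof.
apply: le_trans T8; apply: le_trans (_ : 8 ^+ 3 <= _); first by rewrite -natrX ler_nat.
by rewrite ler_weXn2l // ler1n.
Qed.

Let T1 : 1 <= T. Proof. by apply: le_trans T512; rewrite ler1n. Qed.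
Let T0 : 0 <= T. Proof. exact: le_trans ler01 T1. Qed.
Let Tp : 0 < T. Proof. exact: lt_le_trans ltr01 T1. Qed.

Definition large_solution (x : int * int) : Prop :=
  [/\ 0 < x.2, coprimez x.1 x.2, T ^+ 3 <= x.2%:~R & `|hev n f x.1 x.2| <= m%:Z].

(** Normalized so that the gap principle carries no constant: this needs 1 + 5 (n - 1) <= 11 (n -
    2), an equality for n = 3. *)
Let u (x : int * int) : R := x.2%:~R ^+ 4 / T ^+ 11.

Let u_ge x : large_solution x -> T <= u x.
Proof.
case=> x2 _ yT _; rewrite ler_pdivlMr ?exprn_gt0 // -exprS.
apply: le_trans (_ : (T ^+ 3) ^+ 4 <= _); first by rewrite -exprM.
by rewrite lerXn2r ?nnegrE ?exprn_ge0 // ler0z ltW.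
Qed.

Let half_of_fourth (a : R) : 0 <= a -> a ^+ 4 * T ^+ 2 <= 1 -> a <= 2^-1.
Proof.
move=> a0 h; rewrite leNgt; apply/negP => ha.
have h4 : 2^-1 ^+ 4 <= a ^+ 4 by rewrite lerXn2r ?nnegrE ?invr_ge0 // ltW.
have : 2^-1 ^+ 4 * 512 ^+ 2 <= 1 :> R.
  apply: le_trans h; apply: ler_pM; rewrite ?exprn_ge0 ?invr_ge0 //.
  by rewrite lerXn2r ?nnegrE.
by lra.
Qed.

(** The determinant of x and x' is a nonzero integer, bounded by d y' + d' y. The second term is at
    most 1/2, so d y' >= 1/2, and the upper bound for d forces y' to be large. *)
Let gap i x x' : large_solution x -> large_solution x' -> nearest l i x -> nearest l i x' ->
  x != x' -> x.2 <= x'.2 -> u x ^+ n.-1 <= u x'.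
Proof.
move=> [x2 cx xT xm] [x2' cx' xT' xm'] near near' xx' yy'.
have b := nearest_bound4 n3 hf fl disc1 MT m0 mT near x2 xm.
have b' := nearest_bound4 n3 hf fl disc1 MT m0 mT near' x2' xm'.
move: b b'; set d := root_dist l i x; set d' := root_dist l i x'.
set y : R := x.2%:~R in xT *; set y' : R := x'.2%:~R in xT' * => b b'.
have y0 : 0 < y by rewrite ltr0z.
have y0' : 0 < y' by rewrite ltr0z.
have yy : y <= y' by rewrite ler_int.
have d0 : 0 <= d := modulus_ge0 _.
have d0' : 0 <= d' := modulus_ge0 _.
have h1 : 1 <= d * y' + d' * y.
  apply: le_trans (modulus_int_ge1 R (primitive_det_neq0 x2 x2' cx cx' xx')) _.
  have -> : (x.1 * x'.2 - x'.1 * x.2)%:~R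
     = (x.1%:~R - form_root l i * x.2%:~R) * x'.2%:~R
       - (x'.1%:~R - form_root l i * x'.2%:~R) * x.2%:~R :> R[i].
    rewrite rmorphB !rmorphM /=.
    by move: (x.1%:~R : R[i]) (x.2%:~R : R[i]) (x'.1%:~R : R[i]) (x'.2%:~R : R[i]) => *; ring.
  by apply: le_trans (ler_modulusBD _ _) _; rewrite !modulusM !modulus_int !gtr0_norm.
have n12 : n.-1 = n.-2.+1 by rewrite prednK // -ltnS prednK // ltnW.
(* The threshold T^3 suffices because 5 (n - 1) + 2 <= 12 (n - 2), an equality for n = 3. *)
have h2 : d' * y' <= 2^-1.
  apply: half_of_fourth; first by rewrite mulr_ge0 // ltW.
  have Tn : 0 < T ^+ (5 * n.-1) by rewrite exprn_gt0.
  rewrite -(ler_pM2r Tn) mul1r -mulrA -exprD; apply: le_trans b'.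
  have -> : (d' * y' ^+ n.-1) ^+ 4 = (d' * y') ^+ 4 * (y' ^+ n.-2) ^+ 4.
    by rewrite -exprMn -mulrA -exprS -n12.
  apply: ler_wpM2l; first by rewrite exprn_ge0 // mulr_ge0 // ltW.
  apply: le_trans (_ : ((T ^+ 3) ^+ n.-2) ^+ 4 <= _).
    by rewrite -!exprM ler_weXn2l //; move: n3; clear; lia.
  by rewrite !lerXn2r ?nnegrE ?exprn_ge0 // ltW.
have h3 : 1 <= 2 * (d * y').
  have : d' * y <= d' * y' by rewrite ler_wpM2l.
  by move: h1 h2; lra.
have h4 : 1 <= 16 * (d * y') ^+ 4.
  have -> : 16 = 2 ^+ 4 :> R by rewrite -natrX.
  by rewrite -exprMn exprn_ege1.
have h5 : (y ^+ 4) ^+ n.-1 <= T * (T ^+ (5 * n.-1) * y' ^+ 4).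
  apply: le_trans (_ : 16 * ((d * y ^+ n.-1) ^+ 4 * y' ^+ 4) <= _); last first.
    apply: ler_pM; rewrite ?mulr_ge0 ?exprn_ge0 ?mulr_ge0 ?exprn_ge0 ?(ltW y0) ?(ltW y0') //.
      by apply: le_trans T512; rewrite ler_nat.
    by rewrite ler_wpM2r ?exprn_ge0 // ltW.
  have -> : 16 * ((d * y ^+ n.-1) ^+ 4 * y' ^+ 4) = 16 * (d * y') ^+ 4 * (y ^+ 4) ^+ n.-1.
    by rewrite exprAC; ring.
  by rewrite ler_peMl // !exprn_ge0 // ltW.
rewrite /u -/y -/y' expr_div_n ler_pdivrMr ?exprn_gt0 ?exprn_gt0 //.
apply: le_trans h5 _.
have -> : y' ^+ 4 / T ^+ 11 * (T ^+ 11) ^+ n.-1 = (T ^+ 11) ^+ n.-2 * y' ^+ 4.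
  have -> : (T ^+ 11) ^+ n.-1 = T ^+ 11 * (T ^+ 11) ^+ n.-2 by rewrite -exprS -n12.
  by rewrite mulrA divfK 1?mulrC // expf_neq0 // gt_eqF.
rewrite mulrA; apply: ler_wpM2r; first by rewrite exprn_ge0 // ltW.
rewrite -exprS -exprM ler_weXn2l //.
by move: n3; clear; lia.
Qed.

(** Order 27 solutions by their second coordinate and number them from 0: number 15 has y >= T^(2000
    n), number 26 has y at least the 1000th power of that, and Thue's method excludes such a
    pair. *)
Lemma large_solutions_near i (S : seq (int * int)) : uniq S ->
  (forall x, x \in S -> large_solution x /\ nearest l i x) -> (size S <= 26)%N.
Proof.
move=> uS hS; rewrite leqNgt; apply/negP => sS.
pose leY : rel (int * int) := fun x x' => x.2 <= x'.2.
pose s := sort leY S.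
have mems x : (x \in s) = (x \in S) by rewrite mem_sort.
have us : uniq s by rewrite sort_uniq.
have szs : (26 < size s)%N by rewrite size_sort.
have ss : sorted leY s by apply: sort_sorted => a b; exact: le_total.
pose z : nat -> int * int := nth (0, 0) s.
have zS j : (j < size s)%N -> large_solution (z j) /\ nearest l i (z j).
  by move=> js; apply: hS; rewrite -mems mem_nth.
have grow a j : (a + j < size s)%N -> u (z a) ^+ (n.-1 ^ j) <= u (z (a + j)%N).
  elim: j => [|j IHj] js; first by rewrite addn0 expn0 expr1.
  have js' : (a + j < size s)%N by apply: leq_ltn_trans js; rewrite addnS.
  rewrite expnSr exprM addnS; apply: le_trans (_ : u (z (a + j)%N) ^+ n.-1 <= _).
    rewrite lerXn2r ?nnegrE ?IHj //.
      by rewrite exprn_ge0 // (le_trans T0) // u_ge //; apply: (zS _ _).1; apply: leq_ltn_trans js'; rewrite leq_addr.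
    by rewrite (le_trans T0) // u_ge //; apply: (zS _ _).1.
  rewrite addnS in js.
  have [l1 m1] := zS _ js'; have [l2 m2] := zS _ js.
  apply: (gap l1 l2 m1 m2); first by rewrite /z nth_uniq // neq_ltn leqnn.
  apply: (sorted_leq_nth (leT := leY)) => //; rewrite ?inE //.
  - by move=> p q r; exact: le_trans.
  - by move=> p; exact: lexx.
have [e1 e2] := growth_exponents n3.
have s0 : (0 < size s)%N by apply: leq_ltn_trans szs.
have s15 : (15 < size s)%N by apply: leq_ltn_trans szs.
have [L0 _] := zS _ s0; have [L15 N15] := zS _ s15; have [L26 N26] := zS _ szs.
have u15 : T ^+ (2000 * n * 4) <= u (z 15).
  apply: le_trans (grow 0%N 15%N s15).
  apply: le_trans (_ : T ^+ (n.-1 ^ 15) <= _); first by rewrite ler_weXn2l.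
  by rewrite lerXn2r ?nnegrE // ?(le_trans T0) // u_ge.
have u26 := grow 15%N 11%N szs; rewrite -[(15 + 11)%N]/26%N in u26.
move: L15 N15 L26 N26 u15 u26; set x1 := z 15; set x2 := z 26.
move=> [x12 c1 T31 m1] N1 [x22 c2 T32 m2] N2 u15 u26.
have u15' : 1 <= u x1 by apply: le_trans u15; rewrite exprn_ege1.
have uy (x : int * int) : u x <= x.2%:~R ^+ 4.
  rewrite ler_pdivrMr ?exprn_gt0 // ler_peMr ?exprn_ege1 //.
  by rewrite (exprM _ 2 2) sqr_ge0.
(* By now u(x1) exceeds T^11, the factor lost in the normalization. *)
have yu : x1.2%:~R ^+ 4 <= u x1 ^+ 2.
  have -> : x1.2%:~R ^+ 4 = u x1 * T ^+ 11 by rewrite /u divfK // expf_neq0 // gt_eqF.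
  rewrite expr2 ler_wpM2l ?(le_trans ler01) //; apply: le_trans u15.
  by rewrite ler_weXn2l //; move: n3; clear; lia.
pose y1 := absz x1.2; pose y2 := absz x2.2.
have y1E : (y1 : int) = x1.2 by exact: gtz0_abs.
have c1' : coprimez x1.1 y1 by rewrite y1E.
have y2E : (y2 : int) = x2.2 by exact: gtz0_abs.
have y1R : y1%:R = x1.2%:~R :> R by rewrite -y1E -pmulrn.
have y2R : y2%:R = x2.2%:~R :> R by rewrite -y2E -pmulrn.
have pow4 (a b : R) : 0 <= a -> 0 <= b -> a ^+ 4 <= b ^+ 4 -> a <= b.
  by move=> a0 b0; rewrite ler_pXn2r // ?nnegrE.
have [H hH HT] := height_form hf fl.
have dist_le (x : int * int) : large_solution x -> nearest l i x ->
    modulus (form_root l i - x.1%:~R / (absz x.2)%:R) <= T ^+ (2 * n) / (absz x.2)%:R ^+ n.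
  move=> [p2 _ _ pm] pn; have yE : ((absz x.2)%:R : R) = x.2%:~R by rewrite pmulrn gtz0_abs.
  have yEC : ((absz x.2)%:R : R[i]) = x.2%:~R by rewrite pmulrn gtz0_abs.
  rewrite yE yEC.
  have y0 : 0 < x.2%:~R :> R by rewrite ltr0z.
  have yC0 : x.2%:~R != 0 :> R[i] by rewrite intr_eq0 gt_eqF.
  have -> : form_root l i - x.1%:~R / x.2%:~R = - ((x.1%:~R - form_root l i * x.2%:~R) / x.2%:~R) :> R[i].
    by move: yC0; move: (x.1%:~R : R[i]) (x.2%:~R : R[i]) => p q q0; field.
  rewrite modulusN modulusM modulusV modulus_int gtr0_norm // -/(root_dist l i x).
  have nS : n = n.-1.+1 by rewrite prednK // ltnW.
  rewrite [in X in _ <= _ / _ ^+ X]nS exprSr invfM mulrA ler_pM2r ?invr_gt0 //.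
  rewrite ler_pdivlMr ?exprn_gt0 //; apply: pow4.
  - by rewrite mulr_ge0 ?modulus_ge0 // exprn_ge0 // ltW.
  - by rewrite exprn_ge0.
  apply: le_trans (nearest_bound4 n3 hf fl disc1 MT m0 mT pn p2 pm) _.
  by rewrite -exprM ler_weXn2l //; move: n3; clear; lia.
apply: (@thue_principle R n f (form_root l i) T H x1.1 x2.1 y1 y2) => //.
- exact: (form_rootP n1 hf fl).
- apply: le_trans (_ : 4 * (2 ^+ n * T) <= _).
    by rewrite ler_wpM2l // (le_trans HT) // ler_wpM2l ?exprn_ge0.
  rewrite mulrA exprSr; apply: ler_wpM2r => //; rewrite expr2; apply: ler_pM; rewrite ?exprn_ge0 //.
    by apply: le_trans T512; rewrite ler_nat.
  by apply: le_trans T8; rewrite lerXn2r ?nnegrE // ler_nat.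
- exact: le_trans (modulus_form_root n1 hf fl i) MT.
- rewrite y1R; apply: pow4; rewrite ?exprn_ge0 ?ler0z ?(ltW x12) //.
  by rewrite -exprM; apply: le_trans u15 (uy _).
- rewrite -(ler_nat R) natrX y1R y2R; apply: pow4; rewrite ?exprn_ge0 ?ler0z ?(ltW x12) ?(ltW x22) //.
  rewrite -exprM mulnC exprM; apply: le_trans (_ : (u x1 ^+ 2) ^+ (10 * 100) <= _).
    by rewrite lerXn2r ?nnegrE ?exprn_ge0 ?ler0z ?(ltW x12) // (le_trans ler01).
  rewrite -exprM; apply: le_trans (uy x2); apply: le_trans u26.
  by rewrite ler_weXn2l.
- exact: dist_le.
- exact: dist_le.
Qed.

Lemma large_solutions (S : seq (int * int)) : uniq S ->
  (forall x, x \in S -> large_solution x) -> (size S <= 26 * n)%N.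
Proof.
move=> uS hS.
have /boolp.choice[c hc] : forall x, exists i, nearest l i x by move=> x; exact: nearest_exists n3 _.
rewrite -sum1_size (partition_big c xpredT) //=.
apply: leq_trans (_ : \sum_(i < n) 26 <= _)%N; last by rewrite sum_nat_const card_ord mulnC.
apply: leq_sum => i _; rewrite sum1_count -size_filter.
apply: (@large_solutions_near i); first exact: filter_uniq.
by move=> x; rewrite mem_filter => /andP[/eqP <- xS]; split; [exact: hS|exact: hc].
Qed.

End LargeSolutions.

(** * Counting up to sign *)

Section ThueLists.
Variables (n m : nat).

(** Counting up to sign is encoded by lists of representatives that contain no opposite pair,
    whatever signs were chosen. *)
Definition thue_list (f : {poly int}) (S : seq (int * int)) : Prop :=
  [/\ uniq S, forall x, x \in S -> (- x.1, - x.2) \notin S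
    & forall x, x \in S -> coprimez x.1 x.2 /\ `|hev n f x.1 x.2| <= m%:Z].

Lemma thue_list_subst f p q r s S : p * s - q * r = 1 -> thue_list f S ->
  exists2 S', thue_list (subst_form n f p q r s) S' & size S' = size S.
Proof.
move=> det [uS nS hS].
pose g (x : int * int) := (s * x.1 - q * x.2, p * x.2 - r * x.1).
pose h (x : int * int) := (p * x.1 + q * x.2, r * x.1 + s * x.2).
have hg : cancel g h.
  case=> x y; rewrite /h /g /=; congr pair.
    have -> : p * (s * x - q * y) + q * (p * y - r * x) = (p * s - q * r) * x by ring.
    by rewrite det mul1r.
  have -> : r * (s * x - q * y) + s * (p * y - r * x) = (p * s - q * r) * y by ring.
  by rewrite det mul1r.
have gE x : p * (g x).1 + q * (g x).2 = x.1 /\ r * (g x).1 + s * (g x).2 = x.2.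
  by have := hg x; case: x => x y [].
exists (map g S); last by rewrite size_map.
split; first by rewrite map_inj_uniq //; exact: can_inj hg.
  move=> _ /mapP[x xS ->]; apply/negP => /mapP[x' xS'] /(congr1 h); rewrite hg => E.
  have [E1 E2] := gE x; have Ex : x' = (- x.1, - x.2).
    move: E E1 E2; case: (g x) => u v /= <- <- <-.
    by rewrite /h /=; congr pair; ring.
  by have := nS x xS; rewrite -Ex xS'.
move=> _ /mapP[x xS ->]; have [cx xm] := hS x xS.
have [] := gE x; case: (g x) => g1 g2 /= E1 E2.
split; last by rewrite hev_subst_form E1 E2.
case/coprimezP: cx => [[u v] /= uv]; apply/coprimezP; exists (u * p + v * r, u * q + v * s) => /=.
by rewrite -uv -[in RHS]E1 -[in RHS]E2; ring.
Qed.

(** Changing signs makes y positive. The only primitive pairs with y = 0 are (1, 0) and (-1, 0), of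
    which the list contains at most one: hence the successor. *)
Lemma thue_list_normalize f S : thue_list f S ->
  exists S', [/\ uniq S', (size S <= (size S').+1)%N
    & forall x, x \in S' -> [/\ 0 < x.2, coprimez x.1 x.2 & `|hev n f x.1 x.2| <= m%:Z]].
Proof.
move=> [uS nS hS].
pose S0 := [seq x <- S | x.2 != 0].
pose g (x : int * int) := if 0 < x.2 then x else (- x.1, - x.2).
have szS : (size S <= (size S0).+1)%N.
  rewrite -(count_predC (fun x : int * int => x.2 != 0) S) -size_filter -/S0 -addn1 leq_add2l.
  rewrite -size_filter.
  have y0 (x : int * int) : x \in S -> x.2 == 0 -> x = (1, 0) \/ x = (-1, 0).
    move=> xS /eqP x2; have [cx _] := hS x xS.
    have : absz x.1 = 1%N by move: cx; rewrite x2 /coprimez gcdz0 => /eqP [].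
    by case: x x2 {xS cx} => x y /= ->; case: x => [[|[|k]]|[|k]] //= _; [left|right].
  case: (boolP ((1, 0) \in S)) => [S1|S1].
    apply: (@uniq_leq_size _ _ [:: (1, 0)]); first exact: filter_uniq.
    move=> x; rewrite mem_filter /= negbK => /andP[x2 xS]; rewrite inE.
    have [->//|E] := y0 x xS x2; have := nS _ S1; rewrite /= oppr0 => /negP; case.
    by rewrite -E.
  apply: (@uniq_leq_size _ _ [:: (-1, 0)]); first exact: filter_uniq.
  move=> x; rewrite mem_filter /= negbK => /andP[x2 xS]; rewrite inE.
  by have [E|->//] := y0 x xS x2; move: S1; rewrite -E xS.
exists (map g S0); split.
- rewrite map_inj_in_uniq ?filter_uniq // => x x'.
  rewrite !mem_filter => /andP[x2 xS] /andP[x2' xS']; rewrite /g.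
  have nn (y : int * int) : (- - y.1, - - y.2) = y by rewrite !opprK; case: y.
  case: ifP => [p1|p1]; case: ifP => [p2|p2] // E.
  + by move: (nS _ xS'); rewrite -E xS.
  + by move: (nS _ xS); rewrite E xS'.
  + by rewrite -(nn x) -(nn x'); case: E => -> ->.
- by rewrite size_map.
- move=> _ /mapP[x xS ->]; move: xS; rewrite mem_filter => /andP[x2 xS].
  have [cx xm] := hS x xS; rewrite /g; case: ifP => [p1|p1] //=.
  split.
  + by rewrite oppr_gt0 lt_neqAle x2 leNgt p1.
  + by rewrite coprimezN coprimeNz.
  + have -> : - x.1 = -1 * x.1 by rewrite mulN1r.
    have -> : - x.2 = -1 * x.2 by rewrite mulN1r.
    by rewrite hev_scale normrM normrX normrN1 expr1n mul1r.
Qed.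

End ThueLists.

(** * Sublattices of index P *)

Section Lattices.
Variables (R : realType) (n m P : nat) (l : 'I_n -> R[i] * R[i]).
Hypotheses (n3 : (3 <= n)%N) (m0 : (0 < m)%N) (disc1 : 1 <= disc2 l).

Lemma lin_lact a b c d i (x y : int) :
  lin (lact l a b c d i) x%:~R y%:~R = lin (l i) (a * x + b * y)%:~R (c * x + d * y)%:~R.
Proof.
rewrite /lact /lin /= !rmorphD !rmorphM /=.
by move: (x%:~R : R[i]) (y%:~R : R[i]) (a%:~R : R[i]) (b%:~R : R[i]) (c%:~R : R[i]) (d%:~R : R[i]) => *; ring.
Qed.

Lemma mahler_lact2 a b c d p q r s :
  mahler (lact (lact l a b c d) p q r s)
  = mahler (lact l (a * p + b * r) (a * q + b * s) (c * p + d * r) (c * q + d * s)).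
Proof. by apply: eq_bigr => i _; congr lmax; rewrite {1}/lact !lin_lact. Qed.

Let B : R := (17 / 2) ^+ n * m%:R ^+ 4.
Hypothesis BP : B ^+ 2 <= (P%:R / 2) ^+ n.

Let B0 : 0 < B. Proof. by rewrite mulr_gt0 ?exprn_gt0 ?divr_gt0 ?ltr0n. Qed.

(** The discriminant gives P^(n (n - 1)) <= 2^(n (n - 1)) M^(2 (n - 1)); taking (n - 1)-th roots, (P
    / 2)^n <= M^2. *)
Lemma mahler_sublattice a b c d : a * d - b * c = P%:Z -> B <= mahler (lact l a b c d).
Proof.
move=> det; have := disc2_mahler (lact l a b c d); rewrite disc2_lact det modulus_int.
rewrite ger0_norm // -pmulrn => H.
have M0 := mahler_ge0 (lact l a b c d).
have n10 : (0 < n.-1)%N by move: n3; clear; case: n => [|[|]].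
rewrite -(@ler_pXn2r _ 2%N) ?nnegrE ?(ltW B0) //.
apply: le_trans BP _.
rewrite -(@ler_pXn2r _ n.-1) ?nnegrE ?exprn_ge0 ?divr_ge0 ?ler0n //.
rewrite -!exprM expr_div_n ler_pdivrMr ?exprn_gt0 // [leRHS]mulrC.

apply: (le_trans _ H); rewrite ler_peMr // exprn_ge0 //.
Qed.

(** With 8 n solutions, the 7 n-th power of B / (m 3^n) = (17/6)^n m^3 would be at most B^(3 n),
    whereas (17/6)^7 > (17/2)^3 and m^21 >= m^12. *)
Lemma class_small a b c d (S : seq (int * int)) : a * d - b * c = P%:Z ->
  (forall i, lin (l i) a%:~R c%:~R != 0) -> uniq S ->
  (forall x, x \in S -> [/\ 0 < x.2, coprimez x.1 x.2, x.2%:~R <= B ^+ 3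
     & 0 < \prod_i modulus (lin (l i) (a * x.1 + b * x.2)%:~R (c * x.1 + d * x.2)%:~R) <= m%:R]) ->
  (size S < 8 * n)%N.
Proof.
move=> det ac0 uS hS; rewrite ltnNge; apply/negP => sS.
have m1 : 1 <= m%:R :> R by rewrite ler1n.
have B1 : 1 <= B by rewrite mulr_ege1 // exprn_ege1 //; lra.
pose base : R := B / (m%:R * 3 ^+ n).
have baseE : base = (17 / 6) ^+ n * m%:R ^+ 3.
  have -> : (17 / 6 : R) = 17 / 2 / 3 by field.
  rewrite /base /B [(17 / 2 / 3) ^+ n]expr_div_n.
  have mR : m%:R != 0 :> R by rewrite pnatr_eq0 -lt0n.
  have t0 : 3 ^+ n != 0 :> R by rewrite expf_neq0 // pnatr_eq0.
  by field; rewrite ?mR ?t0.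
have base1 : 1 <= base by rewrite baseE mulr_ege1 // exprn_ege1 //; lra.
have := @small_solutions R n m (lact l a b c d) B (B ^+ 3) m0 _ ac0 _ S uS _ base1.
have -> : 1 <= B ^+ 3 by rewrite exprn_ege1.
move=> /(_ isT) H.
have {}H : base ^+ (size S - n) <= (B ^+ 3) ^+ n.
  apply: H.
    move=> p q r s pqrs; rewrite mahler_lact2; apply: mahler_sublattice.
    transitivity ((a * d - b * c) * (p * s - q * r)); first by ring.
    by rewrite det pqrs mulr1.
  move=> x xS; have [h1 h2 h3 h4] := hS x xS; split=> //.
  by under eq_bigr do rewrite lin_lact.
have n0 : (0 < n)%N by apply: leq_trans n3.
have : base ^+ (7 * n) <= (B ^+ 3) ^+ n.
  apply: le_trans H; rewrite ler_weXn2l // leq_subRL; last by apply: leq_trans sS; rewrite leq_pmull.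
  by rewrite -mulSn.
have b0 : 0 <= base := le_trans ler01 base1.
rewrite exprM ler_pXn2r ?nnegrE ?exprn_ge0 ?(ltW B0) //; apply/negP; rewrite -ltNge.
have -> : B ^+ 3 = ((17 / 2) ^+ 3) ^+ n * m%:R ^+ (4 * 3).
  by rewrite /B exprMn exprAC -[(m%:R ^+ 4) ^+ 3]exprM.
have -> : base ^+ 7 = ((17 / 6) ^+ 7) ^+ n * m%:R ^+ (3 * 7).
  by rewrite baseE exprMn exprAC -[(m%:R ^+ 3) ^+ 7]exprM.
apply: (@lt_le_trans _ _ (((17 / 6) ^+ 7) ^+ n * m%:R ^+ (4 * 3))).
  rewrite ltr_pM2r ?exprn_gt0 ?ltr0n // ltr_pXn2r ?nnegrE ?exprn_ge0 ?divr_ge0 //; lra.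
by rewrite ler_wpM2l ?exprn_ge0 ?divr_ge0 // ler_weXn2l.
Qed.

End Lattices.

(** * The two cases *)

(** The indices are the points of the projective line over the field with p elements; the index p
    stands for the point at infinity. *)
Lemma projective_class (p : nat) (x y : int) : prime p ->
  exists j : 'I_p.+1, if (j < p)%N then (p %| x - j%:Z * y)%Z else (p %| y)%Z.
Proof.
move=> pp; case: (boolP (p %| y)%Z) => py; first by exists ord_max; rewrite ltnn.
have cop : coprimez p y by rewrite coprimezE prime_coprime.
case/coprimezP: cop => [[u v] /= uv].
have p0 : (p : int) != 0 by rewrite eqz_nat -lt0n prime_gt0.
(* As v is an inverse of y modulo p, this is the residue of x / y. *)
have jlt : (absz ((v * x) %% p)%Z < p)%N.
  by rewrite -ltz_nat gez0_abs ?modz_ge0 // ltz_pmod // ltz_nat prime_gt0.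
exists (Ordinal (ltnW jlt : absz ((v * x) %% p)%Z < p.+1)%N) => /=; rewrite jlt.
rewrite gez0_abs ?modz_ge0 //.
have -> : ((v * x) %% p)%Z = v * x - ((v * x) %/ p)%Z * p by rewrite [X in _ = X - _](divz_eq (v * x) p) addrAC subrr add0r.
move: ((v * x) %/ p)%Z => w.
have -> : x - (v * x - w * p) * y = (x * u + w * y) * p.
  transitivity (x * (u * p + v * y) - (v * x - w * p) * y); first by rewrite uv mulr1.
  by ring.
by rewrite dvdz_mull.
Qed.

Lemma coprimez_combine (a b c d u v : int) :
  coprimez (a * u + b * v) (c * u + d * v) -> coprimez u v.
Proof.
case/coprimezP => [[s t] /= E]; apply/coprimezP; exists (s * a + t * c, s * b + t * d) => /=.
by rewrite -E; ring.
Qed.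

Section Counting.
Variables (R : realType) (n m : nat) (f : {poly int}) (l : 'I_n -> R[i] * R[i]).
Hypotheses (n3 : (3 <= n)%N) (m0 : (0 < m)%N) (hf : minimal_at_roots R f n).
Hypotheses (fl : factors f l) (disc1 : 1 <= disc2 l).
Variable S : seq (int * int).
Hypothesis uS : uniq S.
Hypothesis hS : forall x, x \in S ->
  [/\ 0 < x.2, coprimez x.1 x.2 & `|hev n f x.1 x.2| <= m%:Z].

Let n1 : (1 < n)%N. Proof. exact: leq_trans n3. Qed.
Let B : R := (17 / 2) ^+ n * m%:R ^+ 4.

Let prod_bounds x : x \in S -> 0 < \prod_i modulus (lin (l i) x.1%:~R x.2%:~R) <= m%:R.
Proof.
move=> xS; have [x2 _ xm] := hS xS; rewrite -(factors_int _ _ fl) ltr0z normr_gt0.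
rewrite (hev_neq0 n1 hf); last first.
  by apply: contraTneq x2 => -[_ ->]; rewrite ltxx.
by rewrite -[m%:R]/((m : int)%:~R) ler_int.
Qed.

Let B8 : 8 ^+ n * m%:R ^+ 4 <= B.
Proof.
rewrite /B ler_wpM2r ?exprn_ge0 ?ler0n // lerXn2r ?nnegrE ?divr_ge0 //; lra.
Qed.

Let B1 : 1 <= B.
Proof. by rewrite mulr_ege1 // exprn_ege1 ?ler1n //; lra. Qed.

Let count_large T : mahler l <= T -> 8 ^+ n * m%:R ^+ 4 <= T ->
  (size S <= size [seq x : int * int <- S | ((x.2%:~R : R) <= T ^+ 3)%R] + 26 * n)%N.
Proof.
move=> MT mT; rewrite -(count_predC (fun x : int * int => (x.2%:~R : R) <= T ^+ 3) S).
rewrite -size_filter leq_add2l -size_filter.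
apply: (large_solutions n3 hf fl disc1 MT m0 mT); first exact: filter_uniq.
move=> x; rewrite mem_filter /= => /andP[xT xS]; have [x2 cx xm] := hS xS.
by split=> //; rewrite ltW // ltNge.
Qed.

Lemma count_split P : prime P -> B ^+ 2 <= (P%:R / 2) ^+ n -> mahler l <= B ->
  (size S <= P.+1 * (8 * n).-1 + 26 * n)%N.
Proof.
move=> pP BP MB; apply: leq_trans (count_large MB B8) _; rewrite leq_add2r.
set S0 := filter _ S.
have hS0 x : x \in S0 -> [/\ x.2%:~R <= B ^+ 3 :> R, x \in S & 0 < x.2].
  by rewrite mem_filter => /andP[h xS]; have [x2 _ _] := hS xS.
have P0 : (P : int) != 0 by rewrite eqz_nat -lt0n prime_gt0.
have PZ0 : (0 : int) < P by rewrite ltz_nat prime_gt0.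
have /boolp.choice[c hc] := fun x : int * int => projective_class x.1 x.2 pP.
rewrite -sum1_size (partition_big c xpredT) //=.
apply: leq_trans (_ : \sum_(j < P.+1) (8 * n).-1 <= _)%N; last by rewrite sum_nat_const card_ord.
apply: leq_sum => j _; rewrite sum1_count -size_filter.
rewrite -ltnS prednK ?muln_gt0 ?(ltnW n1) //.
set Sj := filter _ S0.
have a0 i : (l i).1 != 0 := lead_form_neq0 n1 hf fl i.
have PC : (P : int)%:~R != 0 :> R[i] by rewrite intr_eq0.
(* [g] gives the coordinates in the basis (a, c0), (b, d) of the sublattice. As the second
   coordinate does not grow, the bound B^3 persists. *)
have core (a b c0 d : int) (g : int * int -> int * int) : a * d - b * c0 = P%:Z ->
    (forall i, lin (l i) a%:~R c0%:~R != 0) ->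
    (forall x, x \in Sj -> [/\ a * (g x).1 + b * (g x).2 = x.1, c0 * (g x).1 + d * (g x).2 = x.2,
       0 < (g x).2 & (g x).2 <= x.2]) -> (size Sj < 8 * n)%N.
  move=> det ac hg; rewrite -(size_map g).
  apply: (@class_small R n m P l n3 m0 disc1 BP a b c0 d) => //.
    rewrite map_inj_in_uniq ?filter_uniq // => x x' xS xS' gg.
    have [E1 E2 _ _] := hg x xS; have [E1' E2' _ _] := hg x' xS'.
    rewrite gg in E1 E2; apply/eqP; rewrite -pair_eqE /pair_eq /=.
    by rewrite -E1 -E2 E1' E2' !eqxx.
  move=> _ /mapP[x xSj ->]; have [E1 E2 g0 gx] := hg x xSj.
  move: xSj; rewrite mem_filter => /andP[_ xS0]; have [xB xS x2] := hS0 x xS0.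
  have [_ cx _] := hS xS; rewrite E1 E2; split=> //.
  - by apply: (@coprimez_combine a b c0 d); rewrite E1 E2.
  - by apply: le_trans xB; rewrite ler_int.
  - exact: prod_bounds.
have cj x : x \in Sj -> if (j < P)%N then (P %| x.1 - j%:Z * x.2)%Z else (P %| x.2)%Z.
  by rewrite mem_filter => /andP[/eqP <- _]; exact: hc.
have x2j x : x \in Sj -> 0 < x.2.
  by rewrite mem_filter => /andP[_ xS]; have [] := hS0 x xS.
move: cj; case: (j < P)%N => cj.
  (* The lattice of the pairs with x = j y modulo P has the basis (P, 0), (j, 1). *)
  apply: (core P j 0 1 (fun x => (((x.1 - j%:Z * x.2) %/ P)%Z, x.2))).
  - by rewrite mulr1 mulr0 subr0.
  - by move=> i; rewrite /lin mulr0 addr0 mulf_neq0.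
  - move=> x xS; split=> //=; [|by rewrite mul0r mul1r add0r|exact: x2j].
    by rewrite mulrC divzK ?cj // subrK.
(* At infinity P divides y, and the basis is (1, 0), (0, P). *)
apply: (core 1 0 0 P (fun x => (x.1, (x.2 %/ P)%Z))).
- by rewrite mul1r mul0r subr0.
- by move=> i; rewrite /lin mulr0 addr0 mulr1.
- move=> x xS; have x2 := x2j x xS; have E := divzK (cj x xS); split=> /=.
  + by rewrite mul1r mul0r addr0.
  + by rewrite mul0r add0r mulrC.
  + by rewrite -(pmulr_lgt0 _ PZ0) E.
  + by rewrite -[leRHS]E ler_peMr // -?gtz0_ge1 // -(pmulr_lge0 _ PZ0) E ltW.
Qed.

(** Near-minimality bounds the measure in every unimodular basis below by T / 2. As base = T / (2 m
    3^n) satisfies base^4 >= T, 16 n factors would give T^(4 n), beyond T^(3 n); with n exceptions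
    this leaves at most 17 n small solutions. *)
Lemma count_minimal : B < mahler l ->
  (forall p q r s : int, p * s - q * r = 1 -> mahler l / 2 <= mahler (lact l p q r s)) ->
  (size S <= 17 * n + 26 * n)%N.
Proof.
move=> BM hM; set T := mahler l in BM hM *.
apply: leq_trans (count_large (lexx T) (le_trans B8 (ltW BM))) _; rewrite leq_add2r.
set S0 := filter _ S.
have hS0 x : x \in S0 -> x.2%:~R <= T ^+ 3 :> R /\ x \in S.
  by rewrite mem_filter => /andP[].
have T1 : 1 <= T by exact: le_trans B1 (ltW BM).
have Tp : 0 < T := lt_le_trans ltr01 T1.
have m1 : 1 <= m%:R :> R by rewrite ler1n.
have mp : 0 < m%:R :> R by rewrite ltr0n.
have n0 : (0 < n)%N by exact: ltnW.
pose base : R := T / 2 / (m%:R * 3 ^+ n).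
have den : 0 < m%:R * 3 ^+ n :> R by rewrite mulr_gt0 ?exprn_gt0.
(* It suffices that 16 (m 3^n)^4 <= B^3, which follows from 3^n >= 16 and (17/2)^3 >= 3 * 81. *)
have baseT : T <= base ^+ 4.
  rewrite /base !expr_div_n ler_pdivlMr ?exprn_gt0 // ler_pdivlMr ?exprn_gt0 //.
  rewrite -mulrA exprS; apply: ler_wpM2l; first exact: ltW.
  apply: le_trans (_ : B ^+ 3 <= _); last by rewrite lerXn2r ?nnegrE ?(le_trans ler01) // ltW.
  have -> : B ^+ 3 = ((17 / 2) ^+ 3) ^+ n * m%:R ^+ (4 * 3).
    by rewrite /B exprMn exprAC -[(m%:R ^+ 4) ^+ 3]exprM.
  have -> : (m%:R * 3 ^+ n) ^+ 4 * 2 ^+ 4 = (2 ^+ 4 * (3 ^+ 4) ^+ n) * m%:R ^+ 4 :> R.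
    by rewrite exprMn exprAC; ring.
  apply: ler_pM; rewrite ?mulr_ge0 ?exprn_ge0 ?exprn_ge0 ?ler0n //; last by rewrite ler_weXn2l.
  apply: le_trans (_ : 3 ^+ n * (3 ^+ 4) ^+ n <= _).
    apply: ler_wpM2r; first by rewrite !exprn_ge0.
    apply: le_trans (_ : 3 ^+ 3 <= _); [lra|by rewrite ler_weXn2l // ler1n].
  by rewrite -exprMn lerXn2r ?nnegrE ?mulr_ge0 ?exprn_ge0 ?divr_ge0 //; lra.
have b0 : 0 <= base by rewrite !divr_ge0 // ltW.
have base1 : 1 <= base.
  rewrite leNgt; apply/negP => blt.
  have : base ^+ 4 < 1 by rewrite exprn_ilt1.
  by rewrite ltNge (le_trans T1 baseT).
rewrite leqNgt; apply/negP => sS.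
have H : base ^+ (size S0 - n) <= (T ^+ 3) ^+ n.
  apply: (@small_solutions R n m l (T / 2) (T ^+ 3)) => //.
  - by rewrite exprn_ege1.
  - exact: (lead_form_neq0 n1 hf fl).
  - exact: filter_uniq.
  - move=> x xS0; have [xT xS] := hS0 x xS0; have [x2 cx _] := hS xS.
    by split=> //; exact: prod_bounds.
have : base ^+ (4 * 4 * n) <= (T ^+ 3) ^+ n.
  apply: le_trans H; rewrite ler_weXn2l // leq_subRL; last by apply: leq_trans (ltnW sS); rewrite leq_pmull.
  by apply: leq_trans (ltnW sS); rewrite -mulSn.
rewrite exprM ler_pXn2r ?nnegrE ?exprn_ge0 ?(ltW Tp) //; apply/negP; rewrite -ltNge.
apply: lt_le_trans (_ : T ^+ 4 <= _); last by rewrite exprM lerXn2r ?nnegrE ?exprn_ge0 ?(ltW Tp).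
rewrite ltr_eXn2l //; apply: le_lt_trans BM; exact: B1.
Qed.

End Counting.

(** * The two cases combined *)

Lemma count_thue_list (R : realType) (n m P : nat) (f : {poly int}) (S : seq (int * int)) :
  (3 <= n)%N -> (0 < m)%N -> minimal_at_roots R f n -> prime P -> (150 <= P)%N ->
  ((17 / 2) ^+ n * m%:R ^+ 4) ^+ 2 <= (P%:R / 2) ^+ n :> R ->
  thue_list n m f S -> (size S <= 9 * n * P.+1)%N.
Proof.
move=> n3 m0 hf pP P150 BP tS; have n1 : (1 < n)%N by apply: leq_trans n3.
have [l fl disc1] := factorization n1 hf.
set B : R := _ * _ in BP.
have step (p q r s : int) : p * s - q * r = 1 ->
    [/\ minimal_at_roots R (subst_form n f p q r s) n,
      factors (subst_form n f p q r s) (lact l p q r s), 1 <= disc2 (lact l p q r s)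
      & exists S', [/\ uniq S', (size S <= (size S').+1)%N
        & forall x, x \in S' -> [/\ 0 < x.2, coprimez x.1 x.2
            & `|hev n (subst_form n f p q r s) x.1 x.2| <= m%:Z]]].
  move=> det; split.
  - by apply: (minimal_subst_form n1 hf); rewrite det.
  - exact: factors_subst.
  - by rewrite disc2_lact det modulus1 expr1n mul1r.
  - have [S1 tS1 <-] := thue_list_subst det tS.
    exact: thue_list_normalize tS1.
have [[[[[p q] r] s] det le]|nle] :=
  pselect (exists2 z : int * int * int * int, z.1.1.1 * z.2 - z.1.1.2 * z.1.2 = 1
    & mahler (lact l z.1.1.1 z.1.1.2 z.1.2 z.2) <= B).
  have [hf' fl' disc1' [S' [uS' sS' hS']]] := step _ _ _ _ det.
  apply: leq_trans sS' _.
  have := count_split n3 m0 hf' fl' disc1' uS' hS' pP BP le.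
  (* The difference between 8 n (P + 1) and 9 n (P + 1) covers the 26 n large solutions and the
     possible one with y = 0. *)
  have : (151 * n <= n * P.+1)%N by rewrite mulnC leq_mul2l ltnS P150 orbT.
  have -> : (P.+1 * (8 * n).-1 = 8 * (n * P.+1) - P.+1)%N.
    by rewrite -subn1 mulnBr muln1 mulnCA [(P.+1 * n)%N]mulnC.
  have -> : (9 * n * P.+1 = 9 * (n * P.+1))%N by rewrite mulnA.
  move: (size S') (n * P.+1)%N => a b; move: n3 P150; clear; lia.
pose E : set R := [set t | exists2 z : int * int * int * int,
  z.1.1.1 * z.2 - z.1.1.2 * z.1.2 = 1 & t = mahler (lact l z.1.1.1 z.1.1.2 z.1.2 z.2)]%classic.
have EB t : E t -> B < t.
  case=> z det ->; rewrite ltNge; apply/negP => le; apply: nle; by exists z.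
have Bp : 0 < B by rewrite mulr_gt0 ?exprn_gt0 ?divr_gt0 ?ltr0n.
have E0 : E (mahler (lact l 1 0 0 1)) by exists (1, 0, 0, 1) => //=; rewrite mulr1 mulr0 subr0.
have lbE : lbound E B by move=> t /EB/ltW.
have hinf : has_inf E by split; [exists (mahler (lact l 1 0 0 1))|exists B].
have Binf : B <= inf E by apply: lb_le_inf => //; exists (mahler (lact l 1 0 0 1)).
have infp : 0 < inf E := lt_le_trans Bp Binf.
(* The infimum serves as its own margin: being positive, it lets some equivalent form have a measure
   below twice the infimum. *)
have [t [[[[p q] r] s] /= det tE] tlt] := inf_adherent infp hinf.
have [hf' fl' disc1' [S' [uS' sS' hS']]] := step _ _ _ _ det.
apply: leq_trans sS' _.
have := count_minimal n3 m0 hf' fl' disc1' uS' hS'; rewrite -tE -/B => H.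
have {H} : (size S' <= 17 * n + 26 * n)%N.
  apply: H; first by apply: EB; exists (p, q, r, s).
  move=> a b c d abcd; rewrite mahler_lact2.
  apply: le_trans (_ : inf E <= _); first by rewrite ler_pdivrMr // mulr_natr mulr2n ltW.
  apply: ge_inf; first by exists B.
  exists (p * a + q * c, p * b + q * d, r * a + s * c, r * b + s * d) => //=.
  transitivity ((p * s - q * r) * (a * d - b * c)); first by ring.
  by rewrite det abcd mulr1.
have : (151 * n <= n * P.+1)%N by rewrite mulnC leq_mul2l ltnS P150 orbT.
have -> : (9 * n * P.+1 = 9 * (n * P.+1))%N by rewrite mulnA.
move: (size S') (n * P.+1)%N => a b; move: n3 P150; clear; lia.
Qed.

Local Open Scope classical_set_scope.

(** Since (7/2)^4 = 150.0625 and the power of n is at least 1, p / 2 >= 75 m^(8/n); and 75 >=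
    (17/2)^2 = 72.25. *)
Lemma prime_bound (R : realType) (n m p : nat) : (3 <= n)%N -> (0 < m)%N ->
  (m%:R : R) `^ (8 / n%:R) * (7 / 2) ^+ 4 * (n%:R : R) `^ (2 / (n%:R - 1)) <= p%:R ->
  (150 <= p)%N /\ ((17 / 2) ^+ n * m%:R ^+ 4) ^+ 2 <= (p%:R / 2) ^+ n :> R.
Proof.
move=> n3 m0; have n_gt0 : (0 < n)%N by apply: leq_trans n3.
set a : R := _ `^ (8 / _); set b : R := _ `^ _ => H.
have n0 : n%:R != 0 :> R by rewrite pnatr_eq0 -lt0n.
have n1R : 1 <= n%:R :> R by rewrite ler1n.
have n2R : 0 <= n%:R - 1 :> R by rewrite subr_ge0.
have b1 : 1 <= b.
  rewrite -(powRr0 (n%:R : R)); apply: ler_powR => //.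
  by rewrite divr_ge0.
have a1 : 1 <= a.
  rewrite -(powRr0 (m%:R : R)); apply: ler_powR; first by rewrite ler1n.
  by rewrite divr_ge0.
have an : a ^+ n = m%:R ^+ 8.
  have a0 : 0 <= a := le_trans ler01 a1.
  rewrite -(powR_mulrn n a0) /a -powRrM divfK // powR_mulrn //.
have pa : 150 * a <= p%:R.
  apply: le_trans H; rewrite [a * _]mulrC; apply: le_trans (_ : (7 / 2) ^+ 4 * a <= _).
    by apply: ler_wpM2r; [exact: le_trans ler01 a1|lra].
  by rewrite ler_peMr // mulr_ge0 ?exprn_ge0 ?divr_ge0 // (le_trans ler01).
split.
  rewrite -(ler_nat R); apply: le_trans pa.
  by rewrite ler_peMr.
have a0 : 0 <= a := le_trans ler01 a1.
have pa2 : 75 * a <= p%:R / 2 by lra.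
have {pa2} : (75 * a) ^+ n <= (p%:R / 2) ^+ n.
  by rewrite lerXn2r // nnegrE; [rewrite mulr_ge0|rewrite divr_ge0].
apply: le_trans; rewrite [leRHS]exprMn an.
have -> : ((17 / 2) ^+ n * m%:R ^+ 4) ^+ 2 = ((17 / 2) ^+ 2) ^+ n * m%:R ^+ 8 :> R.
  by rewrite exprMn exprAC -[(m%:R ^+ 4) ^+ 2]exprM.
apply: ler_wpM2r; first by rewrite exprn_ge0.
by rewrite lerXn2r ?nnegrE ?exprn_ge0 ?divr_ge0 //; lra.
Qed.

(** An infinite set has finite subsets of every size, so a uniform bound on finite subsets yields
    finiteness together with the count. *)
Lemma finite_card_bound (T : choiceType) (A : set T) (k : nat) :
  (forall X : {fset T}, [set` X] `<=` A -> (#|` X| <= k)%N) ->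
  finite_set A /\ (#|` fset_set A| <= k)%N.
Proof.
move=> H; have fA : finite_set A.
  apply: contrapT => infA; have [X XA] := infinite_set_fset k.+1 infA.
  by rewrite ltnNge H.
by split=> //; apply: H; rewrite fset_setK.
Qed.

Theorem theorem1p4 (R : realType) (n m p1 : nat) (F : {mpoly int[2]})
  (hn : (3 <= n)%N) (hF : F \is n.-homog) (hirr : irreducible_form F)
  (hm : (0 < m)%N)
  (hp1 : smallest_prime_ge
           ((m%:R : R) `^ (8 / n%:R) * (7 / 2) ^+ 4
             * (n%:R : R) `^ (2 / (n%:R - 1))) p1) :
  finite_set (primitive_solutions_upto_sign F m) /\
  (#|` fset_set (primitive_solutions_upto_sign F m)|%:R : R)
    <= (p1%:R + 1) * (9 * n%:R + 4 / (n%:R - 1)).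
Proof.
have [pp pB _] := hp1; have [p150 BP] := prime_bound hn hm pB.
have n1 : (1 < n)%N by apply: leq_trans hn.
have [f hf fE] := dehomogenization R n1 hF hirr.
set A := primitive_solutions_upto_sign F m.
have bound (X : {fset set (int * int)}) : [set` X] `<=` A -> (#|` X| <= 9 * n * p1.+1)%N.
  move=> XA.
  (* One representative of each class in X. A class is stable under sign, so distinct classes cannot
     have opposite representatives. *)
  have /boolp.choice[z hz] : forall c : set (int * int), exists z : int * int,
      c \in X -> primitive_solutions F m z /\ [set z; (- z.1, - z.2)] = c.
    move=> c; case: (boolP (c \in X)) => [cX|_]; last by exists (0, 0).
    by have [z zs zc] := XA c cX; exists z.
  have zinj : {in X &, injective z}.
    by move=> c d cX dX zz; rewrite -(hz c cX).2 -(hz d dX).2 zz.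
  rewrite -(size_map z (enum_fset X)).
  apply: (@count_thue_list R n m p1 f) => //; split.
  - by rewrite map_inj_in_uniq ?fset_uniq.
  - move=> _ /mapP[c cX ->]; apply/negP => /mapP[d dX E].
    have [[_ g1] cE] := hz c cX; have [_ dE] := hz d dX.
    have cd : c = d.
      by rewrite -cE -dE -E /= !opprK -(surjective_pairing (z c)) setUC.
    (* A representative equal to its own opposite would be (0, 0), whose gcd is 0. *)
    move: E; rewrite -cd; case: (z c) g1 => a b /= g1 [/eqP ea /eqP eb].
    move: g1; have -> : a = 0 by move: ea; clear; lia.
    by have -> : b = 0 by move: eb; clear; lia.
  - move=> _ /mapP[c cX ->]; have [[h1 h2] _] := hz c cX.
    by rewrite -fE; split=> //; rewrite /coprimez h2.
have [fin card] := finite_card_bound bound; split=> //.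
apply: le_trans (_ : (9 * n * p1.+1)%N%:R <= _); first by rewrite ler_nat.
rewrite natrM -[p1.+1%:R]natr1 [leLHS]mulrC natrM; apply: ler_wpM2l; first by rewrite addr_ge0.
by rewrite lerDl divr_ge0 // subr_ge0 ler1n ltnW.
Qed.
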